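(* Let $X$ be a simple random walk on $\mathbb{Z}^4$ started from the origin and $\mathcal{R}_n=\{X_0,\dots,X_n\}$. Then for any finite and nonempty set $A\subset\mathbb{Z}^4$, $$\lim_{n\to\infty}\frac{\log n}{n}\,\mathbb{E}\big[\mathrm{Cap}(\mathcal{R}_n+A)\big]=\frac{\pi^2}{8}.$$
   Context: Simple random walk on $\mathbb{Z}^4$: i.i.d. increments uniform on the $8$ neighbours of the origin. $\mathcal{R}_n+A=\{r+a:r\in\mathcal{R}_n,a\in A\}$ is the Minkowski sum. With $g(x)=\mathbb{E}\big[\sum_{n\ge0}\mathbf 1(X_n=x)\big]$ the Green's function, the capacity of a finite nonempty set $B\subset\mathbb{Z}^4$ is $\mathrm{Cap}(B)=\Big(\inf\big\{\sum_{x,y\in B}g(y-x)\nu(x)\nu(y):\nu\text{ probability measure on }B\big\}\Big)^{-1}$. *)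

(* Defs.v *)
From HB Require Import structures.
From mathcomp Require Import all_boot all_order all_algebra finmap.
From mathcomp Require Import all_classical all_reals all_analysis.

Set Implicit Arguments.
Unset Strict Implicit.
Unset Printing Implicit Defensive.

Import Order.TTheory GRing.Theory Num.Theory.
Import numFieldNormedType.Exports.

Local Open Scope classical_set_scope.
Local Open Scope ring_scope.

Notation Z4 := 'rV[int]_4.

(* The eight neighbours of the origin are the points with norm1 equal to 1. *)
Definition norm1 (x : Z4) : int := \sum_(i < 4) `|x ord0 i|.

Definition minkowski_sum (B C : set Z4) : set Z4 :=
  [set b + c | b in B & c in C].

(* Z4 carries the discrete sigma-algebra. *)
Definition discrete_rv d (T : measurableType d) (Y : T -> Z4) : Prop :=
  forall S : set Z4, measurable (Y @^-1` S).

Definition mutually_independent d (T : measurableType d) (R : realType)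
    (P : probability T R) (Y : nat -> T -> Z4) : Prop :=
  forall (J : {fset nat}) (S : nat -> set Z4),
    P (\bigcap_(j in [set` J]) (Y j @^-1` S j)) =
    (\prod_(j <- J) P (Y j @^-1` S j))%E.

Definition uniform_neighbour d (T : measurableType d) (R : realType)
    (P : probability T R) (Y : T -> Z4) : Prop :=
  forall e : Z4,
    P (Y @^-1` [set e]) = (if norm1 e == 1 then 8^-1 else 0 : R)%:E.

Definition increment (T : Type) (X : nat -> T -> Z4) (k : nat) (w : T) : Z4 :=
  X k.+1 w - X k w.

Definition simple_random_walk d (T : measurableType d) (R : realType)
    (P : probability T R) (X : nat -> T -> Z4) : Prop :=
  [/\ forall w, X 0%N w = 0,
      forall k, discrete_rv (increment X k),
      mutually_independent P (increment X) &
      forall k, uniform_neighbour P (increment X k)].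

Definition walk_range (T : Type) (X : nat -> T -> Z4) (n : nat) (w : T) :
    set Z4 :=
  [set X k w | k in [set k | (k <= n)%N]].

Definition green d (T : measurableType d) (R : realType)
    (P : probability T R) (X : nat -> T -> Z4) (x : Z4) : \bar R :=
  (\int[P]_w \sum_(0 <= n <oo) (X n w == x)%:R%:E)%E.

(* Probability measures on a finite set B, given by their mass functions. *)
Definition prob_on (R : realType) (B : set Z4) : set (Z4 -> R) :=
  [set nu | (forall x, B x -> 0 <= nu x) /\ \sum_(x \in B) nu x = 1].

Definition energy (R : realType) (g : Z4 -> \bar R) (B : set Z4)
    (nu : Z4 -> R) : \bar R :=
  (\sum_(x \in B) \sum_(y \in B) g (y - x)%R * (nu x)%:E * (nu y)%:E)%E.

(* Meaningful for B finite and nonempty. *)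
Definition capacity (R : realType) (g : Z4 -> \bar R) (B : set Z4) : \bar R :=
  ((ereal_inf [set energy g B nu | nu in @prob_on R B])^-1)%E.

(* Main.v *)
Require Import Defs.
From HB Require Import structures.
From mathcomp Require Import all_boot all_order all_algebra finmap.
From mathcomp Require Import all_classical all_reals all_analysis.
From mathcomp Require Import measurable_realfun.
From mathcomp Require Import ring lra zify.

Import Order.TTheory GRing.Theory Num.Theory.
Import numFieldNormedType.Exports.

Set Implicit Arguments.
Unset Strict Implicit.
Unset Printing Implicit Defensive.

Local Open Scope classical_set_scope.
Local Open Scope ring_scope.

(* The Green function [g] is only accessed through the explicit kernel
   [h_a x = 1 / (|x|^2 + a)]: with [q_a = h_a - avg h_a] one has [h_a = g * q_a],
   and [q_a] is positive with total mass tending to [pi^2 / 2] as [a] grows, which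
   encodes [g x ~ 2 / (pi^2 |x|^2)].  Moreover [avg (ln (|x|^2 + a))] exceeds
   [ln (|x|^2 + a)] by about [1 / (2 (|x|^2 + a))], so the expected sum of [h_a]
   along [n] steps is at most [2 ln n + O(1)].

   Lower bound.  Testing the energy with the local time of the walk gives
   [Cap >= (n+1)^2 / V], [V] being the sum of [g (X_k - X_j)] over [j, k <= n]; by
   Jensen it suffices that [f_n = sum_(k < n) P^k g] satisfies
   [f_n 0 <= (4 / pi^2 + o(1)) ln n].  Convolution of [f_n] with [q_a] is at most
   [2 ln n + O(1)], and near a maximum point [f_n] differs from its maximum by O(1).

   Upper bound.  For the equilibrium measure [nu] with energy [E], the potential of
   [nu] is at most [E], so the integral of [h_a (. - z)] against [nu] is at most
   [E * pi^2 / 2 * (1 + o(1))].  At a typical point of the range plus [A] the sum of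
   [h_a] over the whole walk is at least [4 (1 - o(1)) ln n], two independent
   pieces contributing [2 ln n] each; integrating against [nu] gives
   [1 / E <= (pi^2 / 8 + o(1)) n / ln n] plus the number of bad points.  Bad points
   are rare because a small power of [|X|^2 + b], corrected by the exponential of
   the sum of [h_a] along the path, is a supermartingale. *)

(** * Averaging over the eight neighbours *)

(** The constant comes from a continuum computation: in R^4 one eighth of the Laplacian of
    [1 / (|x|^2 + a)] is [- a / (|x|^2 + a)^3], and the integral of [a / (|x|^2 + a)^3] is
    [pi^2 / 2] for every [a]. On the lattice this holds up to errors that vanish as [a] grows, so
    [a] is fixed from the tolerance before [n] tends to infinity. With [Q = pi^2 / 2] the two halves
    meet: below, [V] has mean at most about [2 n (2 ln n / Q)], and above, the capacity is at most
    about [n Q / (4 ln n)]. Convolutions with [q_a] are only taken over finite sets, with explicit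
    errors. The set [A] disappears because a single translate of the path suffices below, while
    above its size only multiplies the number of bad points, which is [o(n / ln n)] in mean. *)

Definition unitv (i : 'I_4) : Z4 := delta_mx ord0 i.

Definition sqn (R : pzRingType) (x : Z4) : R := \sum_(i < 4) (x ord0 i)%:~R ^+ 2.

Definition avg (R : realType) (f : Z4 -> R) (x : Z4) : R :=
  (\sum_(i < 4) (f (x + unitv i) + f (x - unitv i))) / 8.

Definition avgn (R : realType) (n : nat) (f : Z4 -> R) : Z4 -> R :=
  iter n (@avg R) f.

Arguments avgn : simpl never.

Section averaging.
Variable R : realType.
Implicit Types (f g : Z4 -> R) (x y : Z4) (c : R).

Lemma sqn_ge0 x : 0 <= sqn R x.
Proof. by apply: sumr_ge0 => i _; exact: sqr_ge0. Qed.

Lemma unitvE i j : unitv i ord0 j = (j == i)%:R.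
Proof. by rewrite mxE eqxx. Qed.

Lemma sqnD x y : sqn R (x + y) =
  sqn R x + sqn R y + 2 * \sum_(i < 4) (x ord0 i)%:~R * (y ord0 i)%:~R.
Proof.
rewrite /sqn mulr_sumr -!big_split /=; apply: eq_bigr => i _.
by rewrite mxE rmorphD /=; ring.
Qed.

Lemma sqnN x : sqn R (- x) = sqn R x.
Proof. by apply: eq_bigr => i _; rewrite mxE rmorphN sqrrN. Qed.

Lemma dot_unitv (u : 'I_4 -> R) i :
  \sum_(j < 4) u j * (unitv i ord0 j)%:~R = u i.
Proof.
rewrite (bigD1 i) //= unitvE eqxx mulr1 big1 ?addr0 // => j /negbTE ji.
by rewrite unitvE ji mulr0.
Qed.

Lemma sqn_unitv i : sqn R (unitv i) = 1.
Proof.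
rewrite /sqn (bigD1 i) //= unitvE eqxx expr1n big1 ?addr0 // => j /negbTE ji.
by rewrite unitvE ji expr0n.
Qed.

Lemma sqnDunitv x i : sqn R (x + unitv i) = sqn R x + 1 + 2 * (x ord0 i)%:~R.
Proof. by rewrite sqnD sqn_unitv (dot_unitv (fun i => (x ord0 i)%:~R)). Qed.

Lemma sqnBunitv x i : sqn R (x - unitv i) = sqn R x + 1 - 2 * (x ord0 i)%:~R.
Proof.
rewrite -[x - _]opprK sqnN opprB addrC sqnD sqn_unitv sqnN.
rewrite (eq_bigr (fun j => - ((x ord0 j)%:~R * (unitv i ord0 j)%:~R))).
  by rewrite sumrN (dot_unitv (fun i => (x ord0 i)%:~R)) mulrN.
by move=> j _; rewrite mxE rmorphN /= mulNr.
Qed.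

Lemma coord_sqr_le_sqn x i : ((x ord0 i)%:~R : R) ^+ 2 <= sqn R x.
Proof.
rewrite /sqn (bigD1 i) //= lerDl; apply: sumr_ge0 => j _; exact: sqr_ge0.
Qed.

Lemma avg_le f g x : (forall y, f y <= g y) -> avg f x <= avg g x.
Proof.
move=> fg; rewrite /avg ler_wpM2r ?invr_ge0 //; apply: ler_sum => i _.
by rewrite lerD.
Qed.

Lemma eq_avg f g x : (forall y, f y = g y) -> avg f x = avg g x.
Proof. by move=> fg; apply/le_anti; rewrite !avg_le // => y; rewrite fg. Qed.

Lemma avgD f g x : avg (fun y => f y + g y) x = avg f x + avg g x.
Proof.
rewrite /avg -mulrDl -big_split /=; congr (_ / _); apply: eq_bigr => i _; ring.
Qed.

Lemma avgZ c f x : avg (fun y => c * f y) x = c * avg f x.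
Proof.
rewrite /avg mulrA mulr_sumr; congr (_ / _); apply: eq_bigr => i _; ring.
Qed.

Lemma avg_cst c x : avg (fun=> c) x = c.
Proof. by rewrite /avg !big_ord_recl big_ord0; field. Qed.

Lemma avgnS n f x : avgn n.+1 f x = avg (avgn n f) x.
Proof. by []. Qed.

Lemma avgnSr n f x : avgn n.+1 f x = avgn n (avg f) x.
Proof. by rewrite /avgn iterSr. Qed.

Lemma avgn_le n f g x : (forall y, f y <= g y) -> avgn n f x <= avgn n g x.
Proof. by elim: n x => [|n IH] x fg; [exact: fg | apply: avg_le => y; exact: IH]. Qed.

Lemma eq_avgn n f g x : (forall y, f y = g y) -> avgn n f x = avgn n g x.
Proof. by move=> fg; apply/le_anti; rewrite !avgn_le // => y; rewrite fg. Qed.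

Lemma avgnD n f g x : avgn n (fun y => f y + g y) x = avgn n f x + avgn n g x.
Proof.
elim: n x => [//|n IH] x.
by rewrite !avgnS -avgD; apply: eq_avg.
Qed.

Lemma avgnZ n c f x : avgn n (fun y => c * f y) x = c * avgn n f x.
Proof.
elim: n x => [//|n IH] x.
by rewrite !avgnS -avgZ; apply: eq_avg.
Qed.

Lemma avgn_cst n c x : avgn n (fun=> c) x = c.
Proof.
elim: n x => [//|n IH] x.
by rewrite !avgnS -[RHS](avg_cst c x); apply: eq_avg.
Qed.

Lemma avgnB n f g x : avgn n (fun y => f y - g y) x = avgn n f x - avgn n g x.
Proof.
rewrite (@eq_avgn _ _ (fun y => f y + -1 * g y)) => [|y]; last by rewrite mulN1r.
by rewrite avgnD avgnZ mulN1r.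
Qed.

Lemma avgn_sum (I : Type) (s : seq I) n (F : I -> Z4 -> R) x :
  avgn n (fun y => \sum_(i <- s) F i y) x = \sum_(i <- s) avgn n (F i) x.
Proof.
elim: s => [|i s IH].
  rewrite big_nil -[RHS](avgn_cst n 0 x); apply: eq_avgn => y.
  by rewrite big_nil.
by rewrite big_cons -IH -avgnD; apply: eq_avgn => y; rewrite big_cons.
Qed.

Lemma avgn_ge0 n f x : (forall y, 0 <= f y) -> 0 <= avgn n f x.
Proof. by move=> f0; rewrite -[leLHS](avgn_cst n 0 x); apply: avgn_le. Qed.

Lemma avg_shift f x z : avg (fun y => f (y + z)) x = avg f (x + z).
Proof.
rewrite /avg; congr (_ / _); apply: eq_bigr => i _.
by congr (f _ + f _); rewrite addrAC.
Qed.

Lemma avgn_shift n f x z : avgn n (fun y => f (y + z)) x = avgn n f (x + z).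
Proof.
elim: n x => [//|n IH] x.
by rewrite !avgnS -avg_shift; apply: eq_avg.
Qed.

Lemma avg_opp f x : avg (fun y => f (- y)) x = avg f (- x).
Proof.
rewrite /avg; congr (_ / _); apply: eq_bigr => i _.
by rewrite !opprD opprK addrC.
Qed.

Lemma avgn_opp n f x : avgn n (fun y => f (- y)) x = avgn n f (- x).
Proof.
elim: n x => [//|n IH] x.
by rewrite !avgnS -avg_opp; apply: eq_avg.
Qed.

Lemma avg_nbr_le f x i : (forall y, 0 <= f y) ->
  f (x + unitv i) <= 8 * avg f x /\ f (x - unitv i) <= 8 * avg f x.
Proof.
move=> f0.
rewrite /avg mulrC divfK // (bigD1 i) //=.
have S0 : 0 <= \sum_(j < 4 | j != i) (f (x + unitv j) + f (x - unitv j)).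
  by apply: sumr_ge0 => j _; rewrite addr_ge0.
by split; rewrite -addrA ?lerDl ?addr_ge0 // addrCA lerDl addr_ge0.
Qed.

Lemma avg_sqn x : avg (sqn R) x = sqn R x + 1.
Proof.
rewrite /avg (eq_bigr (fun=> 2 * (sqn R x + 1))).
  by rewrite !big_ord_recl big_ord0; field.
by move=> i _; rewrite sqnDunitv sqnBunitv; ring.
Qed.

Lemma avgn_sqn n x : avgn n (sqn R) x = sqn R x + n%:R.
Proof.
elim: n => [|n IH]; first by rewrite addr0.
rewrite avgnSr (eq_avgn _ _ avg_sqn) avgnD avgn_cst IH -natr1; ring.
Qed.

(* [Z^4] is connected, so a property propagating to neighbours holds everywhere. *)
Lemma Z4_ind (P : Z4 -> Prop) :
  P 0 -> (forall x i, P x -> P (x + unitv i) /\ P (x - unitv i)) ->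
  forall x, P x.
Proof.
move=> P0 PS.
have Pn (i : 'I_4) (k : nat) x : P x -> P (x + unitv i *+ k) /\ P (x - unitv i *+ k).
  elim: k => [|k IH] Px; first by rewrite mulr0n subr0 addr0.
  have [h1 h2] := IH Px; split.
    by rewrite mulrSr addrA; apply (PS _ i h1).
  by rewrite mulrSr opprD addrA; apply (PS _ i h2).
have Pz (i : 'I_4) (k : int) x : P x -> P (x + unitv i *~ k).
  move=> Px; case: k => k.
    by have [h _] := Pn i k _ Px; rewrite -pmulrn.
  by have [_ h] := Pn i k.+1 _ Px; rewrite NegzE mulrNz -pmulrn.
move=> x.
have -> : x = \sum_(i < 4) unitv i *~ x ord0 i.
  apply/rowP => j; rewrite summxE (bigD1 j) //= big1 => [|i ij].
    by rewrite -scaler_int intz mxE unitvE eqxx mulr1 addr0.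
  by rewrite -scaler_int intz mxE unitvE eq_sym (negbTE ij) mulr0.
elim/big_rec: _ => [//|i y _ Py].
by rewrite addrC; exact: Pz.
Qed.

End averaging.

(** * The kernel 1 / (|x|^2 + a) *)

Definition hker (R : realType) (a : R) (x : Z4) : R := (sqn R x + a)^-1.

Definition qker (R : realType) (a : R) (x : Z4) : R :=
  hker a x - avg (hker a) x.

Section kernel.
Variable R : realType.
Implicit Types (f g : Z4 -> R) (x y : Z4) (a b c : R).

Lemma sum_coord_sqr x : \sum_(i < 4) ((x ord0 i)%:~R : R) ^+ 2 = sqn R x.
Proof. by []. Qed.

Lemma sqn_nbr_gt0 a x i : 2 <= a ->
  0 < sqn R x + a + 1 + 2 * (x ord0 i)%:~R /\
  0 < sqn R x + a + 1 - 2 * (x ord0 i)%:~R.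
Proof.
move=> a2; have := coord_sqr_le_sqn R x i; set t := (_%:~R) => ht.
by split; nra.
Qed.

(** Opposite neighbours are paired: [1 / (w + 2t) + 1 / (w - 2t) = 2w / (w^2 - 4t^2)], which removes
    the odd terms of the expansion. *)
Lemma qkerE a x : 2 <= a -> let w := sqn R x + a + 1 in
  avg (hker a) x = (\sum_(i < 4) w / (w ^+ 2 - 4 * (x ord0 i)%:~R ^+ 2)) / 4.
Proof.
move=> a2 w; rewrite /avg -[8]/(2 * 4)%:R natrM invfM mulrA; congr (_ / _).
rewrite mulr_suml; apply: eq_bigr => i _.
rewrite /hker sqnDunitv sqnBunitv.
have [p1 p2] := sqn_nbr_gt0 x i a2.
rewrite /w.
move: p1 p2; set t := (_%:~R); set s := sqn R x => p1 p2.
rewrite -[4](_ : 2 ^+ 2 = 4); last by ring.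
rewrite -exprMn subr_sqr; field.
by rewrite !lt0r_neq0 //; lra.
Qed.

(* Expanding in [w = |x|^2 + a + 1], the lattice Laplacian of [1 / (|x|^2 + a)]
   is [- a / w^3] up to an error [O(1 / w^3)] uniform in [a]. *)
Lemma qker_ge a x : 8 <= a -> (a - 6) / (sqn R x + a + 1) ^+ 3 <= qker a x.
Proof.
move=> a8; rewrite /qker qkerE; last by lra.
set s := sqn R x; set w := s + a + 1.
have s0 : 0 <= s := sqn_ge0 R x.
have w0 : 9 <= w by rewrite /w; lra.
have w1 : 0 <= w by lra.
have term (i : 'I_4) : w / (w ^+ 2 - 4 * (x ord0 i)%:~R ^+ 2) <=
    w^-1 + 4 * (x ord0 i)%:~R ^+ 2 / w ^+ 3 +
    32 * s * (x ord0 i)%:~R ^+ 2 / w ^+ 5.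
  have := coord_sqr_le_sqn R x i; rewrite -/s; set t := (_%:~R) ^+ 2 => ht.
  have t0 : 0 <= t := sqr_ge0 _.
  clearbody t.
  have D : w ^+ 2 / 2 <= w ^+ 2 - 4 * t by rewrite expr2 /w in w0 *; nra.
  have D0 : 0 < w ^+ 2 / 2 by rewrite divr_gt0 // exprn_gt0 //; lra.
  have -> : w / (w ^+ 2 - 4 * t) =
    w^-1 + 4 * t / w ^+ 3 + 16 * t ^+ 2 / w ^+ 3 / (w ^+ 2 - 4 * t).
    by field; rewrite !lt0r_neq0 //; lra.
  rewrite lerD2l.
  apply: (@le_trans _ _ (16 * t ^+ 2 / w ^+ 3 / (w ^+ 2 / 2))).
    rewrite ler_wpM2l ?lef_pV2 ?posrE //; last by lra.
    by rewrite divr_ge0 ?exprn_ge0 ?mulr_ge0 ?exprn_ge0 //; lra.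
  have -> : 16 * t ^+ 2 / w ^+ 3 / (w ^+ 2 / 2) = 32 * t * t / w ^+ 5.
    by field; rewrite lt0r_neq0 //; lra.
  rewrite ler_wpM2r ?invr_ge0 ?exprn_ge0 //.
  by rewrite -!mulrA ler_wpM2l // ler_wpM2r.
have le1 : (\sum_(i < 4) w / (w ^+ 2 - 4 * (x ord0 i)%:~R ^+ 2)) / 4 <=
    w^-1 + s / w ^+ 3 + 8 / w ^+ 3.
  apply: (@le_trans _ _ (w^-1 + s / w ^+ 3 + 8 * s ^+ 2 / w ^+ 5)); last first.
    rewrite lerD2l.
    have -> : 8 * s ^+ 2 / w ^+ 5 = 8 / w ^+ 3 * (s / w) ^+ 2.
      by field; rewrite lt0r_neq0 //; lra.
    rewrite ler_piMr ?divr_ge0 ?exprn_ge0 //.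
    rewrite exprn_ile1 ?divr_ge0 //.
    by rewrite ler_pdivrMr ?mul1r /w; lra.
  rewrite ler_pdivrMr //; apply: le_trans (ler_sum _ (fun i _ => term i)) _.
  rewrite !big_split /= sumr_const card_ord -!mulr_suml -!mulr_sumr sum_coord_sqr.
  rewrite -/s le_eqVlt; apply/orP; left; apply/eqP.
  by rewrite -mulr_natr; field; rewrite lt0r_neq0 //; lra.
(* [hker a x] is [1 / (w - 1)], expanded from below to order three. With [s = w - 1 - a] the orders
   [w^-1] and [w^-2] cancel, and the numerator left over [w ^+ 3] is [1 + 1 + a - 8 = a - 6]. *)
have wm1 : w^-1 + w^-1 ^+ 2 + w^-1 ^+ 3 <= (s + a)^-1.
  have -> : s + a = w - 1 by rewrite /w; ring.
  rewrite -subr_ge0.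
  have -> : (w - 1)^-1 - (w^-1 + w^-1 ^+ 2 + w^-1 ^+ 3) = (w ^+ 3 * (w - 1))^-1.
    by field; rewrite !lt0r_neq0 //; lra.
  by rewrite invr_ge0 mulr_ge0 ?exprn_ge0 //; lra.
rewrite /hker -/s.
apply: (@le_trans _ _ (w^-1 + w^-1 ^+ 2 + w^-1 ^+ 3 - (w^-1 + s / w ^+ 3 + 8 / w ^+ 3))).
  rewrite le_eqVlt; apply/orP; left; apply/eqP.
  have -> : s = w - 1 - a by rewrite /w; ring.
  by field; rewrite lt0r_neq0 //; lra.
by rewrite lerB.
Qed.

(** The same expansion with the nonnegative remainder of the average dropped; doubling the last term
    in the expansion of [1 / (w - 1)] makes it an upper bound and produces [a + 3]. *)
Lemma qker_le a x : 8 <= a -> qker a x <= (a + 3) / (sqn R x + a + 1) ^+ 3.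
Proof.
move=> a8; rewrite /qker qkerE; last by lra.
set s := sqn R x; set w := s + a + 1.
have s0 : 0 <= s := sqn_ge0 R x.
have w0 : 9 <= w by rewrite /w; lra.
have w1 : 0 <= w by lra.
have term (i : 'I_4) : w^-1 + 4 * (x ord0 i)%:~R ^+ 2 / w ^+ 3 <=
    w / (w ^+ 2 - 4 * (x ord0 i)%:~R ^+ 2).
  have := coord_sqr_le_sqn R x i; rewrite -/s; set t := (_%:~R) ^+ 2 => ht.
  have t0 : 0 <= t := sqr_ge0 _.
  clearbody t.
  have D : 0 < w ^+ 2 - 4 * t by rewrite expr2 /w in w0 *; nra.
  have -> : w / (w ^+ 2 - 4 * t) =
    w^-1 + 4 * t / w ^+ 3 + 16 * t ^+ 2 / w ^+ 3 / (w ^+ 2 - 4 * t).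
    by field; rewrite !lt0r_neq0 //; lra.
  by rewrite lerDl !divr_ge0 ?mulr_ge0 ?exprn_ge0 //; lra.
have le1 : w^-1 + s / w ^+ 3 <=
    (\sum_(i < 4) w / (w ^+ 2 - 4 * (x ord0 i)%:~R ^+ 2)) / 4.
  rewrite ler_pdivlMr //; apply: le_trans (ler_sum _ (fun i _ => term i)).
  rewrite !big_split /= sumr_const card_ord -!mulr_suml -!mulr_sumr sum_coord_sqr.
  rewrite -/s le_eqVlt; apply/orP; left; apply/eqP.
  by rewrite -mulr_natr; field; rewrite lt0r_neq0 //; lra.
have wm1 : (s + a)^-1 <= w^-1 + w^-1 ^+ 2 + 2 * w^-1 ^+ 3.
  have -> : s + a = w - 1 by rewrite /w; ring.
  rewrite -subr_ge0.
  have -> : w^-1 + w^-1 ^+ 2 + 2 * w^-1 ^+ 3 - (w - 1)^-1 = (w - 2) / (w ^+ 3 * (w - 1)).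
    by field; rewrite !lt0r_neq0 //; lra.
  by rewrite divr_ge0 ?mulr_ge0 ?exprn_ge0 //; lra.
rewrite /hker -/s.
apply: (@le_trans _ _ (w^-1 + w^-1 ^+ 2 + 2 * w^-1 ^+ 3 - (w^-1 + s / w ^+ 3))).
  by rewrite lerB.
rewrite le_eqVlt; apply/orP; left; apply/eqP.
have -> : s = w - 1 - a by rewrite /w; ring.
by field; rewrite lt0r_neq0 //; lra.
Qed.

Lemma hker_gt0 a x : 0 < a -> 0 < hker a x.
Proof. by move=> a0; rewrite invr_gt0 ltr_wpDl // sqn_ge0. Qed.

Lemma hkerN a x : hker a (- x) = hker a x.
Proof. by rewrite /hker sqnN. Qed.

Lemma qker_gt0 a x : 8 <= a -> 0 < qker a x.
Proof.
move=> a8; apply: lt_le_trans (qker_ge x a8).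
by rewrite divr_gt0 ?exprn_gt0 //; have := sqn_ge0 R x; lra.
Qed.

Lemma avg_ln a x : 2 <= a -> avg (fun y => ln (sqn R y + a)) x =
  (\sum_(i < 4) ln ((sqn R x + a + 1) ^+ 2 - 4 * (x ord0 i)%:~R ^+ 2)) / 8.
Proof.
move=> a2; rewrite /avg; congr (_ / _); apply: eq_bigr => i _.
have [p1 p2] := sqn_nbr_gt0 x i a2.
rewrite sqnDunitv sqnBunitv -lnM ?posrE; [|lra|lra].
by congr ln; ring.
Qed.

Lemma le_ln_sub1 (z : R) : 0 < z -> ln z <= z - 1.
Proof. by move=> z0; have := @le_ln1Dx R (z - 1); rewrite addrCA subrr addr0; apply; lra. Qed.

Lemma ln_sub_le (u v : R) : 0 < u -> 0 < v -> ln u - ln v <= (u - v) / v.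
Proof.
move=> u0 v0; rewrite -ln_div ?posrE //; apply: le_trans (le_ln_sub1 _) _.
  exact: divr_gt0.
by rewrite mulrBl divff // gt_eqF.
Qed.

(** Averaging over paired neighbours loses at most [s / (2 w (w - 4)) <= 1 / (2 w)] from [ln w],
    while [ln w - ln (w - 1) >= 1 / w]; half of this gain survives. *)
Lemma avg_ln_ge a x : 8 <= a ->
  ln (sqn R x + a) + (2 * (sqn R x + a + 1))^-1 <=
  avg (fun y => ln (sqn R y + a)) x.
Proof.
move=> a8; rewrite avg_ln; last by lra.
set s := sqn R x; set w := s + a + 1.
have s0 : 0 <= s := sqn_ge0 R x.
have w0 : 9 <= w by rewrite /w; lra.
have w1 : 0 <= w by lra.
have term (i : 'I_4) : 2 * ln w - 4 * (x ord0 i)%:~R ^+ 2 / (w ^+ 2 - 4 * w) <=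
    ln (w ^+ 2 - 4 * (x ord0 i)%:~R ^+ 2).
  have := coord_sqr_le_sqn R x i; rewrite -/s; set t := (_%:~R) ^+ 2 => ht.
  have t0 : 0 <= t := sqr_ge0 _.
  clearbody t.
  have D' : 0 < w ^+ 2 - 4 * w by rewrite expr2; nra.
  have D : w ^+ 2 - 4 * w <= w ^+ 2 - 4 * t by rewrite /w in w0 *; lra.
  have W : 0 < w ^+ 2 by rewrite exprn_gt0 //; lra.
  have := @ln_sub_le (w ^+ 2) (w ^+ 2 - 4 * t) W (lt_le_trans D' D).
  rewrite lnXn; last by lra.
  rewrite -[ln w *+ 2]mulr_natl => le1.
  rewrite lerBlDr addrC -lerBlDr; apply: le_trans le1 _.
  have -> : w ^+ 2 - (w ^+ 2 - 4 * t) = 4 * t by ring.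
  rewrite ler_wpM2l ?mulr_ge0 //.
  by rewrite lef_pV2 ?posrE //; lra.
apply: (@le_trans _ _ (ln w - s / (w * (w - 4)) / 2)); last first.
  rewrite ler_pdivlMr //; apply: le_trans (ler_sum _ (fun i _ => term i)).
  rewrite sumrB sumr_const card_ord -!mulr_suml -!mulr_sumr sum_coord_sqr -/s.
  rewrite le_eqVlt; apply/orP; left; apply/eqP.
  rewrite -[(2 * ln w) *+ 4]mulr_natr.
  have -> : w ^+ 2 - 4 * w = w * (w - 4) by ring.
  by field; rewrite !lt0r_neq0 //; lra.
have le2 : ln (s + a) - ln w <= - w^-1.
  apply: le_trans (ln_sub_le _ _) _; [lra|lra|].
  have -> : s + a - w = -1 by rewrite /w; ring.
  by rewrite mulN1r.
have le3 : s / (w * (w - 4)) <= w^-1.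
  have -> : w^-1 = (w - 4) / (w * (w - 4)) by field; rewrite !lt0r_neq0 //; lra.
  by rewrite ler_wpM2r ?invr_ge0 ?mulr_ge0 // /w; lra.
have -> : (2 * w)^-1 = w^-1 / 2 by field; rewrite lt0r_neq0 //; lra.
lra.
Qed.

(** By [avg_ln_ge] each term is at most twice a one-step increase of the mean of [ln (|X|^2 + a)],
    so the sum telescopes; the parameter [a + 1] is the one appearing in that gain. *)
Lemma sum_avgn_hker a n x : 8 <= a ->
  \sum_(0 <= k < n) avgn k (hker (a + 1)) x <= 2 * ln (1 + n%:R / a).
Proof.
move=> a8.
pose L y := ln (sqn R y + a).
have s0 := sqn_ge0 R x.
have tele : \sum_(0 <= k < n) avgn k (hker (a + 1)) x <= 2 * (avgn n L x - L x).
  elim: n => [|n IH]; first by rewrite big_nil subrr mulr0.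
  rewrite big_nat_recr //= avgnSr.
  apply: le_trans (lerD IH (lexx _)) _.
  have : avgn n (fun y => L y + 2^-1 * hker (a + 1) y) x <= avgn n (avg L) x.
    apply: avgn_le => y; apply: le_trans (avg_ln_ge y a8).
    by rewrite /L /hker lerD2l addrA invfM.
  rewrite avgnD avgnZ; lra.
apply: le_trans tele _; rewrite ler_wpM2l //.
set z := sqn R x + n%:R + a.
have n0 : 0 <= n%:R :> R by [].
have z0 : 0 < z by rewrite /z; lra.
(* Jensen for the concave logarithm, through its tangent at [z], the mean of [|X_n|^2 + a]. *)
have le1 : avgn n L x <= ln z.
  apply: (@le_trans _ _ (avgn n (fun y => ln z + (z^-1 * (sqn R y + (a - z)))) x)).
    apply: avgn_le => y; rewrite -lerBlDl.
    apply: le_trans (ln_sub_le _ z0) _; first by have := sqn_ge0 R y; lra.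
    by rewrite mulrC addrA.
  rewrite avgnD avgnZ avgnD !avgn_cst avgn_sqn.
  have -> : sqn R x + n%:R + (a - z) = 0 by rewrite /z; ring.
  by rewrite mulr0 addr0.
apply: le_trans (lerB le1 (lexx _)) _.
rewrite /L -ln_div ?posrE //; last by lra.
rewrite ler_ln ?posrE; [|by rewrite divr_gt0 //; lra|by rewrite ltr_wpDr // divr_ge0 //; lra].
have -> : z / (sqn R x + a) = 1 + n%:R / (sqn R x + a).
  by rewrite /z; field; rewrite lt0r_neq0 //; lra.
rewrite lerD2l ler_wpM2l // lef_pV2 ?posrE; lra.
Qed.

Lemma avg_hker_le a x : 8 <= a -> avg (hker a) x <= hker a x.
Proof. by move=> a8; rewrite -subr_ge0 ltW // qker_gt0. Qed.

(** [hker a] is superharmonic, so its averages decrease in time and the last of [n + 1] terms is at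
    most their mean, which [sum_avgn_hker] bounds. *)
Lemma avgn_hker_le a n x : 9 <= a ->
  avgn n (hker a) x <= 2 * ln (1 + n.+1%:R / (a - 1)) / n.+1%:R.
Proof.
move=> a9; rewrite ler_pdivlMr //.
have -> : a = a - 1 + 1 by ring.
rewrite addrK; apply: le_trans (sum_avgn_hker _ _ _); last by lra.
rewrite subrK.
have decr m k : (m <= k)%N -> avgn k (hker a) x <= avgn m (hker a) x.
  move=> /subnK <-; elim: (k - m)%N => [//|j IH].
  apply: le_trans _ IH; rewrite addSn avgnSr; apply: avgn_le => y.
  by apply: avg_hker_le; lra.
apply: (@le_trans _ _ (\sum_(0 <= k < n.+1) avgn n (hker a) x)).
  by rewrite sumr_const_nat subn0 mulr_natr.
rewrite !big_nat; apply: ler_sum => k /= kn.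
exact: decr.
Qed.

End kernel.

(** * The Green function *)

Definition delta0 (R : realType) (x : Z4) : R := (x == 0)%:R.

Definition gpart (R : realType) (n : nat) (x : Z4) : R :=
  \sum_(0 <= k < n) avgn k (@delta0 R) x.

Definition ggreen (R : realType) (x : Z4) : R := limn (fun n => gpart R n x).

Section green_function.
Variable R : realType.
Implicit Types (f g : Z4 -> R) (x y : Z4) (a b c : R).

Lemma ln_le_div_add_ln (y K : R) : 0 < y -> 0 < K -> ln y <= y / K + ln K.
Proof.
move=> y0 K0; have := le_ln_sub1 (divr_gt0 y0 K0).
rewrite ln_div ?posrE //; lra.
Qed.

Lemma avgn_hker_small a (e : R) : 9 <= a -> 0 < e ->
  exists N : nat, forall n x, (N <= n)%N -> avgn n (hker a) x <= e.
Proof.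
move=> a9 e0.
pose K := 8 / e; have K0 : 0 < K by rewrite divr_gt0.
exists (Num.truncn (4 * `|ln K| / e)) => n x Nn.
apply: le_trans (avgn_hker_le _ _ a9) _.
have n1 : 0 < n.+1%:R :> R by [].
have n1' : 1 <= n.+1%:R :> R by rewrite ler1n.
have nl : 4 * `|ln K| / e < n.+1%:R.
  apply: lt_le_trans (truncnS_gt _) _.
  by rewrite ler_nat ltnS.
rewrite ler_pdivrMr // -[leRHS](divrK (x := 2)) ?unitfE // mulrC ler_pM2r //.
have p0 : 0 < 1 + n.+1%:R / (a - 1).
  by rewrite ltr_wpDr // divr_ge0 //; lra.
apply: le_trans (ln_le_div_add_ln p0 K0) _.
have le1 : 1 + n.+1%:R / (a - 1) <= 2 * n.+1%:R.
  have : n.+1%:R / (a - 1) <= n.+1%:R by rewrite ler_pdivrMr ?ler_peMr //; lra.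
  lra.
have le2 : (1 + n.+1%:R / (a - 1)) / K <= e * n.+1%:R / 4.
  rewrite ler_pdivrMr //; apply: le_trans le1 _.
  by rewrite /K le_eqVlt; apply/orP; left; apply/eqP; field; rewrite gt_eqF.
have le3 : ln K <= e * n.+1%:R / 4.
  apply: le_trans (ler_norm _) _; move: nl; rewrite ltr_pdivrMr // => nl; lra.
lra.
Qed.

Lemma sum_avgn_qker a n x :
  \sum_(0 <= k < n) avgn k (qker a) x = hker a x - avgn n (hker a) x.
Proof.
elim: n => [|n IH]; first by rewrite big_nil subrr.
by rewrite big_nat_recr //= IH avgnB avgnSr addrA subrK.
Qed.

Lemma delta0_ge0 x : 0 <= delta0 R x.
Proof. by rewrite ler0n. Qed.

Lemma sum_delta0_le (F : seq Z4) g z : uniq F -> (forall y, 0 <= g y) ->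
  \sum_(y <- F) g y * delta0 R (z - y) <= g z.
Proof.
move=> uF g0; rewrite /delta0; case: (boolP (z \in F)) => zF; last first.
  rewrite big_seq big1 // => y yF; rewrite subr_eq0.
  by case: eqP => [zy|_]; [rewrite zy yF in zF | rewrite mulr0].
rewrite (bigD1_seq z) //= subrr eqxx mulr1 big1 ?addr0 // => y yz.
by rewrite subr_eq0 eq_sym (negbTE yz) mulr0.
Qed.

Lemma gpart_nondecreasing x : nondecreasing_seq (fun n => gpart R n x).
Proof.
apply/nondecreasing_seqP => n; rewrite /gpart big_nat_recr //= lerDl.
by apply: avgn_ge0 => y; exact: delta0_ge0.
Qed.

(** [qker a] dominates [qker a 0] times [delta0], so the partial Green sums are bounded by a
    telescoping sum. This yields transience and the decay of the Green function at once. *)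
Lemma gpart_le a n x : 8 <= a -> gpart R n x <= hker a x / qker a 0.
Proof.
move=> a8; have q0 := @qker_gt0 R a 0 a8.
rewrite ler_pdivlMr // mulrC /gpart mulr_sumr.
apply: (@le_trans _ _ (\sum_(0 <= k < n) avgn k (qker a) x)).
  apply: ler_sum => k _; rewrite -avgnZ; apply: avgn_le => y.
  rewrite /delta0; case: eqP => [->|_]; first by rewrite mulr1.
  by rewrite mulr0 ltW // qker_gt0.
rewrite sum_avgn_qker gerBl; apply: avgn_ge0 => y.
by rewrite ltW // hker_gt0 //; lra.
Qed.

Lemma gpart_cvg x : gpart R n x @[n --> \oo] --> ggreen R x.
Proof.
apply: nondecreasing_is_cvgn; first exact: gpart_nondecreasing.
by exists (hker 9 x / qker 9 0) => _ [n _ <-]; apply: gpart_le; lra.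
Qed.

Lemma gpart_le_ggreen n x : gpart R n x <= ggreen R x.
Proof.
apply: nondecreasing_cvgn_le; first exact: gpart_nondecreasing.
exact: gpart_cvg.
Qed.

Lemma ggreen_le x M : (forall n, gpart R n x <= M) -> ggreen R x <= M.
Proof.
move=> h; apply: limr_le; first exact: gpart_cvg.
by near=> n; exact: h.
Unshelve. all: by end_near. Qed.

Lemma ggreen_ge0 x : 0 <= ggreen R x.
Proof. by apply: le_trans (gpart_le_ggreen 0 x); rewrite /gpart big_nil. Qed.

Lemma ggreen0_ge1 : 1 <= ggreen R 0.
Proof.
apply: le_trans (gpart_le_ggreen 1 0).
by rewrite /gpart big_nat1 /avgn /= /delta0 eqxx.
Qed.

Lemma ggreen_le_hker a x : 8 <= a -> ggreen R x <= hker a x / qker a 0.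
Proof. by move=> a8; apply: ggreen_le => n; exact: gpart_le. Qed.

Lemma ggreen_bounded : exists C : R, forall x, ggreen R x <= C.
Proof.
exists (8^-1 / qker 8 0) => x; apply: le_trans (@ggreen_le_hker 8 x _) _ => //.
rewrite ler_wpM2r ?invr_ge0 ?(ltW (qker_gt0 _ _)) //.
by rewrite /hker lef_pV2 ?posrE //; have := sqn_ge0 R x; lra.
Qed.

Lemma ggreenN x : ggreen R (- x) = ggreen R x.
Proof.
rewrite /ggreen; congr (limn _); apply/funext => n; apply: eq_bigr => k _.
rewrite -avgn_opp; apply: eq_avgn => y; by rewrite /delta0 oppr_eq0.
Qed.

Lemma cvg_sum_seq (T I : Type) (H : set_system T) (FH : Filter H) (s : seq I)
    (F : I -> T -> R) (l : I -> R) :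
  (forall i, F i t @[t --> H] --> l i) ->
  \sum_(i <- s) F i t @[t --> H] --> \sum_(i <- s) l i.
Proof.
move=> Fl; elim: s => [|i s IH].
  by rewrite big_nil; under eq_fun do rewrite big_nil; exact: cvg_cst.
rewrite big_cons; under eq_fun do rewrite big_cons.
by apply: cvgD; [exact: Fl | exact: IH].
Qed.

Lemma avg_cvg (F : nat -> Z4 -> R) f x : (forall y, F n y @[n --> \oo] --> f y) ->
  avg (F n) x @[n --> \oo] --> avg f x.
Proof.
move=> Ff; apply: cvgMr_tmp.
apply: cvg_sum_seq => i; apply: cvgD; exact: Ff.
Qed.

Lemma ggreen_eq x : ggreen R x = delta0 R x + avg (ggreen R) x.
Proof.
have h1 : delta0 R x + avg (gpart R n) x @[n --> \oo] --> delta0 R x + avg (ggreen R) x.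
  by apply: cvgD; [exact: cvg_cst | apply: avg_cvg => y; exact: gpart_cvg].
have E n : delta0 R x + avg (gpart R n) x = gpart R n.+1 x.
  rewrite {2}/gpart big_nat_recl //; congr (_ + _).
  rewrite -[LHS]/(avgn 1 (gpart R n) x) /gpart avgn_sum.
  by apply: eq_bigr => k _.
move: h1; rewrite (_ : (fun n => _) = (fun n => gpart R n.+1 x)); last first.
  by apply/funext => n; rewrite E.
move=> h1; have h2 : gpart R n.+1 x @[n --> \oo] --> ggreen R x.
  by rewrite (cvg_shiftS (gpart R ^~ x)); exact: gpart_cvg.
by rewrite -(cvg_lim _ h2) // (cvg_lim _ h1).
Qed.

Lemma avgn_ggreen_small (e : R) : 0 < e ->
  exists N : nat, forall n x, (N <= n)%N -> avgn n (ggreen R) x <= e.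
Proof.
move=> e0; have q0 : 0 < qker 9 0 :> R by apply: qker_gt0; lra.
have [N HN] := @avgn_hker_small 9 (e * qker 9 0) (lexx _) (mulr_gt0 e0 q0).
exists N => n x Nn; apply: (@le_trans _ _ (avgn n (fun y => (qker 9 0)^-1 * hker 9 y) x)).
  by apply: avgn_le => y; rewrite mulrC; apply: ggreen_le_hker; lra.
by rewrite avgnZ mulrC ler_pdivrMr // HN.
Qed.

Lemma hker_ge_conv a (F : seq Z4) x : 8 <= a -> uniq F ->
  \sum_(y <- F) qker a y * ggreen R (x - y) <= hker a x.
Proof.
move=> a8 uF.
have h1 : \sum_(y <- F) qker a y * gpart R n (x - y) @[n --> \oo] -->
    \sum_(y <- F) qker a y * ggreen R (x - y).
  by apply: cvg_sum_seq => y; apply: cvgMl_tmp; exact: gpart_cvg.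
rewrite -(cvg_lim _ h1) //; apply: limr_le; first by apply/cvg_ex; eexists; exact: h1.
near=> n.
apply: (@le_trans _ _ (\sum_(0 <= k < n) avgn k (qker a) x)).
  rewrite (eq_bigr (fun y => \sum_(0 <= k < n) qker a y * avgn k (delta0 R) (x - y))).
    rewrite exchange_big /=; apply: ler_sum => k _.
    rewrite (eq_bigr (fun y => avgn k (fun z => qker a y * delta0 R (z - y)) x)).
      rewrite -avgn_sum; apply: avgn_le => z; apply: sum_delta0_le => // y.
      by rewrite ltW // qker_gt0.
    by move=> y _; rewrite avgnZ avgn_shift.
  by move=> y _; rewrite /gpart mulr_sumr.
rewrite sum_avgn_qker gerBl; apply: avgn_ge0 => y.
by rewrite ltW // hker_gt0 //; lra.
Unshelve. all: by end_near. Qed.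

(** Converse of [hker_ge_conv]: over [m] steps the part of [qker a] outside [F] adds at most
    [m%:R * e], and the telescoping leaves [avgn m (hker a) x]. In use [m] is chosen first, then
    [F]. *)
Lemma hker_le_conv a (F : seq Z4) (e : R) m x : 8 <= a -> uniq F -> 0 <= e ->
  (forall z, z \notin F -> qker a z <= e) ->
  hker a x <= \sum_(y <- F) qker a y * ggreen R (x - y) + m%:R * e + avgn m (hker a) x.
Proof.
move=> a8 uF e0 Fe.
rewrite -lerBlDr -sum_avgn_qker.
have q0 y : 0 <= qker a y :> R by rewrite ltW // qker_gt0.
have qle z : qker a z <= \sum_(y <- F) qker a y * delta0 R (z - y) + e.
  case: (boolP (z \in F)) => zF.
    rewrite (bigD1_seq z) //= subrr {1}/delta0 eqxx mulr1 -addrA lerDl addr_ge0 //.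
    by apply: sumr_ge0 => y _; rewrite mulr_ge0 ?delta0_ge0.
  apply: le_trans (Fe _ zF) _; rewrite lerDr.
  by apply: sumr_ge0 => y _; rewrite mulr_ge0 ?delta0_ge0.
apply: (@le_trans _ _ (\sum_(0 <= k < m) (\sum_(y <- F) qker a y * avgn k (delta0 R) (x - y) + e))).
  apply: ler_sum => k _; apply: le_trans (avgn_le _ _ qle) _.
  rewrite avgnD avgn_cst avgn_sum lerD2r le_eqVlt; apply/orP; left; apply/eqP.
  by apply: eq_bigr => y _; rewrite avgnZ avgn_shift.
rewrite big_split /= sumr_const_nat subn0 mulr_natl lerD2r exchange_big /=.
apply: ler_sum => y _; rewrite -mulr_sumr ler_wpM2l //.
exact: gpart_le_ggreen.
Qed.

End green_function.

(** * The truncated double Green sum and the maximum principle *)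

Definition fsum (R : realType) (n : nat) (x : Z4) : R :=
  \sum_(0 <= k < n) avgn k (@ggreen R) x.

Section truncated_double_green.
Variable R : realType.
Implicit Types (f g : Z4 -> R) (x y : Z4) (a b c : R).

(** [K] depends on [y] and [G] only, so it serves all [n] when [d] is the deficit of [fsum R n]
    below its supremum. It propagates along the lattice: a neighbour value is at most
    [8 * avg d y <= 8 * (K + G)]. *)
Lemma avg_almost_superharmonic_bound (G : R) y : 0 <= G ->
  exists K : R, forall d : Z4 -> R, (forall x, 0 <= d x) ->
  (forall x, avg d x <= d x + G) -> d 0 <= 1 -> d y <= K.
Proof.
move=> G0; elim/Z4_ind: y => [|y i [K HK]]; first by exists 1.
have h d : (forall x, 0 <= d x) -> (forall x, avg d x <= d x + G) ->
    d 0 <= 1 -> 8 * avg d y <= 8 * (K + G).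
  move=> d0 dG d1; rewrite ler_wpM2l //; apply: le_trans (dG y) _.
  by rewrite lerD2r; exact: HK.
split; exists (8 * (K + G)) => d d0 dG d1; apply: le_trans (h d d0 dG d1);
  by have [h1 h2] := @avg_nbr_le R d y i d0.
Qed.

Lemma fsum_le_nat n x C : (forall y, ggreen R y <= C) -> fsum R n x <= n%:R * C.
Proof.
move=> gC; rewrite /fsum mulr_natl -{2}(subn0 n) -sumr_const_nat.
apply: ler_sum => k _; rewrite -[leRHS](avgn_cst k C x); exact: avgn_le.
Qed.

Lemma fsum_ge0 n x : 0 <= fsum R n x.
Proof. by apply: sumr_ge0 => k _; apply: avgn_ge0 => y; exact: ggreen_ge0. Qed.

Lemma fsum_le n m x : (n <= m)%N -> fsum R n x <= fsum R m x.
Proof.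
move=> nm; rewrite /fsum (big_cat_nat _ nm) //= lerDl.
by apply: sumr_ge0 => k _; apply: avgn_ge0 => y; exact: ggreen_ge0.
Qed.

Lemma avg_fsum n x : avg (fsum R n) x = fsum R n x - ggreen R x + avgn n (ggreen R) x.
Proof.
rewrite -[LHS]/(avgn 1 (fsum R n) x) /fsum avgn_sum.
rewrite (eq_bigr (fun k => avgn k.+1 (ggreen R) x)) //.
have := @big_nat_recl R 0 +%R n 0 (fun k => avgn k (ggreen R) x) (leq0n n).
rewrite big_nat_recr //= [avgn 0 _ _]/avgn /= => h.
by apply: (addrI (ggreen R x)); rewrite -h; ring.
Qed.

(* Near a maximum point of [fsum n] its values differ from the maximum by a
   constant independent of [n], so averaging [fsum n] against [qker] recovers
   the maximum up to a bounded error. *)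
Lemma fsum_bound a (F : seq Z4) : 8 <= a -> uniq F ->
  exists C : R, forall n,
  (\sum_(y <- F) qker (a + 1) y) * fsum R n 0 <= C + 2 * ln (1 + n%:R / a).
Proof.
move=> a8 uF.
have [G HG] := ggreen_bounded R.
have G0 : 0 <= G := le_trans (ggreen_ge0 R 0) (HG 0).
have a8' : 8 <= a + 1 by lra.
have q0 y : 0 <= qker (a + 1) y :> R by rewrite ltW // qker_gt0.
have [K HK] : exists K : Z4 -> R, forall y (d : Z4 -> R), (forall x, 0 <= d x) ->
  (forall x, avg d x <= d x + G) -> d 0 <= 1 -> d y <= K y.
  have /choice [K HK] := fun y => @avg_almost_superharmonic_bound G y G0.
  by exists K.
exists (\sum_(y <- F) qker (a + 1) y * K y) => n.
have ub : has_ubound (range (fsum R n)).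
  by exists (n%:R * G) => _ [x _ <-]; exact: fsum_le_nat.
have hs : has_sup (range (fsum R n)) by split => //; exists (fsum R n 0); exists 0.
set M := sup (range (fsum R n)).
have leM x : fsum R n x <= M by apply: ub_le_sup => //; exists x.
(* The supremum may only be approached; a point within 1 of it suffices, since the deficit enters
   through [d 0 <= 1]. *)
have [_ [z _ <-] zM] := sup_adherent (@ltr01 R) hs.
pose d y := M - fsum R n (z - y).
have dK y : d y <= K y.
  apply: HK => [x|x|]; rewrite /d.
  - by rewrite subr_ge0.
  - rewrite -[leLHS]/(avgn 1 (fun y => M - fsum R n (z - y)) x) avgnB avgn_cst.
    rewrite (_ : avgn 1 _ x = avg (fsum R n) (z - x)); last first.
      rewrite /avgn /= -[z - x]opprB -avg_opp.
      rewrite -(avg_shift (fun y => fsum R n (- y))).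
      by apply: eq_avg => t; rewrite opprB.
    rewrite avg_fsum; have := HG (z - x).
    have : 0 <= avgn n (ggreen R) (z - x) by apply: avgn_ge0 => t; exact: ggreen_ge0.
    lra.
  - by rewrite subr0 -/M in zM *; lra.
have le1 : \sum_(y <- F) qker (a + 1) y * fsum R n (z - y) <= 2 * ln (1 + n%:R / a).
  apply: le_trans (sum_avgn_hker n z a8).
  rewrite (eq_bigr (fun y => \sum_(0 <= k < n) qker (a + 1) y * avgn k (ggreen R) (z - y))).
    rewrite exchange_big /=; apply: ler_sum => k _.
    rewrite (eq_bigr (fun y => avgn k (fun x => qker (a + 1) y * ggreen R (x - y)) z)).
      rewrite -avgn_sum; apply: avgn_le => x; exact: hker_ge_conv.
    by move=> y _; rewrite avgnZ avgn_shift.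
  by move=> y _; rewrite /fsum mulr_sumr.
apply: le_trans (lerD (lexx _) le1).
rewrite mulr_suml -big_split /=; apply: ler_sum => y _.
rewrite -mulrDr ler_wpM2l //; have := dK y; have := leM 0; rewrite /d; lra.
Qed.

(** The positive part of [u - E] is subharmonic: it vanishes where [u <= E], and elsewhere
    [u <= avg u]. It is thus below all its iterated averages, which are dominated by those of [u]
    and become arbitrarily small. *)
Lemma max_principle (u : Z4 -> R) (E : R) :
  (forall x, 0 <= u x) -> 0 <= E -> (forall x, u x <= E \/ u x <= avg u x) ->
  (forall e : R, 0 < e -> exists m, forall x, avgn m u x <= e) ->
  forall x, u x <= E.
Proof.
move=> u0 E0 uE um x.
pose v y := Num.max (u y - E) 0.
have v0 y : 0 <= v y by rewrite /v le_max lexx orbT.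
have v_sub y : v y <= avg v y.
  have a0 : 0 <= avg v y by apply: (@avgn_ge0 _ 1).
  rewrite {1}/v ge_max a0 andbT; case: (uE y) => h; first by apply: le_trans a0; lra.
  apply: (@le_trans _ _ (avg u y - E)); first by rewrite lerD2r.
  have <- : avgn 1 (fun y => u y - E) y = avg u y - E by rewrite avgnB avgn_cst.
  by apply: (@avgn_le _ 1) => t; rewrite /v le_max lexx.
have v_subn m y : v y <= avgn m v y.
  elim: m y => [//|m IH] y; rewrite avgnSr; apply: le_trans (IH y) _.
  by apply: avgn_le.
have vu m : avgn m v x <= avgn m u x.
  by apply: avgn_le => y; rewrite /v ge_max u0 andbT; lra.
have : v x <= 0.
  apply/ler_addgt0Pl => e e0; rewrite addr0.
  have [m Hm] := um e e0.
  exact: le_trans (v_subn m x) (le_trans (vu m) (Hm x)).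
by rewrite /v ge_max subr_le0 => /andP[].
Qed.

End truncated_double_green.

(** * Mass of the kernel q *)

Definition zrange (N : nat) : seq int :=
  0%Z :: [seq k%:Z | k <- iota 1 N] ++ [seq - k%:Z | k <- iota 1 N].

(** Half-integer powers occur because coordinates are summed out one at a time: the sum over [z] of
    [(s + z^2)^(-(j+1)/2)] is about a constant times [s^(-j/2)]. *)
Definition inv_sqrt (R : realType) (s : R) : R := (Num.sqrt s)^-1.

Section lattice_sums.
Variable R : realType.
Implicit Types (a b c s d e : R).

Lemma mem_zrange N z : (z \in zrange N) = (`|z| <= N%:Z).
Proof.
apply/idP/idP.
  rewrite inE mem_cat => /or3P[/eqP->//|/mapP[k]|/mapP[k]];
    rewrite mem_iota => /andP[_ kN] ->; lia.
move=> zN; rewrite inE mem_cat.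
have [->//|z0] := eqVneq z 0%Z.
have [zp|zn] := leP 0 z.
  apply/orP; right; apply/orP; left; apply/mapP; exists `|z|%N; last by lia.
  by rewrite mem_iota; lia.
apply/orP; right; apply/orP; right; apply/mapP; exists `|z|%N; last by lia.
by rewrite mem_iota; lia.
Qed.

Lemma zrange_uniq N : uniq (zrange N).
Proof.
rewrite /zrange cons_uniq cat_uniq !map_inj_uniq ?iota_uniq //=; last first.
- by move=> x y /=; lia.
- by move=> x y /=; lia.
rewrite mem_cat negb_or andbT; apply/andP; split; last first.
  apply/hasPn => z /mapP[k]; rewrite mem_iota => kN ->.
  by apply/negP => /mapP[l]; rewrite mem_iota; lia.
by apply/andP; split; apply/negP => /mapP[k]; rewrite mem_iota; lia.
Qed.

Lemma sum_zrange (V : nmodType) N (f : int -> V) :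
  \sum_(z <- zrange N) f z =
  f 0 + (\sum_(1 <= k < N.+1) f k%:Z + \sum_(1 <= k < N.+1) f (- k%:Z)).
Proof. by rewrite big_cons big_cat !big_map /index_iota subn1. Qed.

Lemma sum_zrange_even N (f : int -> R) : (forall z, f (- z) = f z) ->
  \sum_(z <- zrange N) f z = 2 * \sum_(0 <= k < N.+1) f k%:Z - f 0.
Proof.
move=> fN; rewrite sum_zrange [in RHS]big_nat_recl //.
rewrite (eq_bigr (fun k : nat => f k%:Z) (P := xpredT)) => [|k _]; last by [].
under [X in _ + (_ + X)]eq_bigr do rewrite fN.
rewrite big_add1 /=; ring.
Qed.

Lemma sum_zrange_le N M (f : int -> R) : (N <= M)%N -> (forall z, 0 <= f z) ->
  \sum_(z <- zrange N) f z <= \sum_(z <- zrange M) f z.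
Proof.
move=> NM f0; rewrite !sum_zrange lerD2l.
by apply: lerD; rewrite [leRHS](big_cat_nat _ (n := N.+1)) //= lerDl sumr_ge0.
Qed.

(* [cos (atan t) ^+ j] is [(1 + t^2) ^ (-j/2)] and [I] is its integral over the
   half line. *)
Definition half_mass (j : nat) (I : R) := exists Psi : R -> R,
  [/\ forall t : R, is_derive t 1 Psi (cos (atan t) ^+ j), Psi 0 = 0,
      forall t : R, 0 <= t -> Psi t <= I &
      forall e : R, 0 < e -> exists t0 : R, forall t : R, t0 <= t -> I - e <= Psi t].

Lemma cos_atan_gt0 t : 0 < cos (atan t) :> R.
Proof. by apply: cos_gt0_pihalf; rewrite atan_gtNpi2 atan_ltpi2. Qed.

Lemma cos_atan_decr (s t : R) : 0 <= s -> s <= t -> cos (atan t) <= cos (atan s).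
Proof.
move=> s0 st; rewrite !cos_atan lef_pV2 ?posrE ?sqrtr_gt0 //; last 2 first.
- by have := sqr_ge0 t; lra.
- by have := sqr_ge0 s; lra.
rewrite ler_wsqrtr // lerD2l; nra.
Qed.

(** Substitution [t = tan x]: the derivative of [atan] supplies a factor [cos ^+ 2], so a primitive
    of [cos ^+ j] composed with [atan] handles the exponent [j.+2], with limit [G (pi / 2)] at
    infinity. *)
Lemma half_mass_of_primitive j (G : R -> R) :
  (forall x : R, is_derive x 1 G (cos x ^+ j)) -> G 0 = 0 ->
  half_mass j.+2 (G (pi / 2)).
Proof.
move=> dG G0; pose Psi := G \o atan.
have cG x : {for x, continuous G}.
  by apply: differentiable_continuous; apply/derivable1_diffP; have [] := dG x.
have dPsi (t : R) : is_derive t 1 Psi (cos (atan t) ^+ j.+2).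
  apply: is_derive_eq.
  rewrite /=.
  have -> : (1 + t ^+ 2)^-1 = cos (atan t) ^+ 2.
    by rewrite cos_atan exprVn sqr_sqrtr //; have := sqr_ge0 t; lra.
  rewrite /GRing.scale /= !exprS; ring.
have cPsi x : {for x, continuous Psi}.
  by apply: differentiable_continuous; apply/derivable1_diffP; have [] := dPsi x.
have mono (s t : R) : s <= t -> Psi s <= Psi t.
  rewrite le_eqVlt => /predU1P[->//|st].
  have [x _ E] := MVT st (fun x _ => dPsi x) (continuous_subspaceT cPsi).
  by rewrite -subr_ge0 E mulr_ge0 ?subr_ge0 ?(ltW st) // exprn_ge0 // ltW // cos_atan_gt0.
have lim : Psi t @[t --> +oo] --> G (pi / 2).
  exact: (cvg_comp _ _ (@cvgy_atan R) (cG _)).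
exists Psi; split => //.
- by rewrite /Psi /= atan0.
- move=> t _; rewrite -(cvg_lim _ lim) //; apply: limr_ge; first by apply/cvg_ex; eexists; exact: lim.
  near=> x; apply: mono; near: x; apply: nbhs_pinfty_ge; exact: num_real.
- move=> e e0; have /cvgrPdist_le /(_ _ e0) [M [_ HM]] := lim.
  exists (M + 1) => t Mt; have : `|G (pi / 2) - Psi t| <= e by apply: HM; lra.
  by rewrite ler_norml => /andP[_]; lra.
Unshelve. all: by end_near. Qed.

Lemma regular_scaleE (u v : R) : u *: (v : R^o) = u * v.
Proof. by []. Qed.

(** The values for exponents 3 to 6 are the Wallis integrals of [cos ^+ 1] to [cos ^+ 4] over
    [[0, pi / 2]]. Exponent 6 is that of [(|x|^2 + c)^-3], and each coordinate summed out lowers it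
    by one. *)
Lemma half_mass3 : half_mass 3 1.
Proof.
have := @half_mass_of_primitive 1 sin; rewrite sin_pihalf sin0; by apply.
Qed.

Lemma half_mass4 : half_mass 4 (pi / 4).
Proof.
have := @half_mass_of_primitive 2 (fun x => 2^-1 * (x + sin x * cos x)).
rewrite sin_pihalf cos_pihalf sin0 cos0 mulr0 mul0r !addr0 mulr0.
rewrite (_ : 2^-1 * (pi / 2) = pi / 4); last by field.
apply => // x; apply: is_derive_eq.
rewrite /GRing.scale /=; have := cos2Dsin2 x; nra.
Qed.

Lemma half_mass5 : half_mass 5 (2 / 3).
Proof.
have := @half_mass_of_primitive 3 (fun x => sin x - 3^-1 * sin x ^+ 3).
rewrite sin_pihalf sin0 expr1n expr0n /= mulr0 subr0 mulr1.
rewrite (_ : 1 - 3^-1 = 2 / 3); last by field.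
apply => // x; apply: is_derive_eq.
by rewrite (exprS _ 2) cos2sin2 !regular_scaleE; field.
Qed.

Lemma half_mass6 : half_mass 6 (3 * pi / 16).
Proof.
have := @half_mass_of_primitive 4
  (fun x => 3 / 8 * (x + sin x * cos x) + 4^-1 * (sin x * cos x ^+ 3)).
rewrite sin_pihalf cos_pihalf sin0 cos0 !expr0n /= !mulr0 !mul0r !addr0 !mulr0 addr0.
rewrite (_ : 3 / 8 * (pi / 2) = 3 * pi / 16); last by field.
apply => // x; apply: is_derive_eq.
rewrite (exprD _ 2 2) !regular_scaleE /=.
have := cos2sin2 x; rewrite expr2 => E.
transitivity (3 / 8 * (1 - sin x ^+ 2 + cos x * cos x) + 4^-1 *
  (- 3 * sin x ^+ 2 * (cos x * cos x) + (cos x * cos x) * (cos x * cos x))).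
  by field.
by rewrite !E; field.
Qed.

Lemma inv_sqrtD_sqr s (t : R) : 0 < s ->
  inv_sqrt (s + t ^+ 2) = inv_sqrt s * cos (atan (t * inv_sqrt s)).
Proof.
move=> s0; rewrite cos_atan /inv_sqrt -invfM -sqrtrM ?(ltW s0) //.
rewrite mulrDr mulr1 exprMn exprVn sqr_sqrtr ?(ltW s0) // mulrCA divff ?mulr1 //.
by rewrite gt_eqF.
Qed.

Lemma inv_sqrt_gt0 s : 0 < s -> 0 < inv_sqrt s.
Proof. by move=> s0; rewrite invr_gt0 sqrtr_gt0. Qed.

Lemma inv_sqrt_le s t : 0 < s -> s <= t -> inv_sqrt t <= inv_sqrt s.
Proof.
move=> s0 st; rewrite /inv_sqrt lef_pV2 ?posrE ?sqrtr_gt0 ?(lt_le_trans s0 st) //.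
by rewrite ler_wsqrtr.
Qed.

(** The integrand decreases on the half line, so on each cell the mean value theorem puts the
    increment of [Psi] between [d] times the two end values. *)
Lemma riemann_bounds j (Psi : R -> R) d N :
  (forall t : R, is_derive t 1 Psi (cos (atan t) ^+ j)) -> Psi 0 = 0 -> 0 < d ->
  Psi (N%:R * d) <= d * \sum_(0 <= k < N) cos (atan (k%:R * d)) ^+ j /\
  d * \sum_(0 <= k < N) cos (atan (k.+1%:R * d)) ^+ j <= Psi (N%:R * d).
Proof.
move=> dPsi P0 d0.
have cPsi x : {for x, continuous Psi}.
  by apply: differentiable_continuous; apply/derivable1_diffP; have [] := dPsi x.
elim: N => [|N [IH1 IH2]]; first by rewrite !big_nil mul0r P0 mulr0.
rewrite !big_nat_recr //= !mulrDr.
have NS : N%:R * d < N.+1%:R * d by rewrite ltr_pM2r // ltr_nat.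
have N0 : 0 <= N%:R * d by rewrite mulr_ge0 // ltW.
have [c cI E] := MVT NS (fun x _ => dPsi x) (continuous_subspaceT cPsi).
have E' : Psi (N.+1%:R * d) = Psi (N%:R * d) + d * cos (atan c) ^+ j.
  by rewrite -[LHS](subrK (Psi (N%:R * d))) E -mulrBl -natrB // subSnn mul1r mulrC addrC.
move: cI; rewrite in_itv /= => /andP[c1 c2].
have le1 : cos (atan c) ^+ j <= cos (atan (N%:R * d)) ^+ j.
  by rewrite lerXn2r ?nnegrE ?(ltW (cos_atan_gt0 _)) // cos_atan_decr // ltW.
have le2 : cos (atan (N.+1%:R * d)) ^+ j <= cos (atan c) ^+ j.
  rewrite lerXn2r ?nnegrE ?(ltW (cos_atan_gt0 _)) // cos_atan_decr // ?ltW //.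
  exact: le_lt_trans N0 c1.
by rewrite E'; split; apply: lerD => //; rewrite ler_pM2l.
Qed.

Lemma sum_inv_sqrtE j s N : 0 < s ->
  \sum_(z <- zrange N) inv_sqrt (s + z%:~R ^+ 2) ^+ j.+1 =
  inv_sqrt s ^+ j *
   (2 * (inv_sqrt s * \sum_(0 <= k < N.+1) cos (atan (k%:R * inv_sqrt s)) ^+ j.+1)
    - inv_sqrt s).
Proof.
move=> s0; rewrite sum_zrange_even => [|z]; last by rewrite rmorphN sqrrN.
rewrite expr0n /= addr0 exprS mulrBr; congr (_ - _); last exact: mulrC.
rewrite mulrCA; congr (2 * _); rewrite mulrA -exprSr mulr_sumr.
by apply: eq_bigr => k _; rewrite inv_sqrtD_sqr // exprMn.
Qed.

Lemma sum_inv_sqrt_le j I s N : half_mass j.+1 I -> 0 < s ->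
  \sum_(z <- zrange N) inv_sqrt (s + z%:~R ^+ 2) ^+ j.+1 <=
  (2 * I + inv_sqrt s) * inv_sqrt s ^+ j.
Proof.
move=> [Psi [dPsi P0 PI _]] s0; have d0 := inv_sqrt_gt0 s0.
rewrite sum_inv_sqrtE // mulrC ler_wpM2r ?exprn_ge0 ?(ltW d0) //.
(* The term [k = 0] is split off before comparing with [Psi]: doubling counts it twice and the
   correction [- inv_sqrt s] leaves it once, whence the extra [inv_sqrt s]. *)
rewrite big_nat_recl // mul0r atan0 cos0 expr1n mulrDr mulr1.
have [_ h] := riemann_bounds N dPsi P0 d0.
have := PI (N%:R * inv_sqrt s); rewrite mulr_ge0 ?(ltW d0) // => /(_ isT).
lra.
Qed.

Lemma sum_inv_sqrt_ge j I c S e : half_mass j.+1 I -> 0 < c -> 0 < e ->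
  exists N0, forall N s, (N0 <= N)%N -> c <= s -> s <= S ->
  (2 * I - e - inv_sqrt c) * inv_sqrt s ^+ j <=
  \sum_(z <- zrange N) inv_sqrt (s + z%:~R ^+ 2) ^+ j.+1.
Proof.
move=> [Psi [dPsi P0 _ PI]] c0 e0.
have e20 : 0 < e / 2 by rewrite divr_gt0.
have [t0 Ht0] := PI _ e20.
(* The Riemann sum of mesh [inv_sqrt s] must reach [t0]; the bound [s <= S] keeps the mesh above
   [inv_sqrt S], so one [N0] serves all [s]. *)
exists (Num.truncn (`|t0| / inv_sqrt S)) => N s N0 cs sS.
have s0 : 0 < s := lt_le_trans c0 cs.
have d0 := inv_sqrt_gt0 s0.
have S0 : 0 < S := lt_le_trans s0 sS.
rewrite sum_inv_sqrtE // mulrC ler_wpM2l ?exprn_ge0 ?(ltW d0) //.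
have [h _] := riemann_bounds N.+1 dPsi P0 d0.
have : I - e / 2 <= Psi (N.+1%:R * inv_sqrt s).
  apply: Ht0; apply: le_trans (ler_norm _) _.
  apply: (@le_trans _ _ (N.+1%:R * inv_sqrt S)); last first.
    by rewrite ler_wpM2l // inv_sqrt_le.
  rewrite -ler_pdivrMr ?inv_sqrt_gt0 // ltW //.
  by apply: lt_le_trans (truncnS_gt _) _; rewrite ler_nat ltnS.
have := inv_sqrt_le c0 cs; lra.
Qed.

End lattice_sums.

(** * The mass of the kernel [qker] on boxes of Z^4 *)

Definition pt4 (i j k l : int) : Z4 :=
  \row_(m < 4) nth 0%Z [:: i; j; k; l] m.

Definition box (N : nat) : seq Z4 :=
  [seq pt4 p.1 p.2 q.1 q.2 |
    p <- [seq (i, j) | i <- zrange N, j <- zrange N],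
    q <- [seq (k, l) | k <- zrange N, l <- zrange N]].

Section lattice_mass.
Variable R : realType.
Implicit Types (a b c s d e : R).

Lemma pt4_inj i j k l i' j' k' l' : pt4 i j k l = pt4 i' j' k' l' ->
  [/\ i = i', j = j', k = k' & l = l'].
Proof.
move=> /rowP E; have F (m : 'I_4) := E m.
have := F (@Ordinal 4 0 isT); have := F (@Ordinal 4 1 isT).
have := F (@Ordinal 4 2 isT); have := F (@Ordinal 4 3 isT).
by rewrite !mxE /= => -> -> -> ->.
Qed.

Lemma pt4_coord (x : Z4) :
  x = pt4 (x ord0 (@Ordinal 4 0 isT)) (x ord0 (@Ordinal 4 1 isT))
          (x ord0 (@Ordinal 4 2 isT)) (x ord0 (@Ordinal 4 3 isT)).
Proof.
apply/rowP => -[[|[|[|[|//]]]] im]; rewrite mxE /=; congr (x _ _); exact: val_inj.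
Qed.

Lemma sqn_pt4 i j k l : sqn R (pt4 i j k l) =
  i%:~R ^+ 2 + j%:~R ^+ 2 + k%:~R ^+ 2 + l%:~R ^+ 2.
Proof. by rewrite /sqn !big_ord_recl big_ord0 !mxE /= addr0 !addrA. Qed.

Lemma box_uniq N : uniq (box N).
Proof.
have zu := zrange_uniq N.
have pu : uniq [seq (i, j) | i <- zrange N, j <- zrange N].
  by apply: allpairs_uniq => // -[i j] [i' j'] _ _ [-> ->].
apply: allpairs_uniq => // -[[i j] [k l]] [[i' j'] [k' l']] /= _ _.
by move=> /pt4_inj[-> -> -> ->].
Qed.

Lemma notin_box N (x : Z4) : x \notin box N -> exists i, N.+1%:Z <= `|x ord0 i|.
Proof.
move=> xN; apply/existsP; apply: contraNT xN => /existsPn h.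
have {}h i : x ord0 i \in zrange N by rewrite mem_zrange; have := h i; lia.
apply/allpairsP.
exists ((x ord0 (@Ordinal 4 0 isT), x ord0 (@Ordinal 4 1 isT)),
        (x ord0 (@Ordinal 4 2 isT), x ord0 (@Ordinal 4 3 isT))).
split; [| |exact: pt4_coord]; by apply: (allpairs_f pair); exact: h.
Qed.

Lemma sum_box N (f : Z4 -> R) : \sum_(y <- box N) f y =
  \sum_(i <- zrange N) \sum_(j <- zrange N) \sum_(k <- zrange N)
  \sum_(l <- zrange N) f (pt4 i j k l).
Proof.
transitivity (\sum_(p <- [seq (i, j) | i <- zrange N, j <- zrange N])
    \sum_(q <- [seq (k, l) | k <- zrange N, l <- zrange N]) f (pt4 p.1 p.2 q.1 q.2)).
  exact: big_allpairs_dep.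
rewrite big_allpairs; apply: eq_bigr => i _; apply: eq_bigr => j _.
by rewrite big_allpairs.
Qed.

Lemma inv_cube c y : 0 < c -> (sqn R y + c)^-1 ^+ 3 = inv_sqrt (c + sqn R y) ^+ 6.
Proof.
move=> c0; have s0 := sqn_ge0 R y.
rewrite addrC /inv_sqrt !exprVn (exprM _ 2 3) sqr_sqrtr //; lra.
Qed.

Lemma inv_sqrt_sqr c : 0 < c -> inv_sqrt c ^+ 2 = c^-1.
Proof. by move=> c0; rewrite /inv_sqrt exprVn sqr_sqrtr // ltW. Qed.

(** Full-line masses for the exponents 6, 5, 4 and 3; their product is [pi ^+ 2 / 2]. *)
Let m6 : R := 2 * (3 * pi / 16).
Let m5 : R := 2 * (2 / 3).
Let m4 : R := 2 * (pi / 4).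
Let m3 : R := 2 * 1.

Lemma box_mass_le c N : 0 < c ->
  \sum_(y <- box N) c * (sqn R y + c)^-1 ^+ 3 <=
  (m6 + inv_sqrt c) * (m5 + inv_sqrt c) * (m4 + inv_sqrt c) * (m3 + inv_sqrt c).
Proof.
move=> c0; rewrite -mulr_sumr sum_box.
have d0 := inv_sqrt_gt0 c0; set d := inv_sqrt c in d0 *.
have p0 := pi_gt0 R.
have step j I s (B : R) : half_mass j.+1 I -> c <= s -> 0 <= B -> 0 <= I ->
  \sum_(z <- zrange N) B * inv_sqrt (s + z%:~R ^+ 2) ^+ j.+1 <=
  B * (2 * I + d) * inv_sqrt s ^+ j.
  move=> hI cs B0 I0; rewrite -mulr_sumr -mulrA ler_wpM2l //.
  apply: le_trans (sum_inv_sqrt_le N hI (lt_le_trans c0 cs)) _.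
  rewrite ler_wpM2r ?exprn_ge0 ?(ltW (inv_sqrt_gt0 _)) ?(lt_le_trans c0 cs) //.
  by rewrite lerD2l inv_sqrt_le.
have sq z : 0 <= z%:~R ^+ 2 :> R := sqr_ge0 _.
set B1 := m6 + d; set B2 := m5 + d; set B3 := m4 + d; set B4 := m3 + d.
have B1p : 0 <= B1 by rewrite /B1 /m6; lra.
have B2p : 0 <= B2 by rewrite /B2 /m5; lra.
have B3p : 0 <= B3 by rewrite /B3 /m4; lra.
have -> : B1 * B2 * B3 * B4 = c * (1 * B1 * B2 * B3 * B4 * d ^+ 2).
  by rewrite /d inv_sqrt_sqr //; field; rewrite gt_eqF.
rewrite ler_pM2l //.
apply: (@le_trans _ _ (\sum_(i <- zrange N) 1 * B1 * B2 * B3 * inv_sqrt (c + i%:~R ^+ 2) ^+ 3)).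
  apply: ler_sum => i _; have := sq i => si.
  apply: (@le_trans _ _ (\sum_(j <- zrange N) 1 * B1 * B2 * inv_sqrt (c + i%:~R ^+ 2 + j%:~R ^+ 2) ^+ 4)).
    apply: ler_sum => j _; have := sq j => sj.
    apply: (@le_trans _ _ (\sum_(k <- zrange N) 1 * B1 * inv_sqrt (c + i%:~R ^+ 2 + j%:~R ^+ 2 + k%:~R ^+ 2) ^+ 5)).
      apply: ler_sum => k _; have := sq k => sk.
      apply: le_trans (step _ _ (c + i%:~R ^+ 2 + j%:~R ^+ 2 + k%:~R ^+ 2) 1 (half_mass6 R) _ _ _); last first.
      - lra.
      - by [].
      - lra.
      rewrite le_eqVlt; apply/orP; left; apply/eqP; apply: eq_bigr => l _.
      by rewrite mul1r inv_cube // sqn_pt4 !addrA.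
    apply: le_trans (step _ _ _ _ (half_mass5 R) _ _ _) _ => //; rewrite ?mul1r //; lra.
  apply: le_trans (step _ _ _ _ (half_mass4 R) _ _ _) _ => //; rewrite ?mul1r ?(mulr_ge0 B1p B2p) //; lra.
by apply: le_trans (step _ _ _ _ (half_mass3 R) _ _ _) _ => //; rewrite mul1r !mulr_ge0.
Qed.

Lemma box_mass_ge c e : 0 < c -> 0 < e -> e + inv_sqrt c <= 1 / 2 ->
  exists N,
  (m6 - e - inv_sqrt c) * (m5 - e - inv_sqrt c) * (m4 - e - inv_sqrt c) *
  (m3 - e - inv_sqrt c) <= \sum_(y <- box N) c * (sqn R y + c)^-1 ^+ 3.
Proof.
move=> c0 e0 ed.
have d0 := inv_sqrt_gt0 c0; set d := inv_sqrt c in d0 ed *.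
have p2 := pi_ge2 R.
have sq z : 0 <= z%:~R ^+ 2 :> R := sqr_ge0 _.
have step j I S : half_mass j.+1 I -> 1 / 2 <= 2 * I ->
  exists N0, forall N s (B : R), (N0 <= N)%N -> c <= s -> s <= S -> 0 <= B ->
  B * (2 * I - e - d) * inv_sqrt s ^+ j <=
  \sum_(z <- zrange N) B * inv_sqrt (s + z%:~R ^+ 2) ^+ j.+1.
  move=> hI I1; have [N0 HN] := sum_inv_sqrt_ge S hI c0 e0.
  exists N0 => N s B NN cs sS B0.
  by rewrite -mulr_sumr -mulrA ler_wpM2l // HN.
have zle N z : z \in zrange N -> z%:~R ^+ 2 <= N%:R ^+ 2 :> R.
  rewrite mem_zrange => zN; rewrite -[leLHS]real_normK ?num_real //.
  have zR : `|z%:~R| <= N%:R :> R by rewrite -intr_norm; move: zN; rewrite -(ler_int R).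
  by rewrite lerXn2r ?nnegrE.
(* Cutoffs are chosen from the outermost coordinate inwards, since each depends on a bound for the
   squares already fixed. Each sum over the common box is later cut down to its own range. *)
have [|N1 H1] := step 2 1 c (half_mass3 R); first by lra.
have [|N2 H2] := step 3 (pi / 4) (c + N1%:R ^+ 2) (half_mass4 R); first by lra.
have [|N3 H3] := step 4 (2 / 3) (c + N1%:R ^+ 2 + N2%:R ^+ 2) (half_mass5 R); first by lra.
have [|N4 H4] := step 5 (3 * pi / 16) (c + N1%:R ^+ 2 + N2%:R ^+ 2 + N3%:R ^+ 2) (half_mass6 R); first by lra.
pose N := maxn (maxn N1 N2) (maxn N3 N4).
have NN1 : (N1 <= N)%N by rewrite /N; lia.
have NN2 : (N2 <= N)%N by rewrite /N; lia.
have NN3 : (N3 <= N)%N by rewrite /N; lia.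
have NN4 : (N4 <= N)%N by rewrite /N; lia.
exists N; rewrite -mulr_sumr sum_box.
set B1 := m6 - e - d; set B2 := m5 - e - d; set B3 := m4 - e - d; set B4 := m3 - e - d.
have B1p : 0 <= B1 by rewrite /B1 /m6; lra.
have B2p : 0 <= B2 by rewrite /B2 /m5; lra.
have B3p : 0 <= B3 by rewrite /B3 /m4; lra.
have -> : B1 * B2 * B3 * B4 = c * (1 * B1 * B2 * B3 * B4 * d ^+ 2).
  by rewrite /d inv_sqrt_sqr //; field; rewrite gt_eqF.
rewrite ler_pM2l //.
have f0 i j k l : 0 <= (sqn R (pt4 i j k l) + c)^-1 ^+ 3.
  by rewrite exprn_ge0 // invr_ge0; have := sqn_ge0 R (pt4 i j k l); lra.
have shrink M (f g : int -> R) : (M <= N)%N -> (forall z, 0 <= f z) ->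
  (forall z, z \in zrange M -> g z <= f z) ->
  \sum_(z <- zrange M) g z <= \sum_(z <- zrange N) f z.
  move=> MN ff fg; apply: le_trans (sum_zrange_le MN ff).
  by rewrite big_seq [leRHS]big_seq; apply: ler_sum.
apply: le_trans (H1 N1 c (1 * B1 * B2 * B3) (leqnn _) (lexx _) (lexx _) _) _.
  by rewrite mul1r !mulr_ge0.
apply: (shrink _ _ _) => // i; first by do 3! apply: sumr_ge0 => ? _.
move=> /zle si; have := sq i => si0.
apply: le_trans (H2 N2 (c + i%:~R ^+ 2) (1 * B1 * B2) (leqnn _) _ _ _) _.
- lra.
- lra.
- by rewrite mul1r !mulr_ge0.
apply: (shrink _ _ _) => // j; first by do 2! apply: sumr_ge0 => ? _.
move=> /zle sj; have := sq j => sj0.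
apply: le_trans (H3 N3 (c + i%:~R ^+ 2 + j%:~R ^+ 2) (1 * B1) (leqnn _) _ _ _) _.
- lra.
- lra.
- by rewrite mul1r.
apply: (shrink _ _ _) => // k; first by apply: sumr_ge0 => ? _.
move=> /zle sk; have := sq k => sk0.
apply: le_trans (H4 N4 (c + i%:~R ^+ 2 + j%:~R ^+ 2 + k%:~R ^+ 2) 1 (leqnn _) _ _ _) _.
- lra.
- lra.
- by [].
apply: (shrink _ _ _) => // l _.
by rewrite mul1r inv_cube // sqn_pt4 !addrA.
Qed.

Lemma ler_prod4 (u1 u2 u3 u4 v1 v2 v3 v4 : R) :
  0 <= u1 <= v1 -> 0 <= u2 <= v2 -> 0 <= u3 <= v3 -> 0 <= u4 <= v4 ->
  u1 * u2 * u3 * u4 <= v1 * v2 * v3 * v4.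
Proof.
move=> /andP[? ?] /andP[? ?] /andP[? ?] /andP[? ?].
by do 3 (apply: ler_pM; rewrite ?mulr_ge0 //).
Qed.

Lemma qker_mass (h : R) : 0 < h -> h <= 1 ->
  exists2 a0, 8 <= a0 & forall a, a0 <= a ->
  (forall N, \sum_(y <- box N) qker a y <= pi ^+ 2 / 2 * (1 + h)) /\
  (exists N, pi ^+ 2 / 2 * (1 - h) <= \sum_(y <- box N) qker a y).
Proof.
(* Five factors occur, four from the coordinates and one from comparing [qker a] with
   [c / (|x|^2 + c)^3] for [c = a + 1]. Once [a >= x^-2] each lies between [1 - 4x] and [1 + 2x],
   and the fifth powers stay between [1 - 64x] and [1 + 64x]. *)
move=> h0 h1; pose x := h / 64.
have x0 : 0 < x by rewrite divr_gt0.
have x1 : x <= 64^-1 by rewrite /x; lra.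
have xV : 64 <= x^-1 by rewrite -[64]invrK lef_pV2 ?posrE // invr_gt0.
have xx : 64 <= x^-1 * x^-1 by clear -xV; nra.
exists (x ^- 2) => [|a xa]; first by rewrite -exprVn expr2; lra.
have a8 : 8 <= a by move: xa; rewrite expr2 invfM; lra.
have c0 : 0 < a + 1 by lra.
have cle : inv_sqrt (a + 1) <= x.
  have -> : x = inv_sqrt (x ^- 2).
    by rewrite /inv_sqrt -exprVn sqrtr_sqr ger0_norm ?invrK // invr_ge0 ltW.
  by apply: inv_sqrt_le; [rewrite invr_gt0 exprn_gt0 | lra].
have cV : (a + 1)^-1 <= x ^+ 2.
  by rewrite -inv_sqrt_sqr // lerXn2r ?nnegrE ?(ltW x0) // ltW // inv_sqrt_gt0.
have d0 := inv_sqrt_gt0 c0; set d := inv_sqrt (a + 1) in cle d0.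
have p2 := pi_ge2 R; have V0 : 0 < (a + 1)^-1 by rewrite invr_gt0.
have M : m6 * m5 * m4 * m3 = pi ^+ 2 / 2 by rewrite /m6 /m5 /m4 /m3; field.
have [b6 b5 b4 b3] : [/\ 1 / 2 <= m6, 1 / 2 <= m5, 1 / 2 <= m4 & 1 / 2 <= m3].
  by rewrite /m6 /m5 /m4 /m3; split; lra.
have hx : h = 64 * x by rewrite /x; field.
have VV : (a + 1) * (a + 1)^-1 = 1 by rewrite divff // gt_eqF.
have xa1 : 64 <= x * (a + 1).
  have : 64 * (a + 1)^-1 <= x by rewrite expr2 in cV; clear -cV x0 x1; nra.
  by move=> V64; rewrite mulrC -ler_pdivrMl // mulrC.
split.
  move=> N.
  apply: (@le_trans _ _ ((1 + 2 * x) * \sum_(y <- box N) (a + 1) * (sqn R y + (a + 1))^-1 ^+ 3)).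
    rewrite mulr_sumr; apply: ler_sum => y _; apply: le_trans (qker_le y a8) _.
    rewrite -(addrA _ a 1) exprVn mulrA ler_wpM2r ?invr_ge0 ?exprn_ge0 //.
      by have := sqn_ge0 R y; lra.
    by rewrite mulrDl mul1r; lra.
  have B (m : R) : 1 / 2 <= m -> 0 <= m + d <= m * (1 + 2 * x).
    by move=> m2; apply/andP; split; [lra|clear -m2 cle x0; nra].
  apply: (@le_trans _ _ ((1 + 2 * x) * (m6 * (1 + 2 * x) * (m5 * (1 + 2 * x)) *
     (m4 * (1 + 2 * x)) * (m3 * (1 + 2 * x))))).
    rewrite ler_wpM2l //; first by lra.
    apply: le_trans (box_mass_le N c0) _; rewrite -/d.
    by apply: ler_prod4; exact: B.
  have -> : (1 + 2 * x) * (m6 * (1 + 2 * x) * (m5 * (1 + 2 * x)) *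
     (m4 * (1 + 2 * x)) * (m3 * (1 + 2 * x))) =
     (m6 * m5 * m4 * m3) * (1 + 2 * x) ^+ 5 by ring.
  rewrite M ler_wpM2l ?divr_ge0 ?exprn_ge0 //; first by lra.
  rewrite hx; clear -x0 x1.
  have z1 : (1 + 2 * x) ^+ 2 <= 1 + 5 * x by rewrite expr2; nra.
  have z2 : (1 + 2 * x) ^+ 4 <= 1 + 12 * x.
    rewrite (exprM _ 2 2); have : 0 <= (1 + 2 * x) ^+ 2 by exact: sqr_ge0.
    by move: z1; set u := (_ ^+ 2); rewrite (expr2 u); nra.
  by rewrite exprS; move: z2; set u := (_ ^+ 4); nra.
have [|N HN] := @box_mass_ge (a + 1) x c0 x0; first by rewrite -/d; lra.
exists N; rewrite -/d in HN.
apply: (@le_trans _ _ ((1 - 4 * x) * \sum_(y <- box N) (a + 1) * (sqn R y + (a + 1))^-1 ^+ 3)); last first.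
  rewrite mulr_sumr; apply: ler_sum => y _; apply: le_trans (qker_ge y a8).
  rewrite -(addrA _ a 1) exprVn mulrA ler_wpM2r ?invr_ge0 ?exprn_ge0 //.
    by have := sqn_ge0 R y; lra.
  by rewrite mulrBl mul1r; lra.
apply: (@le_trans _ _ ((1 - 4 * x) * (m6 * (1 - 4 * x) * (m5 * (1 - 4 * x)) *
     (m4 * (1 - 4 * x)) * (m3 * (1 - 4 * x))))); last first.
  have B (m : R) : 1 / 2 <= m -> 0 <= m * (1 - 4 * x) <= m - x - d.
    by move=> m2; clear -m2 cle x0 x1; apply/andP; split; nra.
  rewrite ler_wpM2l //; first by lra.
  apply: le_trans HN.
  by apply: ler_prod4; exact: B.
have -> : (1 - 4 * x) * (m6 * (1 - 4 * x) * (m5 * (1 - 4 * x)) *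
   (m4 * (1 - 4 * x)) * (m3 * (1 - 4 * x))) =
   (m6 * m5 * m4 * m3) * (1 - 4 * x) ^+ 5 by ring.
rewrite M ler_wpM2l ?divr_ge0 ?exprn_ge0 //; first by lra.
rewrite hx; clear -x0 x1.
have z1 : 1 - 8 * x <= (1 - 4 * x) ^+ 2 by rewrite expr2; nra.
have z2 : 1 - 16 * x <= (1 - 4 * x) ^+ 4.
  by rewrite (exprM _ 2 2); move: z1; set u := (_ ^+ 2); rewrite (expr2 u); nra.
by rewrite exprS; move: z2; set u := (_ ^+ 4); nra.
Qed.

Lemma qker_small a e : 8 <= a -> 0 < e ->
  exists N, forall z, z \notin box N -> qker a z <= e.
Proof.
move=> a8 e0; exists (Num.truncn ((a + 3) / e)) => z /notin_box[i zi].
set N := Num.truncn _ in zi.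
have N1 : (a + 3) / e < N.+1%:R by exact: truncnS_gt.
have zR : N.+1%:R <= `|(z ord0 i)%:~R| :> R by rewrite -intr_norm; move: zi; rewrite -(ler_int R).
have n1 : 1 <= N.+1%:R :> R by rewrite ler1n.
have s1 : N.+1%:R <= sqn R z.
  apply: le_trans (coord_sqr_le_sqn R z i); rewrite -real_normK ?num_real //.
  by rewrite expr2; clear -zR n1; nra.
apply: le_trans (qker_le z a8) _.
have w1 : 1 <= sqn R z + a + 1 by lra.
apply: (@le_trans _ _ ((a + 3) / (sqn R z + a + 1))).
  rewrite ler_wpM2l //; first by lra.
  rewrite lef_pV2 ?posrE ?exprn_gt0 //; [|lra|lra].
  by rewrite exprS ler_peMr // ?exprn_ege1 //; lra.
rewrite ler_pdivrMr; last by lra.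
move: N1; rewrite ltr_pdivrMr // => N1.
apply: le_trans (ltW N1) _; rewrite mulrC ler_pM2l //; lra.
Qed.

End lattice_mass.

(** * Path expectations *)

(* The first [n] increments of the walk form the list [s], so every expectation
   needed below is an average over the [8 ^ n] lists of steps. *)
Fixpoint pathE (R : realType) (n : nat) (F : seq Z4 -> R) : R :=
  if n is m.+1 then
    (\sum_(i < 4) (pathE m (fun s => F (unitv i :: s)) +
                   pathE m (fun s => F (- unitv i :: s)))) / 8
  else F [::].

Fixpoint pathsum (R : realType) (f : Z4 -> R) (x : Z4) (s : seq Z4) : R :=
  if s is e :: s' then f x + pathsum f (x + e) s' else 0.

Definition endpoint (s : seq Z4) : Z4 := \sum_(e <- s) e.

Section path_expectation.
Variable R : realType.
Implicit Types (F G : seq Z4 -> R) (f : Z4 -> R) (x : Z4) (s t : seq Z4) (c : R).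

Lemma pathE_le n F G : (forall s, size s = n -> F s <= G s) -> pathE n F <= pathE n G.
Proof.
elim: n F G => [|n IH] F G FG /=; first exact: FG.
rewrite ler_wpM2r ?invr_ge0 //; apply: ler_sum => i _.
by apply: lerD; apply: IH => s sn; apply: FG; rewrite /= sn.
Qed.

Lemma eq_pathE n F G : (forall s, size s = n -> F s = G s) -> pathE n F = pathE n G.
Proof. by move=> FG; apply/le_anti; rewrite !pathE_le // => s /FG ->. Qed.

Lemma pathE_cst n c : pathE n (fun=> c) = c.
Proof.
elim: n => [//|n /= ->]; by rewrite sumr_const card_ord -mulr_natl; field.
Qed.

Lemma pathED n F G : pathE n (fun s => F s + G s) = pathE n F + pathE n G.
Proof.
elim: n F G => [//|n IH] F G /=.
rewrite -mulrDl -big_split /=; congr (_ / _); apply: eq_bigr => i _.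
by rewrite !IH addrACA.
Qed.

Lemma pathEZ n c F : pathE n (fun s => c * F s) = c * pathE n F.
Proof.
elim: n F => [//|n IH] F /=.
rewrite mulrA mulr_sumr; congr (_ / _); apply: eq_bigr => i _.
by rewrite !IH mulrDr.
Qed.

Lemma pathE_sum (I : Type) (r : seq I) n (F : I -> seq Z4 -> R) :
  pathE n (fun s => \sum_(i <- r) F i s) = \sum_(i <- r) pathE n (F i).
Proof.
elim: r => [|i r IH].
  by rewrite big_nil -[RHS](pathE_cst n 0); apply: eq_pathE => s _; rewrite big_nil.
by rewrite big_cons -IH -pathED; apply: eq_pathE => s _; rewrite big_cons.
Qed.

Lemma pathE_ge0 n F : (forall s, 0 <= F s) -> 0 <= pathE n F.
Proof. by move=> F0; rewrite -[leLHS](pathE_cst n 0); apply: pathE_le. Qed.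

Lemma pathE_cat m n F :
  pathE (m + n) F = pathE m (fun s => pathE n (fun t => F (s ++ t))).
Proof.
elim: m F => [//|m IH] F /=; congr (_ / _); apply: eq_bigr => i _.
by rewrite !IH.
Qed.

Lemma pathE_take m n F : pathE (m + n) (fun s => F (take m s)) = pathE m F.
Proof.
rewrite pathE_cat; apply: eq_pathE => s sm.
rewrite -[RHS](pathE_cst n); apply: eq_pathE => t _.
by rewrite take_size_cat.
Qed.

Lemma pathE_drop m n F : pathE (m + n) (fun s => F (drop m s)) = pathE n F.
Proof.
rewrite pathE_cat -[RHS](pathE_cst m); apply: eq_pathE => s sm.
by apply: eq_pathE => t _; rewrite drop_size_cat.
Qed.

Lemma pathE_opp n F : pathE n (fun s => F (map -%R s)) = pathE n F.
Proof.
elim: n F => [//|n IH] F /=; congr (_ / _); apply: eq_bigr => i _.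
rewrite addrC opprK.
by rewrite (IH (fun s => F (unitv i :: s))) (IH (fun s => F (- unitv i :: s))).
Qed.

Lemma pathE_rcons n F : pathE n.+1 F =
  pathE n (fun s => pathE 1 (fun t => F (s ++ t))).
Proof. by rewrite -pathE_cat addn1. Qed.

(** Steps are exchangeable. Together with [pathE_opp] this makes the past, seen backwards from a
    given time, a walk again. *)
Lemma pathE_rev n F : pathE n (fun s => F (rev s)) = pathE n F.
Proof.
elim: n F => [//|n IH] F.
rewrite [RHS]pathE_rcons /= (eq_pathE (G := fun s => 8^-1 * \sum_(i < 4)
  (F (rcons s (unitv i)) + F (rcons s (- unitv i))))); last first.
  move=> s _; rewrite mulrC; congr (_ * _); apply: eq_bigr => i _.
  by rewrite !cats1.
rewrite pathEZ pathE_sum mulrC; congr (_ * _); apply: eq_bigr => i _.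
rewrite pathED -(IH (fun s => F (rcons s (unitv i)))).
rewrite -(IH (fun s => F (rcons s (- unitv i)))).
by congr (_ + _); apply: eq_pathE => s _; rewrite rev_cons.
Qed.

Lemma pathE_endpoint n f x : pathE n (fun s => f (x + endpoint s)) = avgn n f x.
Proof.
elim: n x => [|n IH] x; first by rewrite /= /endpoint big_nil addr0.
rewrite avgnS /avg /=; congr (_ / _); apply: eq_bigr => i _.
rewrite -!IH; congr (_ + _); apply: eq_pathE => s _; congr f;
  by rewrite /endpoint big_cons addrA.
Qed.

End path_expectation.

(** * Lower tail of the sum of [hker] along a walk *)

Section lower_tail.
Variable R : realType.
Implicit Types (x y : Z4) (a b d e u v th : R).

Lemma expR_le_quad (z : R) : z <= 2^-1 -> expR z <= 1 + z + 2 * z ^+ 2.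
Proof.
move=> z2; have h : 1 - z <= expR (- z) by have := expR_ge1Dx (- z); lra.
have p : 0 < 1 - z by lra.
rewrite -[z in leLHS]opprK expRN.
apply: (@le_trans _ _ (1 - z)^-1).
  by rewrite lef_pV2 ?posrE ?expR_gt0.
rewrite -(@ler_pM2l _ (1 - z)) // divff ?gt_eqF //.
have : 0 <= z ^+ 2 * (1 - 2 * z) by rewrite mulr_ge0 ?sqr_ge0 //; lra.
rewrite expr2; nra.
Qed.

Lemma avg_ln_le a x : 8 <= a ->
  avg (fun y => ln (sqn R y + a)) x <=
  ln (sqn R x + a) + ((sqn R x + a)^-1 - sqn R x / (2 * (sqn R x + a + 1) ^+ 2)).
Proof.
move=> a8; rewrite avg_ln; last by lra.
set s := sqn R x; set w := s + a + 1.
have s0 : 0 <= s := sqn_ge0 R x.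
have w0 : 9 <= w by rewrite /w; lra.
have term (i : 'I_4) : ln (w ^+ 2 - 4 * (x ord0 i)%:~R ^+ 2) <=
    2 * ln w - 4 * (x ord0 i)%:~R ^+ 2 / w ^+ 2.
  have := coord_sqr_le_sqn R x i; rewrite -/s; set t := (_%:~R) ^+ 2 => ht.
  have t0 : 0 <= t := sqr_ge0 _.
  clearbody t.
  have tw : t <= w by rewrite /w; lra.
  have D : 0 < w ^+ 2 - 4 * t by rewrite expr2; nra.
  have W : 0 < w ^+ 2 by rewrite exprn_gt0 //; lra.
  have := ln_sub_le D W.
  rewrite lnXn; last by lra.
  rewrite -[ln w *+ 2]mulr_natl.
  have -> : w ^+ 2 - 4 * t - w ^+ 2 = - (4 * t) by ring.
  by rewrite mulNr; lra.
apply: (@le_trans _ _ (ln w - s / w ^+ 2 / 2)).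
  rewrite ler_pdivrMr //; apply: le_trans (ler_sum _ (fun i _ => term i)) _.
  rewrite sumrB sumr_const card_ord -!mulr_suml -!mulr_sumr sum_coord_sqr -/s.
  rewrite le_eqVlt; apply/orP; left; apply/eqP.
  rewrite -[(2 * ln w) *+ 4]mulr_natr.
  by field; rewrite !lt0r_neq0 //; lra.
have le2 : ln w - ln (s + a) <= (s + a)^-1.
  apply: le_trans (ln_sub_le _ _) _; [lra|lra|].
  by rewrite (_ : w - (s + a) = 1) ?mul1r // /w; ring.
have -> : s / (2 * w ^+ 2) = s / w ^+ 2 / 2.
  by field; rewrite lt0r_neq0 //; lra.
lra.
Qed.

(* A larger additive constant [b] in the logarithm absorbs the positive second
   order term [a/u^2] of the drift near the origin. *)
Lemma ln_drift_le a b d x : 8 <= a -> 0 < d -> d <= 1 ->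
  b = a + (a + 3) / d ->
  (sqn R x + b)^-1 - sqn R x / (2 * (sqn R x + b + 1) ^+ 2) <=
  (1 + d) / 2 * hker a x.
Proof.
move=> a8 d0 d1 bE; set s := sqn R x.
have s0 : 0 <= s := sqn_ge0 R x.
have c0 : 0 < (a + 3) / d by rewrite divr_gt0 //; lra.
set c := (a + 3) / d in bE c0.
have cd : c * d = a + 3 by rewrite /c divfK // gt_eqF.
have w0 : 9 < s + b + 1 by rewrite bE; lra.
set w := s + b + 1 in w0 *.
have -> : s + b = w - 1 by rewrite /w; ring.
have sE : s = w - 1 - b by rewrite /w; ring.
rewrite /hker -/s.
have sa : s + a = w - (c + 1) by rewrite /w bE; ring.
have sa0 : 0 < w - (c + 1) by rewrite -sa; lra.
apply: (@le_trans _ _ ((w + b + 4) / (2 * w ^+ 2))).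
  have -> : (w - 1)^-1 = w^-1 + w^-1 / (w - 1).
    by field; rewrite !lt0r_neq0 //; lra.
  have h : w^-1 / (w - 1) <= 3 / 2 * w^-1 ^+ 2.
    rewrite -(@ler_pM2l _ (w ^+ 2 * (w - 1))); last first.
      by rewrite mulr_gt0 ?exprn_gt0 //; lra.
    have -> : w ^+ 2 * (w - 1) * (w^-1 / (w - 1)) = w.
      by field; rewrite !lt0r_neq0 //; lra.
    have -> : w ^+ 2 * (w - 1) * (3 / 2 * w^-1 ^+ 2) = 3 / 2 * (w - 1).
      by field; rewrite !lt0r_neq0 //; lra.
    lra.
  rewrite sE; apply: (@le_trans _ _ (w^-1 + 3 / 2 * w^-1 ^+ 2 - (w - 1 - b) / (2 * w ^+ 2))).
    by rewrite lerD2r lerD2l.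
  by rewrite le_eqVlt; apply/orP; left; apply/eqP; field; rewrite lt0r_neq0 //; lra.
rewrite sa -mulrA -invfM.
rewrite ler_pdivrMr; last by rewrite mulr_gt0 ?exprn_gt0 //; lra.
have -> : (1 + d) / (2 * (w - (c + 1))) * (2 * w ^+ 2) =
          (1 + d) * w ^+ 2 / (w - (c + 1)).
  by field; rewrite lt0r_neq0.
rewrite ler_pdivlMr //.
have -> : (w + b + 4) * (w - (c + 1)) =
  w ^+ 2 + (a + 3) * w - (b + 4) * (c + 1) by rewrite bE; ring.
have -> : (1 + d) * w ^+ 2 = w ^+ 2 + d * w ^+ 2 by ring.
rewrite -addrA lerD2l bE -cd.
have dw : 0 <= d * w ^+ 2 by rewrite mulr_ge0 ?exprn_ge0 //; lra.
have cd0 : 0 < c * d by rewrite mulr_gt0.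
(* The claim is now [c * d * w <= d * w ^+ 2 + (b + 4) * (c + 1)]. The quadratic term suffices for
   [w > c], the constant for [w <= c]; this is where [c = (a + 3) / d] is needed. *)
have [wc|wc] := leP w c.
  have : c * d * w <= c * d * c by rewrite ler_pM2l.
  have : 0 <= (a + c + 4) * (c + 1) - c * d * c.
    have -> : a = c * d - 3 by rewrite cd; ring.
    have -> : (c * d - 3 + c + 4) * (c + 1) - c * d * c = c * d + (1 + c) * (c + 1) by ring.
    by rewrite addr_ge0 ?mulr_ge0 //; lra.
  lra.
have : c * d * w <= d * w ^+ 2.
  have -> : c * d * w = d * w * c by ring.
  have -> : d * w ^+ 2 = d * w * w by ring.
  by rewrite ler_wpM2l ?(ltW wc) // mulr_ge0 // ltW //; lra.
have : 0 <= (a + c + 4) * (c + 1) by rewrite mulr_ge0 //; lra.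
lra.
Qed.

(** With [u = |x|^2 + b] and [v] its value after a step, [v - u] is of order the square root of [u].
    The squared increment of the logarithm is then of order [1 / u], like the drift itself, and has
    to be suppressed by a small exponent [th]. *)
Lemma ln_ratio_bounds u (t v : R) : 8 <= u -> t ^+ 2 <= u - 8 -> v = u + 1 + 2 * t ->
  0 < v /\ (ln v - ln u) ^+ 2 <= 32 / u.
Proof.
move=> u8 tu vE.
have vu : u / 2 <= v by rewrite vE; nra.
have v0 : 0 < v by lra.
have u0 : 0 < u by lra.
split => //.
have h1 := ln_sub_le v0 u0; have h2 := ln_sub_le u0 v0.
have D2 : (v - u) ^+ 2 <= 8 * u by rewrite vE; nra.
have K w : u / 2 <= w -> ((v - u) / w) ^+ 2 <= 32 / u.
  move=> uw; have w0 : 0 < w by lra.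
  rewrite expr_div_n ler_pdivrMr ?exprn_gt0 //.
  rewrite mulrAC ler_pdivlMr //; nra.
have [le|lt] := leP u v.
  apply: le_trans (K u _); last by lra.
  rewrite lerXn2r ?nnegrE //; last by rewrite divr_ge0 //; lra.
  by rewrite subr_ge0 ler_ln ?posrE.
apply: le_trans (K v vu); rewrite -sqrrN opprB -[leRHS]sqrrN -mulNr opprB.
rewrite lerXn2r ?nnegrE //; last by rewrite divr_ge0 //; lra.
by rewrite subr_ge0 ler_ln ?posrE // ltW.
Qed.

Definition powfun th b x : R := expR (th * ln (sqn R x + b)).

(** Second order expansion of the exponential: the drift of the logarithm gives [(1 + d) / 2], and
    the squared increments give [64 * th], measured against [hker a] because [a <= b]. *)
Lemma avg_powfun_le a b d th x : 128 <= a -> 0 < d -> d <= 1 -> 0 < th -> th <= 1 ->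
  b = a + (a + 3) / d ->
  avg (powfun th b) x <=
  powfun th b x * expR (th * ((1 + d) / 2 + 64 * th) * hker a x).
Proof.
move=> a128 d0 d1 t0 t1 bE; set k := th * _.
have a8 : 8 <= a by lra.
have s0 := sqn_ge0 R x.
have c0 : 0 < (a + 3) / d by rewrite divr_gt0 //; lra.
have ba : a <= b by rewrite bE; lra.
set u := sqn R x + b.
have u1 : 128 <= u by rewrite /u; lra.
have u0 : 0 < u by lra.
pose Z y := ln (sqn R y + b) - ln u.
have step v (t : R) : t ^+ 2 <= sqn R x -> v = u + 1 + 2 * t ->
  expR (th * ln v) <= powfun th b x * (1 + th * (ln v - ln u) + 64 * th ^+ 2 / u).
  move=> ts vE.
  have [||v0 vZ] := @ln_ratio_bounds u t v _ _ vE; [by lra|by rewrite /u; lra|].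
  have -> : th * ln v = th * ln u + th * (ln v - ln u) by ring.
  rewrite expRD ler_pM2l ?expR_gt0 //.
  have Zs : (th * (ln v - ln u)) ^+ 2 <= th ^+ 2 * (32 / u).
    by rewrite exprMn ler_wpM2l ?sqr_ge0.
  have th2 : th ^+ 2 <= 1 by rewrite expr2; nra.
  have : 32 / u <= 4^-1 by rewrite ler_pdivrMr //; lra.
  have : 0 <= 32 / u by rewrite divr_ge0 // ltW.
  move=> h1 h2; apply: le_trans (expR_le_quad _) _.
    move: Zs; set z := th * _ => Zs.
    have : z ^+ 2 <= 4^-1 by apply: le_trans Zs _; nra.
    by clear; nra.
  rewrite lerD2l (_ : 64 * th ^+ 2 / u = 2 * (th ^+ 2 * (32 / u))); first lra.
  by field; rewrite gt_eqF.
have stepi i : powfun th b (x + unitv i) + powfun th b (x - unitv i) <=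
  powfun th b x * (2 + th * (Z (x + unitv i) + Z (x - unitv i)) + 128 * th ^+ 2 / u).
  have t2 := coord_sqr_le_sqn R x i.
  have h1 := step (sqn R (x + unitv i) + b) _ t2; rewrite sqnDunitv in h1.
  have h2 := step (sqn R (x - unitv i) + b) (- (x ord0 i)%:~R).
  rewrite sqrrN sqnBunitv in h2.
  rewrite /powfun /Z sqnDunitv sqnBunitv.
  apply: le_trans (lerD (h1 _) (h2 t2 _)) _.
  - by rewrite /u; ring.
  - by rewrite /u; ring.
  by rewrite /powfun -mulrDr ler_pM2l ?expR_gt0 // le_eqVlt; apply/orP; left; apply/eqP; ring.
have avgZ : avg Z x <= (1 + d) / 2 * hker a x.
  rewrite (_ : avg Z x = avg (fun y => ln (sqn R y + b)) x - ln u).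
    have b8 : 8 <= b by lra.
    have := avg_ln_le x b8; have := ln_drift_le x a8 d0 d1 bE; rewrite -/u in b8 *; lra.
  by rewrite -[LHS]/(avgn 1 Z x) /Z avgnB avgn_cst.
apply: (@le_trans _ _ (powfun th b x * (1 + th * avg Z x + 64 * th ^+ 2 / u))).
  rewrite {1}/avg ler_pdivrMr //; apply: le_trans (ler_sum _ (fun i _ => stepi i)) _.
  rewrite -mulr_sumr -[leRHS]mulrA ler_pM2l ?expR_gt0 // !big_split /= -mulr_sumr.
  rewrite !sumr_const card_ord /avg le_eqVlt; apply/orP; left; apply/eqP.
  by rewrite -[_ / u *+ 4]mulr_natr; field; rewrite gt_eqF.
rewrite ler_pM2l ?expR_gt0 //; apply: le_trans (expR_ge1Dx _).
rewrite -addrA lerD2l /k.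
have hu : u^-1 <= hker a x by rewrite /hker lef_pV2 ?posrE /u //; lra.
have -> : th * ((1 + d) / 2 + 64 * th) * hker a x =
  th * ((1 + d) / 2 * hker a x) + 64 * th ^+ 2 * hker a x by ring.
by apply: lerD; [rewrite ler_pM2l | rewrite ler_wpM2l // mulr_ge0 ?sqr_ge0].
Qed.

(** A discrete Feynman-Kac bound: the weight [expR (- (k * g x))] of the first step exactly
    compensates the growth allowed for [avg f x]. *)
Lemma pathE_exp_supermartingale (f g : Z4 -> R) (k : R) x n :
  (forall y, 0 <= f y) -> (forall y, avg f y <= f y * expR (k * g y)) ->
  pathE n (fun s => f (x + endpoint s) * expR (- (k * pathsum g x s))) <= f x.
Proof.
move=> f0 fg; elim: n x => [|n IH] x.
  by rewrite /= /endpoint big_nil addr0 mulr0 oppr0 expR0 mulr1.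
have E (e : Z4) : pathE n (fun s => f (x + endpoint (e :: s)) *
      expR (- (k * pathsum g x (e :: s)))) <= expR (- (k * g x)) * f (x + e).
  rewrite (eq_pathE (G := fun s => expR (- (k * g x)) *
     (f (x + e + endpoint s) * expR (- (k * pathsum g (x + e) s))))).
    by rewrite pathEZ ler_pM2l ?expR_gt0.
  move=> s _; rewrite /endpoint big_cons addrA /= mulrDr opprD expRD; ring.
apply: (@le_trans _ _ (expR (- (k * g x)) * avg f x)).
  rewrite /avg mulrA /= ler_wpM2r ?invr_ge0 // mulr_sumr; apply: ler_sum => i _.
  by rewrite mulrDr; apply: lerD; exact: E.
by rewrite expRN mulrC ler_pdivrMr ?expR_gt0.
Qed.

(* If the local potential stays below [2 (1 - e) ln m], then either the walk ends
   within distance [m ^ (1/2 - e/4)] of the origin, which has small probability by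
   the decay of [avgn m (hker a)], or [(|X|^2 + b)^th * exp (- k * pathsum)] is at
   least a positive power of [m], contradicting its supermartingale bound. *)
Lemma lower_tail_bound a e x : 128 <= a -> 0 < e -> e <= 1 ->
  exists2 c : R, 0 < c & exists2 K : R, 0 <= K & forall m, (0 < m)%N ->
  pathE m (fun s => (pathsum (hker a) x s < 2 * (1 - e) * ln m%:R)%R%:R : R) <=
  K * expR (- (c * ln m%:R)) * (1 + ln m%:R).
Proof.
(* With [128 * th = d] the exponent of [m] below is [th * ((1 + 2 * d) * (1 - e) - (1 - e / 2))],
   and [2 * d = e / 4] makes the bracket at most [- e / 4]. *)
move=> a128 e0 e1; pose d := e / 8; pose th := d / 128.
have d0 : 0 < d by rewrite divr_gt0.
have t0 : 0 < th by rewrite divr_gt0 ?ltr0n.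
have d1 : d <= 1 by rewrite /d; lra.
have t1 : th <= 1 by rewrite /th; lra.
pose b := a + (a + 3) / d; pose k := th * ((1 + d) / 2 + 64 * th).
have ba : a <= b by rewrite /b lerDl divr_ge0 //; lra.
have s0 := sqn_ge0 R.
pose c := th * (e / 4).
have c0 : 0 < c by rewrite mulr_gt0 // divr_gt0.
have pw0 y : 0 <= powfun th b y by rewrite expR_ge0.
exists c => //; exists (powfun th b x + 2); first by rewrite addr_ge0.
move=> m m0; set l := ln m%:R.
have mR : 1 <= m%:R :> R by rewrite ler1n.
have l0 : 0 <= l by exact: ln_ge0.
pose sg := 2 * (1 - e) * l; pose L := (1 - e / 2) * l.
have k0 : 0 < k by rewrite mulr_gt0 //; lra.
have pt s : (pathsum (hker a) x s < sg)%R%:R <=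
  expR (k * sg - th * L) * (powfun th b (x + endpoint s) *
     expR (- (k * pathsum (hker a) x s))) + expR L * hker a (x + endpoint s) :> R.
  set y := x + endpoint s; set S := pathsum _ _ _.
  have h0 : 0 <= hker a y by apply: ltW; apply: hker_gt0; lra.
  have e0' : 0 <= expR L by exact: expR_ge0.
  case: ltP => [Ssg|_] /=; last first.
    by rewrite addr_ge0 // mulr_ge0 // ?expR_ge0 // mulr_ge0 ?expR_ge0.
  have [yL|Ly] := ltP (sqn R y + a) (expR L).
    rewrite -[leLHS]add0r lerD //; first by rewrite !mulr_ge0 ?expR_ge0.
    by rewrite /hker ler_pdivlMr ?mul1r ?ltW //; have := s0 y; lra.
  rewrite -[leLHS]addr0 lerD //; last by rewrite mulr_ge0.
  rewrite /powfun -!expRD -expR0 ler_expR.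
  have : L <= ln (sqn R y + b).
    rewrite -[L]expRK ler_ln ?posrE ?expR_gt0 //; first by lra.
    by have := s0 y; lra.
  have : k * S <= k * sg by rewrite ler_pM2l // ltW.
  move=> h1 h2; have : th * L <= th * ln (sqn R y + b) by rewrite ler_pM2l.
  lra.
apply: le_trans (pathE_le (fun s _ => pt s)) _.
rewrite pathED !pathEZ pathE_endpoint.
have le1 : pathE m (fun s => powfun th b (x + endpoint s) *
    expR (- (k * pathsum (hker a) x s))) <= powfun th b x.
  apply: pathE_exp_supermartingale => // y.
  by apply: (@avg_powfun_le a b d).
have ec : k * sg - th * L <= - (c * l).
  have -> : k * sg - th * L = (th * l) * ((1 + d + 128 * th) * (1 - e) - (1 - e / 2)).
    by rewrite /k /sg /L; field.
  have -> : - (c * l) = (th * l) * (- (e / 4)) by rewrite /c; ring.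
  rewrite ler_wpM2l //; first by rewrite mulr_ge0 // ltW.
  have -> : 128 * th = d by rewrite /th mulrC divfK // pnatr_eq0.
  by rewrite /d; clear -e0; nra.
have le2 : expR (k * sg - th * L) <= expR (- (c * l)) by rewrite ler_expR.
have le3 : avgn m (hker a) x <= 2 * (1 + l) / m%:R.
  have a9 : 9 <= a by lra.
  apply: le_trans (avgn_hker_le m x a9) _.
  have m1 : 0 < m.+1%:R :> R by [].
  have mm : m.+1%:R = m%:R + 1 :> R by rewrite natr1.
  rewrite ler_pM ?mulr_ge0 ?invr_ge0 ?ln_ge0 //.
  - by rewrite lerDl divr_ge0 //; lra.
  - rewrite ler_pM2l //.
    apply: (@le_trans _ _ (ln (2 * m%:R))).
      rewrite ler_ln ?posrE //; [|by rewrite ltr_wpDr // divr_ge0 //; lra|lra].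
      have : m.+1%:R / (a - 1) <= m%:R by rewrite ler_pdivrMr; nra.
      lra.
    rewrite lnM ?posrE //; last by lra.
    rewrite lerD2r; have := @le_ln_sub1 R 2 ltac:(by []); lra.
  - by rewrite lef_pV2 ?posrE //; lra.
have le4 : expR L / m%:R <= expR (- (c * l)).
  rewrite -[m%:R]lnK ?posrE; last by lra.
  rewrite -expRN -expRD ler_expR -/l /L /c.
  have : th * (e / 4) <= e / 2 by nra.
  by move=> h; have : th * (e / 4) * l <= e / 2 * l by [rewrite ler_wpM2r]; lra.
apply: (@le_trans _ _ (expR (- (c * l)) * powfun th b x + expR (- (c * l)) * (2 * (1 + l)))).
  apply: lerD; first by rewrite ler_pM ?expR_ge0 // pathE_ge0 // => s; rewrite mulr_ge0 ?expR_ge0.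
  apply: (@le_trans _ _ (expR L / m%:R * (2 * (1 + l)))).
    by rewrite mulrAC -mulrA ler_wpM2l ?expR_ge0.
  by rewrite ler_wpM2r // mulr_ge0 //; lra.
have -> : (powfun th b x + 2) * expR (- (c * l)) * (1 + l) =
  expR (- (c * l)) * (powfun th b x * (1 + l)) + expR (- (c * l)) * (2 * (1 + l)) by ring.
by rewrite lerD2r ler_wpM2l ?expR_ge0 // ler_peMr //; lra.
Qed.

End lower_tail.

(** * Energy and capacity *)

Section minimal_energy.
Variable R : realType.

Lemma simplex_minimizer N (M : 'I_N.+1 -> 'I_N.+1 -> R) :
  exists v : 'I_N.+1 -> R,
  [/\ forall i, 0 <= v i, \sum_i v i = 1 &
    forall w : 'I_N.+1 -> R, (forall i, 0 <= w i) -> \sum_i w i = 1 ->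
    \sum_i \sum_j M i j * v i * v j <= \sum_i \sum_j M i j * w i * w j].
Proof.
pose cube := [set v : 'rV[R]_N.+1 | forall i, `[0, 1]%classic (v ord0 i)].
pose plane := [set v : 'rV[R]_N.+1 | \sum_i v ord0 i = 1].
pose K := cube `&` plane.
have coordc i : continuous (fun v : 'rV[R]_N.+1 => v ord0 i) by exact: coord_continuous.
have cK : compact K.
  apply: compact_closedI.
    have h := @rV_compact R N.+1 (fun=> `[0, 1]%classic).
    by apply: h => _; exact: segment_compact.
  apply: (@closed_comp _ _ (fun v : 'rV[R]_N.+1 => \sum_i v ord0 i) [set 1]).
    by move=> v _; apply: (cvg_sum_seq (nbhs_filter v)) => i; exact: coordc.
  exact: closed_eq.
pose Q (v : 'rV[R]_N.+1) := \sum_i \sum_j M i j * v ord0 i * v ord0 j.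
have cQ : continuous Q.
  move=> v; apply: (cvg_sum_seq (nbhs_filter v)) => i; apply: (cvg_sum_seq (nbhs_filter v)) => j.
  by apply: cvgM; [apply: cvgMl_tmp|]; exact: coordc.
have K0 : K !=set0.
  exists (delta_mx ord0 ord0); split => [i|] /=.
    by rewrite in_itv /= mxE eqxx /=; case: (_ == _); rewrite ?lexx ?ler01.
  rewrite /plane /= (bigD1 ord0) //= mxE !eqxx big1 ?addr0 // => i i0.
  by rewrite mxE eqxx /= (negbTE i0).
have [v] := compact_EVT_min K0 cK (continuous_subspaceT cQ).
rewrite inE => -[v01 v1] vmin; exists (fun i => v ord0 i); split => //.
  by move=> i; have := v01 i; rewrite /= in_itv /= => /andP[].
move=> w w0 w1; have := vmin (\row_i w i); rewrite inE => /(_ _) H.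
have : K (\row_i w i).
  split => [i|] /=.
    rewrite in_itv /= mxE w0 -w1 (bigD1 i) //= lerDl.
    by apply: sumr_ge0 => j _; exact: w0.
  by rewrite /plane /= -[RHS]w1; apply: eq_bigr => i _; rewrite mxE.
move=> /H; rewrite /Q; congr (_ <= _).
by apply: eq_bigr => i _; apply: eq_bigr => j _; rewrite !mxE.
Qed.

(** First variation: if the potential at a point were below the energy, shifting a little mass there
    would lower the energy. *)
Lemma minimizer_potential N (M : 'I_N.+1 -> 'I_N.+1 -> R) (v : 'I_N.+1 -> R) :
  (forall i j, M i j = M j i) -> (forall i, 0 <= v i) -> \sum_i v i = 1 ->
  (forall w : 'I_N.+1 -> R, (forall i, 0 <= w i) -> \sum_i w i = 1 ->
    \sum_i \sum_j M i j * v i * v j <= \sum_i \sum_j M i j * w i * w j) ->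
  forall i, \sum_i \sum_j M i j * v i * v j <= \sum_j M i j * v j.
Proof.
move=> Ms v0 v1 vmin k; set Q := (X in X <= _); set U := (X in _ <= X).
rewrite leNgt; apply/negP => UQ.
pose D := Q - U; pose C := Q - 2 * U + M k k.
have D0 : 0 < D by rewrite subr_gt0.
have c0 := normr_ge0 C.
(* Moving mass [t] to [k] changes the energy by [t * (t * C - 2 * D)]. This [t] is positive, at most
   1, and gives [t * C <= D], so the change is negative. *)
pose t := D / (D + `|C| + D).
have S0 : 0 < D + `|C| + D by lra.
have t0 : 0 < t by rewrite divr_gt0.
have t1 : t <= 1 by rewrite ler_pdivrMr // mul1r; lra.
have tC : t * C <= D.
  apply: (@le_trans _ _ (t * `|C|)); first by rewrite ler_wpM2l ?(ltW t0) // ler_norm.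
  by rewrite mulrAC ler_pdivrMr //; nra.
pose e (i : 'I_N.+1) : R := (i == k)%:R.
have sume (f : 'I_N.+1 -> R) : \sum_i f i * e i = f k.
  rewrite (bigD1 k) //= /e eqxx mulr1 big1 ?addr0 // => i /negbTE ->.
  by rewrite mulr0.
pose w i := (1 - t) * v i + t * e i.
have := vmin w.
have w0 i : 0 <= w i by rewrite addr_ge0 // mulr_ge0 ?ler0n //; lra.
have w1 : \sum_i w i = 1.
  rewrite big_split /= -!mulr_sumr v1 (eq_bigr (fun i => 1 * e i)) => [|i _].
    by rewrite sume; ring.
  by rewrite mul1r.
move=> /(_ w0 w1).
have -> : \sum_i \sum_j M i j * w i * w j =
    (1 - t) ^+ 2 * Q + 2 * t * (1 - t) * U + t ^+ 2 * M k k.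
  have E i : \sum_j M i j * w i * w j =
      (1 - t) ^+ 2 * (\sum_j M i j * v i * v j) +
      t * (1 - t) * (v i * M k i) +
      (t * (1 - t) * \sum_j M i j * v j) * e i + (t ^+ 2 * M i k) * e i.
    have -> : v i * M k i = \sum_j (M i j * v i) * e j by rewrite sume Ms mulrC.
    have -> : t ^+ 2 * M i k * e i = t ^+ 2 * \sum_j (M i j * e i) * e j.
      by rewrite sume; ring.
    rewrite !mulr_sumr mulr_suml -!big_split /=; apply: eq_bigr => j _.
    by rewrite /w; ring.
  rewrite (eq_bigr _ (fun i _ => E i)) !big_split /= -!mulr_sumr.
  rewrite (sume (fun i => t * (1 - t) * \sum_j M i j * v j)).
  rewrite (sume (fun i => t ^+ 2 * M i k)) -/Q -/U.
  have -> : \sum_i v i * M k i = U by apply: eq_bigr => i _; rewrite mulrC.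
  ring.
rewrite -/Q -subr_ge0.
have -> : (1 - t) ^+ 2 * Q + 2 * t * (1 - t) * U + t ^+ 2 * M k k - Q =
  t * (t * C - 2 * D) by rewrite /C /D; ring.
rewrite pmulr_rge0 //; lra.
Qed.

End minimal_energy.

(** * Two-sided capacity bounds from test measures and equilibrium measures *)

Section capacity_bounds.
Variable R : realType.
Implicit Types (B : set Z4) (nu : Z4 -> R).

Local Notation gE := (fun x : Z4 => (ggreen R x)%:E).

Lemma prob_onE B nu : finite_set B -> prob_on B nu <->
  (forall x, x \in fset_set B -> 0 <= nu x) /\ \sum_(x <- fset_set B) nu x = 1.
Proof.
move=> fB; rewrite /prob_on /= fsbig_finite //; split=> -[h1 h2]; split=> // x.
  by rewrite in_fset_set // inE; exact: h1.
by move=> Bx; apply: h1; rewrite in_fset_set // inE.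
Qed.

Definition energyR (s : seq Z4) nu : R :=
  \sum_(x <- s) \sum_(y <- s) ggreen R (y - x) * nu x * nu y.

Lemma energyE B nu : finite_set B -> energy gE B nu = (energyR (fset_set B) nu)%:E.
Proof.
move=> fB; rewrite /energy fsbig_finite // /energyR -sumEFin.
by apply: eq_bigr => x _; rewrite fsbig_finite // -sumEFin.
Qed.

Lemma energyR_ge0 (s : seq Z4) nu : (forall x, x \in s -> 0 <= nu x) -> 0 <= energyR s nu.
Proof.
move=> nu0; rewrite /energyR big_seq; apply: sumr_ge0 => x xs.
rewrite big_seq; apply: sumr_ge0 => y ys.
by rewrite !mulr_ge0 ?nu0 ?ggreen_ge0.
Qed.

(** The energy is tested with the empirical measure of [s]. Repetitions count as multiplicities, so
    that the local time of a walk can be used. *)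
Lemma capacity_ge B (s : seq Z4) : finite_set B -> s != [::] ->
  (forall x, x \in s -> B x) ->
  (((size s)%:R ^+ 2 / \sum_(x <- s) \sum_(y <- s) ggreen R (y - x))%:E
    <= capacity gE B)%E.
Proof.
move=> fB s0 sB.
have n0 : 0 < (size s)%:R :> R by rewrite ltr0n lt0n size_eq0.
set n := (size s)%:R in n0 *; set V := \sum_(x <- s) _.
pose nu x : R := (count_mem x s)%:R / n.
have nu0 x : 0 <= nu x by rewrite divr_ge0 // ltW.
have sumnu (f : Z4 -> R) : \sum_(x <- fset_set B) f x * nu x = (\sum_(x <- s) f x) / n.
  rewrite mulr_suml (eq_bigr (fun x => \sum_(a <- s) f x / n * (a == x)%:R)); last first.
    move=> x _; rewrite -mulr_sumr /nu -sum1_count big_mkcond /= natr_sum.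
    rewrite mulrA mulrAC; congr (_ * _).
  rewrite exchange_big /=; rewrite big_seq [RHS]big_seq; apply: eq_bigr => a sa.
  rewrite (bigD1_seq a) ?fset_uniq //=; last by rewrite in_fset_set // inE; exact: sB.
  rewrite eqxx mulr1 big1 ?addr0 // => x xa.
  by rewrite eq_sym (negbTE xa) mulr0.
have Pnu : prob_on B nu.
  apply/prob_onE => //; split => [x _|]; first exact: nu0.
  have := sumnu (fun=> 1); under eq_bigr do rewrite mul1r; move=> ->.
  by rewrite big_const_seq count_predT iter_addr_0 divff // gt_eqF.
have En : energyR (fset_set B) nu = V / n ^+ 2.
  rewrite /energyR (eq_bigr (fun x => ((\sum_(y <- s) ggreen R (y - x)) / n) * nu x)).
    by rewrite sumnu -mulr_suml -mulrA -invfM -expr2.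
  move=> x _; rewrite -sumnu mulr_suml; apply: eq_bigr => y _; ring.
have V0 : 0 < V.
  case: s s0 sB @n n0 @V @nu nu0 sumnu Pnu En => // a s' _ _ n n0 V _ _ _ _ _.
  rewrite /V big_cons big_cons subrr.
  apply: ltr_wpDr.
    by apply: sumr_ge0 => x _; apply: sumr_ge0 => y _; exact: ggreen_ge0.
  apply: ltr_wpDr; first by apply: sumr_ge0 => x _; exact: ggreen_ge0.
  by apply: lt_le_trans (ggreen0_ge1 R).
have le1 : (ereal_inf [set energy gE B nu | nu in prob_on B] <= (V / n ^+ 2)%:E)%E.
  by apply: ereal_inf_lbound; exists nu => //; rewrite energyE // En.
have ge0 : (0 <= ereal_inf [set energy gE B nu | nu in prob_on B])%E.
  apply: le_ereal_inf_tmp => _ [mu /prob_onE -/(_ fB)[mu0 _] <-].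
  by rewrite energyE // lee_fin energyR_ge0.
rewrite /capacity.
have -> : (n ^+ 2 / V)%:E = ((V / n ^+ 2)%:E^-1)%E.
  rewrite inver gt_eqF; first by rewrite invf_div.
  by rewrite divr_gt0 // exprn_gt0.
rewrite lee_pV2 // inE /= lee_fin; rewrite divr_ge0 ?exprn_ge0 ?ltW //.
Qed.

(* The minimiser [nu] of the energy has potential at most its energy [E] everywhere
   by the maximum principle; [H] exploits such a [nu] to bound [1 / E]. *)
Lemma capacity_le B (M : R) : finite_set B -> B !=set0 ->
  (forall nu (E : R), (forall x, 0 <= nu x) -> \sum_(x <- fset_set B) nu x = 1 ->
    0 <= E -> (forall z, \sum_(x <- fset_set B) nu x * ggreen R (z - x) <= E) ->
    1 <= E * M) ->
  (capacity gE B <= M%:E)%E.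
Proof.
move=> fB [x0 Bx0] H.
pose s : seq Z4 := fset_set B.
have us : uniq s by exact: fset_uniq.
have [N sN] : exists N, size s = N.+1.
  case E : s => [|y s']; last by exists (size s').
  have : x0 \in s by rewrite /s in_fset_set // inE.
  by rewrite E.
pose b (i : 'I_N.+1) := nth 0 s i.
have sumb (f : Z4 -> R) : \sum_(x <- s) f x = \sum_(i < N.+1) f (b i).
  by rewrite (big_nth 0) sN big_mkord.
have binj i j : b i = b j -> i = j.
  move=> /eqP; rewrite nth_uniq ?sN // => /eqP ij; exact: val_inj.
have [v [v0 v1 vmin]] := simplex_minimizer (fun i j : 'I_N.+1 => ggreen R (b j - b i)).
have Ms i j : ggreen R (b j - b i) = ggreen R (b i - b j) by rewrite -ggreenN opprB.
have vpot := minimizer_potential Ms v0 v1 vmin.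
set E := \sum_i \sum_j ggreen R (b j - b i) * v i * v j in vmin vpot.
pose nu x := \sum_i v i * (x == b i)%:R.
have nub i : nu (b i) = v i.
  rewrite /nu (bigD1 i) //= eqxx mulr1 big1 ?addr0 // => j ji.
  by case: eqP => [/binj ij|_]; [rewrite ij eqxx in ji | rewrite mulr0].
have nu0 x : 0 <= nu x by apply: sumr_ge0 => i _; rewrite mulr_ge0 ?ler0n.
have E0 : 0 <= E.
  by apply: sumr_ge0 => i _; apply: sumr_ge0 => j _; rewrite !mulr_ge0 ?ggreen_ge0.
pose u z := \sum_i v i * ggreen R (z - b i).
have ub i : E <= u (b i).
  apply: le_trans (vpot i) _; rewrite le_eqVlt; apply/orP; left; apply/eqP.
  by apply: eq_bigr => j _; rewrite Ms mulrC.
(* The mean of [u - E] under [v] is zero and its terms are nonnegative by [ub], so each of them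
   vanishes. *)
have ubE i : v i != 0 -> u (b i) = E.
  move=> vi; apply/eqP; rewrite -subr_eq0; apply/eqP.
  have : \sum_j v j * (u (b j) - E) = 0.
    rewrite (eq_bigr (fun j => v j * u (b j) - v j * E)) => [|j _]; last by rewrite mulrBr.
    rewrite sumrB -mulr_suml v1 mul1r; apply/eqP; rewrite subr_eq0; apply/eqP.
    rewrite /E; apply: eq_bigr => j _; rewrite /u mulr_sumr.
    by apply: eq_bigr => k _; rewrite Ms; ring.
  move=> /eqP; rewrite psumr_eq0; last by move=> j _; rewrite mulr_ge0 ?subr_ge0.
  by move=> /allP /(_ i (mem_index_enum i)) /=; rewrite mulf_eq0 (negbTE vi) => /eqP.
have u0 z : 0 <= u z by apply: sumr_ge0 => i _; rewrite mulr_ge0 ?ggreen_ge0.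
have avgu m z : avgn m u z = \sum_i v i * avgn m (ggreen R) (z - b i).
  by rewrite /u avgn_sum; apply: eq_bigr => i _; rewrite avgnZ avgn_shift.
have uE z : u z <= E.
  move: z; apply: max_principle => //.
    (* On the support [u] equals [E]; off it [u] is harmonic, because each [delta0] term of
       [ggreen_eq] is zero or has weight zero. *)
    move=> x; case: (boolP [exists i, (x == b i) && (v i != 0)]).
      by move=> /existsP[i /andP[/eqP -> vi]]; left; rewrite ubE.
    move=> /existsPn h; right.
    rewrite -[avg u x]/(avgn 1 u x) avgu; apply: ler_sum => i _.
    rewrite ggreen_eq mulrDr gerDr le_eqVlt; apply/orP; left; apply/eqP.
    have := h i; rewrite /delta0 subr_eq0 negb_and negbK.
    by case: eqP => [_ /= /eqP ->|_ _]; rewrite ?mul0r ?mulr0.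
  move=> e e0; have [m Hm] := @avgn_ggreen_small R e e0.
  exists m => x; rewrite avgu.
  apply: (@le_trans _ _ (\sum_i v i * e)); last by rewrite -mulr_suml v1 mul1r.
  by apply: ler_sum => i _; rewrite ler_wpM2l // Hm.
have EM : 1 <= E * M.
  apply: (H nu) => //.
    by rewrite -/s sumb -[RHS]v1; apply: eq_bigr => i _; exact: nub.
  move=> z; rewrite -/s sumb; apply: le_trans (uE z).
  by apply: ler_sum => i _; rewrite nub.
have Ep : 0 < E.
  by rewrite lt_neqAle E0 andbT eq_sym; apply: contraTneq EM => ->; rewrite mul0r -ltNge.
have inf : (E%:E <= ereal_inf [set energy gE B nu | nu in prob_on B])%E.
  apply: le_ereal_inf_tmp => _ [mu /prob_onE -/(_ fB)[mu0 mu1] <-].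
  rewrite energyE // lee_fin /energyR -/s sumb.
  have bs i : b i \in s by apply: mem_nth; rewrite sN.
  rewrite (eq_bigr (fun i => \sum_j ggreen R (b j - b i) * mu (b i) * mu (b j))).
    apply: (vmin (mu \o b)) => [i|]; first exact: mu0.
    by rewrite -sumb.
  by move=> i _; rewrite sumb.
rewrite /capacity; apply: (@le_trans _ _ ((E%:E)^-1)%E).
  rewrite lee_pV2 //; rewrite inE /= ?lee_fin //.
  by apply: le_trans inf; rewrite lee_fin.
rewrite inver gt_eqF // lee_fin -(@ler_pM2l _ E) // divff // gt_eqF //.
Qed.

End capacity_bounds.

(** * Capacity of the range along a path *)

Section expected_capacity.
Variable R : realType.

Local Notation gE := (fun x : Z4 => (ggreen R x)%:E).

Definition visited (n : nat) (s : seq Z4) : set Z4 :=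
  [set endpoint (take k s) | k in [set k | (k <= n)%N]].

Lemma visited_finite n s : finite_set (visited n s).
Proof. by apply: finite_image; exact: (finite_II n.+1). Qed.

Lemma minkowski_finite (B C : set Z4) :
  finite_set B -> finite_set C -> finite_set (minkowski_sum B C).
Proof.
move=> fB fC; have -> : minkowski_sum B C = (fun p => p.1 + p.2) @` (B `*` C).
  rewrite /minkowski_sum; apply/seteqP; split => x /=.
    by move=> [b Bb [c Cc <-]]; exists (b, c).
  by move=> [[b c] /= [Bb Cc] <-]; exists b => //; exists c.
by apply: finite_image; exact: finite_setX.
Qed.

Lemma endpoint_cat s t : endpoint (s ++ t) = endpoint s + endpoint t.
Proof. by rewrite /endpoint big_cat. Qed.

Lemma endpoint_take_sub j k s : (j <= k)%N ->
  endpoint (take k s) - endpoint (take j s) = endpoint (drop j (take k s)).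
Proof.
move=> jk; rewrite -[take k s in LHS](cat_take_drop j) endpoint_cat.
by rewrite take_takel // addrAC subrr add0r.
Qed.

Lemma pathE_diff n j k (f : Z4 -> R) : (j <= k)%N -> (k <= n)%N ->
  pathE n (fun s => f (endpoint (take k s) - endpoint (take j s))) = avgn (k - j) f 0.
Proof.
move=> jk kn.
rewrite (eq_pathE (G := fun s => f (endpoint (drop j (take k s))))); last first.
  by move=> s _; rewrite endpoint_take_sub.
rewrite -{1}(subnKC kn) (pathE_take k (n - k) (fun s => f (endpoint (drop j s)))).
rewrite -{1}(subnKC jk) (pathE_drop j (k - j) (fun s => f (endpoint s))).
by rewrite -pathE_endpoint; apply: eq_pathE => s _; rewrite add0r.
Qed.

Definition interaction (n : nat) (s : seq Z4) : R :=
  \sum_(0 <= j < n.+1) \sum_(0 <= k < n.+1)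
     ggreen R (endpoint (take k s) - endpoint (take j s)).

(** For fixed [j] the times from [j] on and the times before it each contribute at most one [fsum],
    by stationarity of the increments and the symmetry of [ggreen]; hence the factor 2. *)
Lemma pathE_interaction_le n :
  pathE n (interaction n) <= 2 * n.+1%:R * fsum R n.+1 0.
Proof.
pose c k := avgn k (ggreen R) 0.
have c0 k : 0 <= c k by apply: avgn_ge0 => y; exact: ggreen_ge0.
rewrite pathE_sum mulrAC -[X in _ * X%:R](subn0 n.+1) mulr_natr -sumr_const_nat.
rewrite big_nat [leRHS]big_nat; apply: ler_sum => j /= jn.
rewrite pathE_sum (big_cat_nat (leq0n j) (ltnW jn)) /= mulr_natl mulr2n.
apply: lerD.
  rewrite big_nat_rev /= add0n big_nat.
  apply: (@le_trans _ _ (\sum_(0 <= k < j.+1) c k)); last first.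
    by apply: fsum_le.
  rewrite big_nat_recl // -[leLHS]add0r; apply: lerD; first exact: c0.
  rewrite [leRHS]big_nat; apply: ler_sum => k /= kj.
  rewrite (eq_pathE (G := fun s => ggreen R (endpoint (take j s) - endpoint (take (j - k.+1) s)))).
    by rewrite pathE_diff ?leq_subr // subKn.
  by move=> s _; rewrite -ggreenN opprB.
apply: (@le_trans _ _ (\sum_(0 <= k < n.+1 - j) c k)); last first.
  by apply: fsum_le; exact: leq_subr.
rewrite -{1}(add0n j) big_addn big_nat [leRHS]big_nat; apply: ler_sum => k /= kn.
rewrite pathE_diff ?leq_addl //; first by rewrite addnK.
by move: kn jn; lia.
Qed.

Definition range_capacity (A : set Z4) (n : nat) (s : seq Z4) : \bar R :=
  capacity gE (minkowski_sum (visited n s) A).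

Lemma interaction_gt0 n s : 0 < interaction n s.
Proof.
rewrite /interaction big_nat_recl // big_nat_recl // subrr.
apply: ltr_wpDr.
  by apply: sumr_ge0 => j _; apply: sumr_ge0 => k _; exact: ggreen_ge0.
apply: ltr_wpDr; first by apply: sumr_ge0 => k _; exact: ggreen_ge0.
exact: lt_le_trans (ggreen0_ge1 R).
Qed.

(** One point [c] of [A] suffices: the path translated by [c] lies in the Minkowski sum, and [c]
    cancels in all differences. *)
Lemma range_capacity_ge A n s : finite_set A -> A !=set0 ->
  ((n.+1%:R ^+ 2 / interaction n s)%:E <= range_capacity A n s)%E.
Proof.
move=> fA [c Ac].
pose t := [seq endpoint (take k s) + c | k <- iota 0 n.+1].
have tB x : x \in t -> minkowski_sum (visited n s) A x.
  move=> /mapP[k]; rewrite mem_iota add0n /= => kn ->.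
  exists (endpoint (take k s)); last by exists c.
  by exists k => //=.
have := capacity_ge R (minkowski_finite (visited_finite n s) fA) _ tB.
rewrite size_map size_iota => /(_ isT).
rewrite /range_capacity; congr (_%:E <= _)%E; congr (_ / _).
rewrite /interaction /index_iota subn0 big_map; apply: eq_bigr => j _.
rewrite big_map; apply: eq_bigr => k _.
by rewrite opprD addrACA subrr addr0.
Qed.

(* Tangent line of [1/V] at [V = w], a lower bound by convexity. *)
Lemma range_capacity_ge_tangent A n s (w : R) : finite_set A -> A !=set0 -> 0 < w ->
  ((n.+1%:R ^+ 2 * (2 / w - interaction n s / w ^+ 2))%:E <= range_capacity A n s)%E.
Proof.
move=> fA A0 w0; apply: le_trans (range_capacity_ge n s fA A0).
rewrite lee_fin ler_wpM2l ?sqr_ge0 //.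
have V0 := interaction_gt0 n s; set V := interaction n s in V0 *.
rewrite -subr_ge0.
have -> : V^-1 - (2 / w - V / w ^+ 2) = (V - w) ^+ 2 / (V * w ^+ 2).
  by field; rewrite !gt_eqF.
by rewrite divr_ge0 ?sqr_ge0 // mulr_ge0 ?sqr_ge0 // ltW.
Qed.

(** Jensen's inequality for [1 / V] in linearised form: the mean of [2 / w - V / w ^+ 2] is at least
    [1 / w] as soon as [w] bounds the mean of [V]. *)
Lemma pathE_tangent_ge n (w : R) : 0 < w -> 2 * n.+1%:R * fsum R n.+1 0 <= w ->
  n.+1%:R ^+ 2 / w <=
  pathE n (fun s => n.+1%:R ^+ 2 * (2 / w - interaction n s / w ^+ 2)).
Proof.
move=> w0 fw; rewrite pathEZ ler_wpM2l ?sqr_ge0 //.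
rewrite (eq_pathE (G := fun s => 2 / w + - (w ^+ 2)^-1 * interaction n s)); last first.
  by move=> s _; ring.
rewrite pathED pathE_cst pathEZ.
have := le_trans (pathE_interaction_le n) fw; set V := pathE _ _ => Vw.
have : V / w ^+ 2 <= w^-1.
  by rewrite ler_pdivrMr ?exprn_gt0 // expr2 mulrA mulVf ?mul1r // gt_eqF.
rewrite mulNr mulrC; lra.
Qed.

(** [hker a] is replaced by its convolution up to a small error. For each [y] the potential of [nu]
    at [z + y] is at most [E], and what remains is the mass of the kernel, at most [Q]. *)
Lemma sum_potential_le (s : seq Z4) (nu : Z4 -> R) (E Q a : R) z :
  9 <= a -> (forall N, \sum_(y <- box N) qker a y <= Q) ->
  (forall x, 0 <= nu x) -> \sum_(x <- s) nu x = 1 -> 0 <= E ->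
  (forall y, \sum_(x <- s) nu x * ggreen R (y - x) <= E) ->
  \sum_(x <- s) nu x * hker a (x - z) <= E * Q.
Proof.
move=> a9 hQ nu0 nu1 E0 hE; have a8 : 8 <= a by lra.
apply/ler_addgt0Pr => e e0.
have e20 : 0 < e / 2 by rewrite divr_gt0.
have [m Hm] := avgn_hker_small a9 e20.
have em0 : 0 < e / 2 / m.+1%:R by rewrite divr_gt0.
have [N HN] := qker_small a8 em0.
have q0 y : 0 <= qker a y :> R by rewrite ltW // qker_gt0.
have conv x : hker a x <= \sum_(y <- box N) qker a y * ggreen R (x - y) + e.
  apply: le_trans (hker_le_conv m.+1 x a8 (box_uniq N) (ltW em0) HN) _.
  rewrite -addrA lerD2l mulrCA divff ?mulr1 ?pnatr_eq0 //.
  by have := Hm m.+1 x (leqnSn m); lra.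
apply: (@le_trans _ _ (\sum_(x <- s) nu x *
    (\sum_(y <- box N) qker a y * ggreen R (x - z - y) + e))).
  by apply: ler_sum => x _; rewrite ler_wpM2l.
rewrite (eq_bigr (fun x => \sum_(y <- box N) qker a y * (nu x * ggreen R (z + y - x)) + nu x * e)).
  rewrite big_split /= -mulr_suml nu1 mul1r lerD2r exchange_big /=.
  apply: (@le_trans _ _ (\sum_(y <- box N) qker a y * E)).
    by apply: ler_sum => y _; rewrite -mulr_sumr ler_wpM2l.
  by rewrite -mulr_suml mulrC ler_wpM2l.
move=> x _; rewrite mulrDr mulr_sumr; congr (_ + _); apply: eq_bigr => y _.
by rewrite -(ggreenN _ (x - z - y)) !opprB mulrCA [y + _]addrA [y + z]addrC.
Qed.

Definition range_potential (a : R) (n k : nat) (s : seq Z4) (x : Z4) : R :=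
  \sum_(0 <= j < n.+1) hker a (endpoint (take k s) + x - endpoint (take j s)).

(* Off the bad points the normalised local time potential is at least [1]; each bad
   point is covered by adding a unit point mass there. *)
Lemma range_capacity_le A n s (Q a sg : R) : finite_set A -> A !=set0 ->
  9 <= a -> (forall N, \sum_(y <- box N) qker a y <= Q) -> 0 < sg ->
  (range_capacity A n s <=
   (n.+1%:R * Q / sg + \sum_(0 <= k < n.+1) \sum_(x <- fset_set A)
      (range_potential a n k s x < sg)%R%:R)%:E)%E.
Proof.
move=> fA [c Ac] a9 hQ s0; apply: capacity_le.
- exact: minkowski_finite (visited_finite n s) fA.
- by exists (endpoint (take 0 s) + c); exists (endpoint (take 0 s)); [exists 0%N|exists c].
set B := minkowski_sum _ _; have fB : finite_set B := minkowski_finite (visited_finite n s) fA.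
move=> nu E nu0 nu1 E0 hE.
have h0 y : 0 <= hker a y :> R by apply: ltW; apply: hker_gt0; lra.
(* Since [ggreen R 0] is at least 1, no point carries more mass than [E]; this is the price of a bad
   point. *)
have nuE y : \sum_(x <- fset_set B) nu x * (x == y)%:R <= E.
  apply: le_trans (hE y); apply: ler_sum => x _; rewrite ler_wpM2l //.
  by case: eqP => [->|_]; rewrite ?subrr ?ggreen0_ge1 ?ggreen_ge0.
have cover x : x \in fset_set B ->
  1 <= sg^-1 * (\sum_(0 <= j < n.+1) hker a (x - endpoint (take j s))) +
    \sum_(0 <= k < n.+1) \sum_(y <- fset_set A)
      (range_potential a n k s y < sg)%R%:R * (x == endpoint (take k s) + y)%:R.
  rewrite in_fset_set // inE => -[_ [k kn <-] [y Ay xE]].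
  have S0 k' : 0 <= \sum_(y0 <- fset_set A)
      (range_potential a n k' s y0 < sg)%R%:R * (x == endpoint (take k' s) + y0)%:R :> R.
    by apply: sumr_ge0 => y' _; rewrite mulr_ge0 ?ler0n.
  have P0 : 0 <= sg^-1 * (\sum_(0 <= j < n.+1) hker a (x - endpoint (take j s))).
    by rewrite mulr_ge0 ?invr_ge0 ?(ltW s0) //; apply: sumr_ge0.
  case: (ltP (range_potential a n k s y) sg) => [bad|good]; last first.
    rewrite -[leLHS]addr0; apply: lerD; last by apply: sumr_ge0.
    by rewrite mulrC ler_pdivlMr // mul1r -xE.
  rewrite -[leLHS]add0r; apply: lerD => //.
  rewrite (bigD1_seq k) ?iota_uniq ?mem_index_iota //=.
  rewrite -[leLHS]addr0; apply: lerD; last by apply: sumr_ge0.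
  rewrite (bigD1_seq y) ?fset_uniq ?in_fset_set ?inE //= bad xE eqxx mulr1 lerDl.
  by apply: sumr_ge0 => y' _; rewrite mulr_ge0 ?ler0n.
rewrite -{1}nu1.
apply: (@le_trans _ _ (\sum_(x <- fset_set B) nu x *
  (sg^-1 * (\sum_(0 <= j < n.+1) hker a (x - endpoint (take j s))) +
    \sum_(0 <= k < n.+1) \sum_(y <- fset_set A)
      (range_potential a n k s y < sg)%R%:R * (x == endpoint (take k s) + y)%:R))).
  rewrite big_seq [leRHS]big_seq; apply: ler_sum => x xB.
  by rewrite ler_peMr // cover.
rewrite (eq_bigr (fun x => sg^-1 * (\sum_(0 <= j < n.+1) nu x * hker a (x - endpoint (take j s))) +
    \sum_(0 <= k < n.+1) \sum_(y <- fset_set A)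
      (range_potential a n k s y < sg)%R%:R * (nu x * (x == endpoint (take k s) + y)%:R))); last first.
  move=> x _; rewrite mulrDr; congr (_ + _).
    by rewrite mulrCA -mulr_sumr.
  rewrite mulr_sumr; apply: eq_bigr => k _; rewrite mulr_sumr; apply: eq_bigr => y _.
  by rewrite mulrCA.
rewrite big_split /= mulrDr; apply: lerD.
  rewrite -mulr_sumr exchange_big /=.
  have -> : E * (n.+1%:R * Q / sg) = sg^-1 * (n.+1%:R * (E * Q)) by ring.
  rewrite ler_wpM2l ?invr_ge0 ?(ltW s0) // mulr_natl -{2}(subn0 n.+1) -sumr_const_nat.
  by apply: ler_sum => j _; apply: sum_potential_le.
rewrite exchange_big /= mulr_sumr; apply: ler_sum => k _.
rewrite exchange_big /= mulr_sumr; apply: ler_sum => y _.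
by rewrite -mulr_sumr mulrC ler_wpM2r ?ler0n.
Qed.

End expected_capacity.

(** * Expected number of bad points *)

Section bad_points.
Variable R : realType.

Lemma pathsumE (f : Z4 -> R) x s :
  pathsum f x s = \sum_(0 <= i < size s) f (x + endpoint (take i s)).
Proof.
elim: s x => [|e s IH] x; first by rewrite big_nil.
rewrite /= big_nat_recl // take0 {1}/endpoint big_nil addr0 IH.
congr (_ + _); apply: eq_bigr => i _.
by rewrite /= /endpoint big_cons addrA.
Qed.

Lemma pathsum_take_le (f : Z4 -> R) x m s : (forall y, 0 <= f y) ->
  pathsum f x (take m s) <= pathsum f x s.
Proof.
move=> f0; rewrite !pathsumE size_take_min.
rewrite [leRHS](big_cat_nat _ (geq_minr m (size s))) //=.
rewrite -[leLHS]addr0; apply: lerD; last by apply: sumr_ge0.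
rewrite big_nat [leRHS]big_nat le_eqVlt; apply/orP; left; apply/eqP.
apply: eq_bigr => i /=; rewrite leq_min => /andP[im _].
by rewrite take_takel // ltnW.
Qed.

Lemma endpoint_opp s : endpoint (map -%R s) = - endpoint s.
Proof. by rewrite /endpoint big_map sumrN. Qed.

Lemma endpoint_rev s : endpoint (rev s) = endpoint s.
Proof. by apply: perm_big; rewrite perm_rev. Qed.

(** The future of time [k] covers the times [k] to [n - 1], the reversed and negated past the times
    [k] down to 1. At most time [k] is counted twice, and [hker a <= 1] pays for it. *)
Lemma range_potential_ge (a : R) n k s x : 1 <= a -> size s = n -> (k <= n)%N ->
  pathsum (hker a) (- x) (drop k s) + pathsum (hker a) (- x) (rev (map -%R (take k s)))
    <= range_potential a n k s x + 1.
Proof.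
move=> a1 sn kn.
have hE y z : hker a (y + x - z) = hker a (- x + (z - y)) :> R.
  by rewrite -hkerN opprB opprD addrA addrC.
have h1 y : hker a y <= 1 by rewrite /hker invf_le1; have := sqn_ge0 R y; lra.
rewrite /range_potential (eq_bigr _ (fun j _ => hE _ _)).
rewrite (big_cat_nat (leq0n k) (leqW kn)) /= [leRHS]addrC addrA.
rewrite addrC; apply: lerD; last first.
  rewrite pathsumE size_rev size_map size_takel ?sn //.
  have -> : \sum_(0 <= i < k) hker a (- x + endpoint (take i (rev (map -%R (take k s))))) =
            \sum_(0 <= i < k) hker a (- x + (endpoint (take (k - i) s) - endpoint (take k s))) :> R.
    rewrite big_nat [RHS]big_nat; apply: eq_bigr => i /= ik.
    rewrite take_rev endpoint_rev -map_drop endpoint_opp size_map size_takel ?sn //.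
    by rewrite -endpoint_take_sub ?leq_subr // opprB.
  case: k kn => [|k] kn; first by rewrite !big_nil addr0.
  rewrite [leLHS]big_nat_recl //=; apply: lerD => //.
  rewrite [leRHS]big_nat_recl // -[leLHS]add0r; apply: lerD; first by apply: ltW; apply: hker_gt0; lra.
  rewrite big_nat_rev /= add0n big_nat [leRHS]big_nat le_eqVlt; apply/orP; left; apply/eqP.
  by apply: eq_bigr => i /= ik; rewrite subSS subKn.
rewrite big_nat_recr //= -[leLHS]addr0; apply: lerD; last by apply: ltW; apply: hker_gt0; lra.
rewrite pathsumE size_drop sn.
set F := fun i => hker a (- x + (endpoint (take i s) - endpoint (take k s))).
have -> : \sum_(k <= i < n) F i = \sum_(0 <= i < n - k) F (i + k)%N.
  by rewrite -{1}(add0n k) big_addn.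
rewrite /F big_nat [leRHS]big_nat le_eqVlt; apply/orP; left; apply/eqP.
apply: eq_bigr => i /= ik; rewrite endpoint_take_sub ?leq_addl //.
by rewrite take_drop.
Qed.

Lemma pathE_lt_antitone (f : Z4 -> R) x (c : R) m n : (forall y, 0 <= f y) ->
  (m <= n)%N ->
  pathE n (fun s => (pathsum f x s < c)%R%:R : R) <=
  pathE m (fun s => (pathsum f x s < c)%R%:R).
Proof.
move=> f0 mn; rewrite -(subnKC mn).
rewrite -[leRHS](pathE_take m (n - m) (fun s => (pathsum f x s < c)%R%:R)).
apply: pathE_le => s _; rewrite ler_nat.
case: (ltP (pathsum f x s)) => // h.
by rewrite (le_lt_trans (pathsum_take_le x m s f0) h).
Qed.

(** If past and future together stay below [2 * c], one of them is below [c]. Both have at least [m]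
    steps and, by [pathE_lt_antitone], a longer path is no more likely to stay below. *)
Lemma pathE_bad_le (a c : R) n m k x (tau : R) : 1 <= a -> (m <= k)%N ->
  (k + m <= n)%N ->
  pathE m (fun s => (pathsum (hker a) (- x) s < c)%R%:R : R) <= tau ->
  pathE n (fun s => (range_potential a n k s x < 2 * c - 1)%R%:R : R) <= 2 * tau.
Proof.
move=> a1 mk kmn htau.
have h0 y : 0 <= hker a y :> R by apply: ltW; apply: hker_gt0; lra.
have kn : (k <= n)%N by apply: leq_trans kmn; exact: leq_addr.
pose ind s : R := (pathsum (hker a) (- x) s < c)%R%:R.
have pt s : size s = n -> (range_potential a n k s x < 2 * c - 1)%R%:R <=
    ind (drop k s) + ind (rev (map -%R (take k s))).
  move=> sn; have := range_potential_ge x a1 sn kn; rewrite /ind.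
  case: ltP => [bad|_] /=; last by rewrite addr_ge0 ?ler0n.
  case: ltP => [_ _|h1]; first by rewrite lerDl ler0n.
  case: ltP => [_ _|h2]; first by rewrite lerDr ler0n.
  by move=> h; exfalso; lra.
apply: le_trans (pathE_le pt) _; rewrite pathED.
have -> : pathE n (fun s => ind (drop k s)) = pathE (n - k) ind.
  by rewrite -{1}(subnKC kn) pathE_drop.
have -> : pathE n (fun s => ind (rev (map -%R (take k s)))) = pathE k ind.
  rewrite -{1}(subnKC kn) (pathE_take k (n - k) (fun s => ind (rev (map -%R s)))).
  rewrite (pathE_opp k (fun s => ind (rev s))).
  by rewrite pathE_rev.
rewrite mulr_natl mulr2n; apply: lerD; apply: le_trans htau; apply: pathE_lt_antitone => //.
by rewrite leq_subRL.
Qed.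

Lemma sum_ind_ltn m n : \sum_(0 <= k < n) (k < m)%N%:R <= m%:R :> R.
Proof.
have -> : \sum_(0 <= k < n) (k < m)%N%:R = (minn n m)%:R :> R.
  elim: n => [|n IH]; first by rewrite big_nil min0n.
  rewrite big_nat_recr //= IH -natrD; congr _%:R.
  by case: (ltnP n m) => nm /=; lia.
by rewrite ler_nat geq_minr.
Qed.

(** Times closer than [m] to either end get the trivial bound 1, hence [2 * m]; all others get
    [2 * tau] from [pathE_bad_le]. *)
Lemma pathE_bad_count_le (A : set Z4) (a c : R) n m (tau : R) :
  1 <= a -> (m <= n)%N -> 0 <= tau ->
  (forall x, x \in fset_set A ->
    pathE m (fun s => (pathsum (hker a) (- x) s < c)%R%:R : R) <= tau) ->
  pathE n (fun s => \sum_(0 <= k < n.+1) \sum_(x <- fset_set A)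
      (range_potential a n k s x < 2 * c - 1)%R%:R : R) <=
  (size (fset_set A))%:R * (2 * m%:R + 2 * n.+1%:R * tau).
Proof.
move=> a1 mn tau0 htau.
rewrite pathE_sum.
pose I k : R := (k < m)%N%:R + (n - k < m)%N%:R + 2 * tau.
apply: (@le_trans _ _ (\sum_(0 <= k < n.+1) (size (fset_set A))%:R * I k)).
  rewrite big_nat [leRHS]big_nat; apply: ler_sum => k /= kn.
  rewrite pathE_sum; apply: (@le_trans _ _ (\sum_(x <- fset_set A) I k)); last first.
    by rewrite big_const_seq count_predT iter_addr_0 mulr_natl.
  rewrite big_seq [leRHS]big_seq; apply: ler_sum => x xA; rewrite /I.
  have p1 : pathE n (fun s => (range_potential a n k s x < 2 * c - 1)%R%:R : R) <= 1.
    by rewrite -[leRHS](pathE_cst n 1); apply: pathE_le => s _; case: ltP.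
  case: (ltnP k m) => km; first by apply: le_trans p1 _; rewrite -addrA lerDl addr_ge0 ?ler0n // mulr_ge0.
  case: (ltnP (n - k) m) => nkm; first by apply: le_trans p1 _; rewrite add0r lerDl mulr_ge0.
  rewrite !add0r; apply: pathE_bad_le (htau _ xA) => //.
  by move: kn nkm; lia.
rewrite -mulr_sumr ler_wpM2l ?ler0n // /I !big_split /= sumr_const_nat subn0.
have : \sum_(0 <= k < n.+1) (n - k < m)%N%:R <= m%:R :> R.
  rewrite big_nat_rev /= add0n; apply: le_trans (sum_ind_ltn m n.+1).
  rewrite big_nat [leRHS]big_nat; apply: ler_sum => k /= kn.
  by rewrite subSS subKn.
have := sum_ind_ltn m n.+1.
rewrite -[(2 * tau) *+ n.+1]mulr_natr; lra.
Qed.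

End bad_points.

(** * From the probability space to path expectations *)

Definition nbrs : seq Z4 :=
  [seq unitv i | i <- enum 'I_4] ++ [seq - unitv i | i <- enum 'I_4].

Fixpoint paths (n : nat) : seq (seq Z4) :=
  if n is m.+1 then [seq e :: t | e <- nbrs, t <- paths m] else [:: [::]].

Definition increments (T : Type) (X : nat -> T -> Z4) (n : nat) (w : T) : seq Z4 :=
  [seq increment X k w | k <- iota 0 n].

Section path_space.
Variable R : realType.

Lemma nbrs_uniq : uniq nbrs.
Proof.
have uI : injective unitv.
  by move=> i j /rowP /(_ i) /eqP; rewrite !unitvE eqxx eqr_nat; case: (i =P j).
have u1 : uniq [seq unitv i | i <- enum 'I_4] by rewrite (map_inj_uniq uI) enum_uniq.
have u2 : uniq [seq - unitv i | i <- enum 'I_4].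
  by rewrite map_inj_uniq ?enum_uniq // => i j /oppr_inj /uI.
rewrite cat_uniq u1 u2 andbT andTb; apply/hasPn => _ /mapP[i _ ->]; apply/negP => /mapP[j _].
by move=> /rowP /(_ i); rewrite mxE !unitvE eqxx; case: (_ == _).
Qed.

Lemma norm1_unitv i : norm1 (unitv i) = 1.
Proof.
rewrite /norm1 (bigD1 i) //= unitvE eqxx normr1 big1 ?addr0 // => j /negbTE ji.
by rewrite unitvE ji normr0.
Qed.

Lemma norm1_nbrs e : e \in nbrs -> norm1 e = 1.
Proof.
rewrite mem_cat => /orP[] /mapP[i _ ->]; first exact: norm1_unitv.
by rewrite -(norm1_unitv i); apply: eq_bigr => j _; rewrite mxE normrN.
Qed.

Lemma paths_uniq n : uniq (paths n).
Proof.
elim: n => //= n IH; apply: allpairs_uniq => //; first exact: nbrs_uniq.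
by move=> [e s] [e' s'] _ _ [-> ->].
Qed.

Lemma size_in_paths n s : s \in paths n -> size s = n.
Proof.
elim: n s => [|n IH] s /=; first by rewrite inE => /eqP ->.
by move=> /allpairsP[[e t] [_ /IH tn ->]] /=; rewrite tn.
Qed.

Lemma mem_paths n s e : s \in paths n -> e \in s -> e \in nbrs.
Proof.
elim: n s => [|n IH] s /=; first by rewrite inE => /eqP ->.
move=> /allpairsP[[e' t] /= [e'n /IH ht ->]].
by rewrite inE => /predU1P[-> //|]; exact: ht.
Qed.

Lemma sum_paths n (F : seq Z4 -> R) :
  \sum_(s <- paths n) F s * (8^-1) ^+ n = pathE n F.
Proof.
elim: n F => [|n IH] F /=; first by rewrite big_seq1 expr0 mulr1.
transitivity (\sum_(e <- nbrs) \sum_(t <- paths n) F (e :: t) * 8^-1 ^+ n.+1).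
  exact: big_allpairs_dep.
have E e : \sum_(t <- paths n) F (e :: t) * 8^-1 ^+ n.+1 = pathE n (fun t => F (e :: t)) / 8.
  by rewrite -IH mulr_suml; apply: eq_bigr => t _; rewrite exprSr mulrA.
rewrite (eq_bigr _ (fun e _ => E e)) -mulr_suml; congr (_ / _).
by rewrite big_split /nbrs big_cat /=; congr (_ + _); rewrite big_map big_enum.
Qed.

Variables (d : measure_display) (T : measurableType d) (P : probability T R).
Variable X : nat -> T -> Z4.
Hypothesis hX : simple_random_walk P X.

Local Notation inc := (increments X).

Lemma size_increments n w : size (inc n w) = n.
Proof. by rewrite size_map size_iota. Qed.

Lemma take_increments n k w : (k <= n)%N -> take k (inc n w) = inc k w.
Proof. by move=> kn; rewrite -map_take take_iota; congr map; congr iota; lia. Qed.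

Lemma endpoint_increments n w : endpoint (inc n w) = X n w.
Proof.
case: hX => X0 _ _ _; rewrite /endpoint big_map.
elim: n => [|n IH]; first by rewrite big_nil X0.
have -> : iota 0 n.+1 = iota 0 n ++ [:: n] by rewrite -addn1 iotaD.
by rewrite big_cat /= IH big_seq1 /increment addrC subrK.
Qed.

Lemma walk_range_visited n w : walk_range X n w = visited n (inc n w).
Proof.
rewrite /walk_range /visited; apply/seteqP; split => x /= [k kn <-]; exists k => //;
  by rewrite take_increments // endpoint_increments.
Qed.

Lemma increments_eqE n w s : size s = n ->
  inc n w = s <-> forall k, (k < n)%N -> increment X k w = nth 0 s k.
Proof.
move=> sn; split=> [<- k kn|h].
  by rewrite (nth_map 0%N) ?size_iota // nth_iota.
apply: (@eq_from_nth _ 0); rewrite size_increments // => k kn.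
by rewrite (nth_map 0%N) ?size_iota // nth_iota // h.
Qed.

Lemma measurable_increments_eq n s : measurable [set w | inc n w = s].
Proof.
case: hX => _ mX _ _.
have [sn|sn] := eqVneq (size s) n; last first.
  rewrite (_ : [set w | _] = set0); first exact: measurable0.
  by apply/seteqP; split => // w /= h; rewrite -h size_increments eqxx in sn.
rewrite (_ : [set w | _] = \bigcap_(k in `I_n) (increment X k @^-1` [set nth 0 s k])).
  by apply: fin_bigcap_measurable => [|k _]; [exact: finite_II | exact: mX].
apply/seteqP; split => w /=.
  by move=> /(increments_eqE _ sn) h k kn /=; exact: h.
by move=> h; apply/(increments_eqE _ sn) => k kn; exact: h.
Qed.

(** Lists of lattice points form a countable type, so every event about the increments is a
    countable union of atoms. Hence any function of them is measurable, the capacity included. *)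
Lemma measurable_increments n (S : set (seq Z4)) : measurable (inc n @^-1` S).
Proof.
rewrite (_ : _ @^-1` S = \bigcup_(s in S) [set w | inc n w = s]).
  rewrite bigcup_mkcond; apply: countable_bigcupT_measurable => [|s]; first exact: countableP.
  by case: ifP => // _; exact: measurable_increments_eq.
by apply/seteqP; split => w /=; [move=> h; exists (inc n w) | move=> [s Ss /= ->]].
Qed.

Lemma measurable_fun_increments n d' (U : measurableType d') (F : seq Z4 -> U) :
  measurable_fun setT (fun w => F (inc n w)).
Proof.
move=> _ B _; rewrite setTI.
exact: (measurable_increments n (F @^-1` B)).
Qed.

Lemma probability_increments_eq n s : s \in paths n ->
  P [set w | inc n w = s] = ((8^-1) ^+ n)%:E.
Proof.
move=> sp; have sn := size_in_paths sp.
case: hX => _ _ indep unif.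
pose J : {fset nat} := [fset k | k in iota 0 n]%fset.
have memJ k : (k \in J) = (k < n)%N by rewrite in_fset mem_iota add0n.
have -> : [set w | inc n w = s] =
    \bigcap_(k in [set` J]) (increment X k @^-1` [set nth 0 s k]).
  apply/seteqP; split => w /=.
    by move=> /(increments_eqE _ sn) h k /=; rewrite memJ => kn; exact: h.
  by move=> h; apply/(increments_eqE _ sn) => k kn; apply: h; rewrite /= memJ.
rewrite (indep J (fun k => [set nth 0 s k])).
rewrite big_seq (eq_bigr (fun=> (8^-1)%:E)); last first.
  move=> k; rewrite memJ => kn; rewrite unif (norm1_nbrs (mem_paths sp _)) ?eqxx //.
  by rewrite mem_nth // sn.
rewrite -big_seq prodEFin; congr (_%:E).
rewrite big_const_seq count_predT iter_mulr_1; congr (_ ^+ _).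
by rewrite -/(#|` J|) card_fseq undup_id ?iota_uniq // size_iota.
Qed.

(** Each list in [paths n] has probability [8^-n], and these probabilities already add up to 1. *)
Lemma increments_paths_ae n : {ae P, forall w, inc n w \in paths n}.
Proof.
have mS : measurable [set w | inc n w \in paths n].
  exact: (measurable_increments n [set s | s \in paths n]).
exists (~` [set w | inc n w \in paths n]); split => //; first exact: measurableC.
rewrite probability_setC //.
suff -> : P [set w | inc n w \in paths n] = 1%E by rewrite subee.
rewrite (_ : [set w | _] = \bigcup_(s in [set` paths n]) [set w | inc n w = s]); last first.
  apply/seteqP; split => w /=; first by move=> h; exists (inc n w).
  by move=> [s sp /= ->].
rewrite measure_fin_bigcup //=; last 2 first.
- by move=> s t _ _ [w [/= <- <-]].
- by move=> s _; exact: measurable_increments_eq.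
rewrite -fsbig_seq ?paths_uniq //.
rewrite big_seq (eq_bigr _ (fun s => @probability_increments_eq n s)) -big_seq.
rewrite sumEFin; congr (_%:E).
rewrite -[RHS](pathE_cst n 1) -sum_paths.
by apply: eq_bigr => s _; rewrite mul1r.
Qed.

Lemma integral_increments n (F : seq Z4 -> R) : (forall s, 0 <= F s) ->
  (\int[P]_w (F (inc n w))%:E = (pathE n F)%:E)%E.
Proof.
move=> F0.
pose I (s : seq Z4) (w : T) : \bar R := ((F s)%:E * (\1_[set w | inc n w = s] w)%:E)%E.
pose G w := (\sum_(s <- paths n) I s w)%E.
have mG s : measurable_fun setT (I s).
  apply: measurable_funeM; apply/measurable_EFinP; apply: measurable_indic.
  exact: measurable_increments_eq.
have G0 s w : (0 <= I s w)%E.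
  by rewrite mule_ge0 ?lee_fin.
transitivity (\int[P]_w G w)%E.
  apply: ge0_ae_eq_integral => //.
  - exact: (measurable_fun_increments n (fun s => (F s)%:E)).
  - by apply: emeasurable_sum => s; exact: mG.
  - by move=> w _; rewrite lee_fin.
  - by move=> w _; apply: sume_ge0 => s _.
  apply: filterS (increments_paths_ae n) => w wp _.
  rewrite /G (bigD1_seq (inc n w)) ?paths_uniq //= /I indicE mem_set // mule1.
  rewrite big1 ?adde0 // => s sw; rewrite indicE memNset ?mule0 //= => h.
  by rewrite h eqxx in sw.
rewrite ge0_integral_sum //.
rewrite -sum_paths -sumEFin big_seq [RHS]big_seq; apply: eq_bigr => s sp.
rewrite ge0_integralZl_EFin //; last first.
  by apply/measurable_EFinP; apply: measurable_indic; exact: measurable_increments_eq.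
rewrite integral_indic //; last exact: measurable_increments_eq.
by rewrite EFinM -(probability_increments_eq sp) setIT.
Qed.

Lemma green_ggreen x : green P X x = (ggreen R x)%:E.
Proof.
rewrite /green integral_nneseries //; last first.
  move=> n; rewrite (_ : (fun w => _) =
    (fun w => ((endpoint (increments X n w) == x)%:R : R)%:E)); last first.
    by apply/funext => w; rewrite endpoint_increments.
  exact: (measurable_fun_increments n (fun s => ((endpoint s == x)%:R : R)%:E)).
have E n : (\int[P]_w ((X n w == x)%:R : R)%:E = (avgn n (delta0 R) x)%:E)%E.
  rewrite (eq_integral (fun w => ((endpoint (inc n w) == x)%:R : R)%:E)); last first.
    by move=> w _; rewrite endpoint_increments.
  rewrite (integral_increments n (F := fun s => (endpoint s == x)%:R)) //.
  (* [avgn n (delta0 R) x] is the probability that the walk from [x] ends at 0; changing the signs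
     of the steps makes it that of going from 0 to [x]. *)
  rewrite -(pathE_endpoint n _ x) -pathE_opp; congr (_%:E); apply: eq_pathE => s _.
  by rewrite endpoint_opp /delta0 addrC eq_sym -subr_eq0 opprK addrC.
under eq_eseriesr do rewrite E.
apply: cvg_lim => //.
rewrite (_ : (fun n => _) = (fun n => (gpart R n x)%:E)); last first.
  by apply/funext => n; rewrite sumEFin.
by apply: cvg_EFin; [exact: nearW | exact: gpart_cvg].
Qed.

Lemma capacity_walk A n w :
  capacity (green P X) (minkowski_sum (walk_range X n w) A) =
  range_capacity R A n (inc n w).
Proof.
rewrite /range_capacity walk_range_visited; congr capacity.
by apply/funext => x; rewrite green_ggreen.
Qed.

Lemma expected_capacity_le A n (F : seq Z4 -> R) : (forall s, 0 <= F s) ->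
  (forall s, size s = n -> (0 <= range_capacity R A n s <= (F s)%:E)%E) ->
  (\int[P]_w capacity (green P X) (minkowski_sum (walk_range X n w) A) <=
   (pathE n F)%:E)%E.
Proof.
move=> F0 FA; rewrite -integral_increments //.
under eq_integral do rewrite capacity_walk.
apply: ge0_le_integral => //.
- by move=> w _; have /andP[] := FA _ (size_increments n w).
- exact: (measurable_fun_increments n (range_capacity R A n)).
- exact: (measurable_fun_increments n (fun s => (F s)%:E)).
- by move=> w _; have /andP[] := FA _ (size_increments n w).
Qed.

Lemma expected_capacity_ge A n (F : seq Z4 -> R) :
  (forall s, size s = n -> (0 <= range_capacity R A n s)%E) ->
  (forall s, size s = n -> ((F s)%:E <= range_capacity R A n s)%E) ->
  ((pathE n F)%:E <=
   \int[P]_w capacity (green P X) (minkowski_sum (walk_range X n w) A))%E.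
Proof.
(* The tangent bound used as [F] may be negative; its positive part keeps all integrands
   nonnegative. *)
move=> A0 FA; apply: (@le_trans _ _ (pathE n (fun s => Num.max (F s) 0))%:E).
  by rewrite lee_fin; apply: pathE_le => s _; rewrite le_max lexx.
rewrite -integral_increments; last by move=> s; rewrite le_max lexx orbT.
under [leRHS]eq_integral do rewrite capacity_walk.
apply: ge0_le_integral => //.
- by move=> w _; rewrite lee_fin le_max lexx orbT.
- exact: (measurable_fun_increments n (fun s => (Num.max (F s) 0)%:E)).
- exact: (measurable_fun_increments n (range_capacity R A n)).
- move=> w _; rewrite EFin_max ge_max A0 ?FA ?size_increments //.
Qed.

End path_space.

(** * The limit *)

Definition expected_capacity (R : realType) d (T : measurableType d)
    (P : probability T R) (X : nat -> T -> Z4) (A : set Z4) n : \bar R :=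
  (\int[P]_w capacity (green P X) (minkowski_sum (walk_range X n w) A))%E.

Section expected_capacity_bounds.
Variable R : realType.
Variables (d : measure_display) (T : measurableType d) (P : probability T R).
Variable X : nat -> T -> Z4.
Hypothesis hX : simple_random_walk P X.
Variables (A : set Z4) (finA : finite_set A) (A0 : A !=set0).

Local Notation EC := (expected_capacity P X A).

Let range_capacity_ge0 n s : (0 <= range_capacity R A n s)%E.
Proof.
apply: le_trans (range_capacity_ge R n s finA A0).
by rewrite lee_fin divr_ge0 ?sqr_ge0 // ltW // interaction_gt0.
Qed.

Lemma expected_capacity_lower (e : R) : 0 < e -> e < 1 ->
  exists B : R, forall n, (0 < n)%N -> B <= ln n%:R ->
  ((pi ^+ 2 / 8 * (1 - e) ^+ 2)%:E <= (ln n%:R / n%:R)%:E * EC n)%E.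
Proof.
move=> e0 e1.
have [a0 a08 mass] := qker_mass e0 (ltW e1).
have a08' : a0 <= a0 + 1 by lra.
have [_ [N HN]] := mass _ a08'.
have [C HC] := fsum_bound a08 (box_uniq N).
set q := pi ^+ 2 / 2 * (1 - e) in HN.
have p0 := pi_gt0 R.
have q0 : 0 < q by rewrite mulr_gt0 ?divr_gt0 ?exprn_gt0 //; lra.
(* [C] is the additive error of [fsum_bound]; the 2 comes from
   [2 * ln (1 + n.+1 / a0) <= 2 + 2 * L]. *)
pose C' := `|C| + 2; have C0 : 0 < C' by rewrite ltr_wpDl.
exists (C' / e + 1) => n n0 BL; set L := ln n%:R in BL *.
have nR : 1 <= n%:R :> R by rewrite ler1n.
have L0 : 0 < L by apply: lt_le_trans BL; rewrite ltr_wpDl // divr_ge0 ?ltW.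
have eL : C' <= e * L by rewrite mulrC -ler_pdivrMr //; lra.
have n10 : 0 < n.+1%:R :> R by [].
pose w := 2 * n.+1%:R * ((C' + 2 * L) / q).
have w0 : 0 < w by rewrite !mulr_gt0 ?invr_gt0 //; lra.
have lnb : 2 * ln (1 + n.+1%:R / a0) <= 2 + 2 * L.
  have : ln (1 + n.+1%:R / a0) <= ln (2 * n%:R).
    rewrite ler_ln ?posrE; last 2 first.
    - by rewrite ltr_wpDr // divr_ge0 //; lra.
    - by lra.
    have : n.+1%:R / a0 <= n%:R by rewrite ler_pdivrMr -?natr1; nra.
    lra.
  rewrite lnM ?posrE //; last by lra.
  have := @le_ln_sub1 R 2; rewrite ltr0n => /(_ isT); rewrite -/L; lra.
have fw : 2 * n.+1%:R * fsum R n.+1 0 <= w.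
  rewrite ler_wpM2l ?mulr_ge0 // ler_pdivlMr //.
  have f0 := fsum_ge0 R n.+1 0.
  have h1 : q * fsum R n.+1 0 <= (\sum_(y <- box N) qker (a0 + 1) y) * fsum R n.+1 0.
    by rewrite ler_wpM2r.
  have := HC n.+1; have := ler_norm C; rewrite /C' (mulrC _ q); lra.
have lb := pathE_tangent_ge w0 fw.
have EClb : ((n.+1%:R ^+ 2 / w)%:E <= EC n)%E.
  apply: le_trans (expected_capacity_ge hX (F := fun s => n.+1%:R ^+ 2 * (2 / w - interaction R n s / w ^+ 2)) _ _) => //.
  by move=> s _; exact: range_capacity_ge_tangent.
apply: (@le_trans _ _ ((ln n%:R / n%:R)%:E * (n.+1%:R ^+ 2 / w)%:E)%E); last first.
  by rewrite lee_wpmul2l // lee_fin divr_ge0 // ltW.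
rewrite -EFinM lee_fin -/L.
have -> : L / n%:R * (n.+1%:R ^+ 2 / w) = (n.+1%:R / n%:R) * (L * q / (2 * (C' + 2 * L))).
  rewrite /w; field; rewrite !gt_eqF //; lra.
have h1 : 1 <= n.+1%:R / n%:R :> R.
  by rewrite ler_pdivlMr ?mul1r ?ler_nat //; lra.
have D0 : 0 < 2 * (C' + 2 * L) by lra.
(* One factor [1 - e] is the mass defect in [q], the other absorbs [C' <= e * L]. *)
have h2 : pi ^+ 2 / 8 * (1 - e) ^+ 2 <= L * q / (2 * (C' + 2 * L)).
  rewrite ler_pdivlMr // /q.
  have -> : pi ^+ 2 / 8 * (1 - e) ^+ 2 * (2 * (C' + 2 * L)) =
    (pi ^+ 2 / 2 * (1 - e)) * ((1 - e) * (C' + 2 * L) / 2) by field.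
  rewrite mulrC ler_wpM2r ?(ltW q0) //.
  nra.
apply: le_trans h2 _; rewrite ler_peMl //.
by rewrite divr_ge0 // ?(ltW D0) // mulr_ge0 // ltW.
Qed.

(** The exponential beats a cube of order [L ^+ 3], and one power is lost to [1 + l <= 2 * L]. The
    remaining [L ^+ 2] is what makes the number of bad points small against [n / ln n]. *)
Lemma tail_decay (c K L l e : R) : 0 < c -> 0 <= K -> 1 <= L -> e <= 1 / 2 ->
  (1 - e) * L <= l -> l <= L ->
  K * expR (- (c * l)) * (1 + l) <= K * (2 * 6 ^+ 3 / c ^+ 3) / L ^+ 2.
Proof.
move=> c0 K0 L1 e2 Ll lL.
have l0 : 0 < l by nra.
have hl : L / 2 <= l by nra.
have E : (c * L / 6) ^+ 3 <= expR (c * l).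
  have -> : c * l = 3%:R * (c * l / 3) by field.
  rewrite expRM_natl.
  have h : c * L / 6 <= expR (c * l / 3).
    have : c * (L / 2) <= c * l by rewrite ler_pM2l.
    have := expR_ge1Dx (c * l / 3); lra.
  by rewrite lerXn2r ?nnegrE ?expR_ge0 // divr_ge0 // mulr_ge0 //; lra.
have -> : K * (2 * 6 ^+ 3 / c ^+ 3) / L ^+ 2 =
  K * (2 * 6 ^+ 3 * ((c ^+ 3)^-1 / L ^+ 2)) by ring.
rewrite -mulrA ler_wpM2l // expRN mulrC ler_pdivrMr ?expR_gt0 //.
apply: (@le_trans _ _ (2 * L)); first by lra.
apply: (@le_trans _ _ (2 * 6 ^+ 3 * ((c ^+ 3)^-1 / L ^+ 2) * (c * L / 6) ^+ 3)).
  rewrite le_eqVlt; apply/orP; left; apply/eqP; field; rewrite !gt_eqF //; lra.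
rewrite ler_wpM2l // mulr_ge0 ?mulr_ge0 ?exprn_ge0 ?ler0n // ?invr_ge0 ?exprn_ge0 //.
- exact: ltW.
- lra.
Qed.

(* The window length [m ~ n / ln^2 n] is negligible against [n / ln n] but has
   the same logarithm up to a factor [1 - e]. *)
Lemma log_window (e : R) : 0 < e -> e <= 1 ->
  exists B : R, forall n, (0 < n)%N -> B <= ln n%:R ->
  exists m, [/\ (0 < m)%N, (m <= n)%N, m%:R * ln n%:R ^+ 2 <= n%:R :> R &
    (1 - e) * ln n%:R <= ln m%:R :> R].
Proof.
move=> e0 e1; pose K := 4 / e.
have K0 : 0 < K by rewrite divr_gt0.
exists (2 * (2 * `|ln K| + 1) / e + 1) => n n0; set L := ln n%:R => BL.
have nR : 1 <= n%:R :> R by rewrite ler1n.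
have L1 : 1 <= L.
  apply: le_trans BL; rewrite lerDr divr_ge0 ?(ltW e0) //.
have L0 : 0 < L by lra.
have lnL : 2 * ln L + 1 <= e * L.
  have h := ln_le_div_add_ln L0 K0.
  have h2 : L / K = e * L / 4 by rewrite /K; field; rewrite gt_eqF.
  have h3 := ler_norm (ln K).
  have h4 : 2 * (2 * `|ln K| + 1) <= e * L.
    by rewrite [leRHS]mulrC -ler_pdivrMr //; lra.
  lra.
have L2 : 0 < L ^+ 2 by rewrite exprn_gt0.
pose y := n%:R / L ^+ 2.
have y0 : 0 < y by rewrite divr_gt0 //; lra.
have lny : ln y = L - 2 * ln L.
  by rewrite ln_div ?posrE ?ltr0n // lnXn // mulr_natl.
have y1 : 1 <= y.
  rewrite leNgt; apply/negP => /(conj y0)/andP/ln_lt0; rewrite lny.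
  have : e * L <= L by rewrite ler_piMl // ltW.
  lra.
exists (Num.truncn y).
have ty : (Num.truncn y)%:R <= y by rewrite truncn_le ltW.
have m0 : (0 < Num.truncn y)%N by rewrite truncn_gt0.
have mL : (Num.truncn y)%:R * L ^+ 2 <= n%:R by rewrite -ler_pdivlMr.
have mR : 1 <= (Num.truncn y)%:R :> R by rewrite ler1n.
split => //.
  rewrite -(@ler_nat R); apply: le_trans mL.
  by rewrite ler_peMr ?ler0n // expr2; nra.
have y2 : y <= 2 * (Num.truncn y)%:R.
  by have := truncnS_gt y; rewrite -natr1 => /ltW; lra.
have : ln y <= ln (2 * (Num.truncn y)%:R).
  by rewrite ler_ln ?posrE //; lra.
rewrite lnM ?posrE //; last by lra.
have := @le_ln_sub1 R 2; rewrite ltr0n => /(_ isT); rewrite lny.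
lra.
Qed.

(** The tail threshold and the window length each cost a factor [1 - e]; the third factor absorbs
    the [- 1] due to the doubly counted time. *)
Lemma threshold_ge (e L l : R) : 0 < e -> e <= 1 / 8 -> 1 <= e * L ->
  (1 - e) * L <= l -> 4 * (1 - e) ^+ 3 * L <= 2 * (2 * (1 - e) * l) - 1.
Proof.
move=> e0 e8 L1e lm.
have h1 : 4 * (1 - e) * ((1 - e) * L) <= 4 * (1 - e) * l by rewrite ler_wpM2l //; lra.
have h2 : 1 <= 4 * (1 - e) ^+ 2 * (e * L).
  have : 1 <= 4 * (1 - e) ^+ 2 by rewrite expr2; nra.
  by move=> h; rewrite (le_trans L1e) // ler_peMl // (le_trans ler01).
have -> : 4 * (1 - e) ^+ 3 * L = 4 * (1 - e) * ((1 - e) * L) - 4 * (1 - e) ^+ 2 * (e * L) by ring.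
lra.
Qed.

(** The bad points contribute at most [N * (2 + 4 * D) / L <= e], because the window satisfies
    [m <= n / L ^+ 2] and the tail is [D / L ^+ 2]; the rest is the main term with
    [(n + 1) / n <= 1 + e]. *)
Lemma upper_rate (e L n m D N Q sg : R) : 0 < e -> e <= 1 / 8 -> 1 <= L -> L <= n ->
  1 <= e * L -> N * (2 + 4 * D) <= e * L -> 0 <= D -> 0 <= N -> 0 <= Q ->
  m * L ^+ 2 <= n -> 4 * (1 - e) ^+ 3 * L <= sg ->
  L / n * ((n + 1) * Q / sg + N * (2 * m + 2 * (n + 1) * (D / L ^+ 2))) <=
  (1 + e) * (Q / (4 * (1 - e) ^+ 3)) + e.
Proof.
move=> e0 e8 L1 nL L1e NL D0 N0 Q0 mL sgL.
have L0 : 0 < L by lra.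
have n0 : 0 < n by lra.
have D4 : 0 < 4 * (1 - e) ^+ 3 by rewrite mulr_gt0 // exprn_gt0 //; lra.
have sg0 : 0 < sg by apply: lt_le_trans sgL; rewrite mulr_gt0.
have n1 : (n + 1) / n <= 1 + e.
  rewrite ler_pdivrMr //.
  have : 1 <= e * n by apply: le_trans L1e _; rewrite ler_pM2l.
  lra.
have n10 : 0 <= (n + 1) / n by rewrite divr_ge0 //; lra.
rewrite mulrDr; apply: lerD.
  have -> : L / n * ((n + 1) * Q / sg) = (n + 1) / n * (Q * (L / sg)).
    by field; rewrite !gt_eqF.
  have Lsg : L / sg <= (4 * (1 - e) ^+ 3)^-1.
    by rewrite ler_pdivrMr // mulrC ler_pdivlMr // mulrC.
  have Lsg0 : 0 <= L / sg by rewrite divr_ge0 // ltW.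
  by apply: ler_pM (mulr_ge0 Q0 Lsg0) n1 _ => //; rewrite ler_wpM2l.
have -> : L / n * (N * (2 * m + 2 * (n + 1) * (D / L ^+ 2))) =
    N * (2 * (m * L / n) + 2 * ((n + 1) / n) * (D / L)).
  by field; rewrite !gt_eqF.
have h1 : m * L / n <= L^-1.
  by rewrite ler_pdivrMr // [leRHS]mulrC ler_pdivlMr // -mulrA -expr2.
have h3 : 2 * ((n + 1) / n) * (D / L) <= 4 * (D / L).
  rewrite ler_wpM2r ?divr_ge0 ?(ltW L0) //; lra.
apply: (@le_trans _ _ (N * (2 + 4 * D) / L)); last by rewrite ler_pdivrMr.
rewrite -[leRHS]mulrA ler_wpM2l // [leRHS]mulrDl; lra.
Qed.

Lemma expected_capacity_upper (e : R) : 0 < e -> e <= 1 / 8 ->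
  exists B : R, forall n, (0 < n)%N -> B <= ln n%:R ->
  ((ln n%:R / n%:R)%:E * EC n <=
   (pi ^+ 2 / 8 * ((1 + e) ^+ 2 / (1 - e) ^+ 3) + e)%:E)%E.
Proof.
move=> e0 e8.
have e1 : e <= 1 by lra.
have [a0 a08 mass] := qker_mass e0 e1.
(* [qker_mass] asks for [a >= a0] and [lower_tail_bound] for [a >= 128]. *)
pose a := a0 + 128.
have aa0 : a0 <= a by rewrite /a; lra.
have a128 : 128 <= a by rewrite /a; lra.
have a9 : 9 <= a by lra.
have a1 : 1 <= a by lra.
have ne0 : 0 < 1 - e by lra.
have e2 : e <= 1 / 2 by lra.
have [Qle _] := mass _ aa0.
set Q := pi ^+ 2 / 2 * (1 + e) in Qle.
have QE : pi ^+ 2 / 8 * ((1 + e) ^+ 2 / (1 - e) ^+ 3) =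
    (1 + e) * (Q / (4 * (1 - e) ^+ 3)).
  by rewrite /Q; field; rewrite gt_eqF.
have p0 := pi_gt0 R.
have Q0 : 0 <= Q by rewrite mulr_ge0 ?divr_ge0 ?exprn_ge0 //; lra.
have [cK HcK] : exists cK : Z4 -> R * R, forall x, [/\ 0 < (cK x).1, 0 <= (cK x).2 &
    forall m, (0 < m)%N ->
    pathE m (fun s => (pathsum (hker a) (- x) s < 2 * (1 - e) * ln m%:R)%R%:R : R) <=
    (cK x).2 * expR (- ((cK x).1 * ln m%:R)) * (1 + ln m%:R)].
  have /choice [cK HcK] : forall x : Z4, exists ck : R * R, [/\ 0 < ck.1, 0 <= ck.2 &
    forall m, (0 < m)%N ->
    pathE m (fun s => (pathsum (hker a) (- x) s < 2 * (1 - e) * ln m%:R)%R%:R : R) <=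
    ck.2 * expR (- (ck.1 * ln m%:R)) * (1 + ln m%:R)].
    move=> x; have [c c0 [K K0 HK]] := lower_tail_bound (- x) a128 e0 e1.
    by exists (c, K).
  by exists cK.
(* The tail constants depend on the starting point [- x]; their sum over the finite set [A] bounds
   all of them. *)
pose D : R := \sum_(x <- fset_set A) (cK x).2 * (2 * 6 ^+ 3 / (cK x).1 ^+ 3).
have D0 : 0 <= D.
  apply: sumr_ge0 => x _; have [c0 K0 _] := HcK x.
  by rewrite mulr_ge0 ?divr_ge0 ?exprn_ge0 // ltW.
pose NA : R := (size (fset_set A))%:R.
have NA0 : 0 <= NA by rewrite ler0n.
have [B HB] := log_window e0 e1.
exists (`|B| + 1 / e + NA * (2 + 4 * D) / e + 1) => n n0; set L := ln n%:R => BL.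
have nR : 1 <= n%:R :> R by rewrite ler1n.
have t0 : 0 <= NA * (2 + 4 * D) / e by rewrite divr_ge0 ?mulr_ge0 ?(ltW e0) //; lra.
have e10 : 0 < 1 / e by rewrite divr_gt0.
have B0 := normr_ge0 B; have BB := ler_norm B.
have [|m [m0 mn mL lm]] := HB n n0; first by rewrite -/L; lra.
rewrite -/L in mL lm.
have L1 : 1 <= L by lra.
have L0 : 0 < L by lra.
have L1e : 1 <= e * L by rewrite [leRHS]mulrC -ler_pdivrMr //; lra.
have mR : 1 <= m%:R :> R by rewrite ler1n.
have lmL : ln m%:R <= L by rewrite /L ler_ln ?posrE ?ltr0n // ler_nat.
set l := ln m%:R in lm lmL.
pose tau := D / L ^+ 2.
have tau0 : 0 <= tau by rewrite divr_ge0 // exprn_ge0 // ltW.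
have htau x : x \in fset_set A ->
    pathE m (fun s => (pathsum (hker a) (- x) s < 2 * (1 - e) * l)%R%:R : R) <= tau.
  move=> xA; have [c0 K0 HK] := HcK x.
  apply: le_trans (HK m m0) _.
  apply: le_trans (tail_decay c0 K0 L1 e2 lm lmL) _.
  rewrite /tau ler_wpM2r ?invr_ge0 ?exprn_ge0 ?(ltW L0) //.
  rewrite /D (bigD1_seq x) ?fset_uniq //= lerDl.
  apply: sumr_ge0 => y _; have [cy0 Ky0 _] := HcK y.
  by rewrite mulr_ge0 ?divr_ge0 ?exprn_ge0 // ltW.
pose sg := 2 * (2 * (1 - e) * l) - 1.
have sgL : 4 * (1 - e) ^+ 3 * L <= sg by exact: threshold_ge.
have sg0 : 0 < sg.
  by apply: lt_le_trans sgL; rewrite mulr_gt0 // mulr_gt0 // exprn_gt0.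
pose F s := n.+1%:R * Q / sg + \sum_(0 <= k < n.+1) \sum_(x <- fset_set A)
      (range_potential a n k s x < sg)%R%:R.
have F0 s : 0 <= F s.
  rewrite addr_ge0 ?divr_ge0 ?(mulr_ge0 _ Q0) ?(ltW sg0) //.
  by apply: sumr_ge0 => k _; apply: sumr_ge0 => x _; rewrite ler0n.
have ECF : (EC n <= (pathE n F)%:E)%E.
  apply: (expected_capacity_le hX F0) => s _.
  by rewrite range_capacity_ge0 range_capacity_le.
have pF : pathE n F <= n.+1%:R * Q / sg + NA * (2 * m%:R + 2 * n.+1%:R * tau).
  by rewrite /F pathED pathE_cst lerD2l; exact: pathE_bad_count_le.
have Ln0 : 0 <= L / n%:R by rewrite divr_ge0 ?ler0n // ltW.
apply: (@le_trans _ _ ((L / n%:R)%:E *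
    (n.+1%:R * Q / sg + NA * (2 * m%:R + 2 * n.+1%:R * tau))%:E)%E).
  by rewrite lee_wpmul2l ?lee_fin //; apply: le_trans ECF _; rewrite lee_fin.
rewrite -EFinM lee_fin QE.
rewrite -natr1; apply: upper_rate => //.
- by apply: ltW; apply: ln_sublinear; rewrite ltr0n.
- by rewrite [leRHS]mulrC -ler_pdivrMr //; lra.
Qed.

End expected_capacity_bounds.

Theorem proposition1p8 (R : realType) (d : measure_display)
    (T : measurableType d) (P : probability T R) (X : nat -> T -> Z4)
    (hX : simple_random_walk P X)
    (A : set Z4) (finA : finite_set A) (A0 : A !=set0) :
  ((ln n%:R / n%:R)%:E *
     \int[P]_w capacity (green P X) (minkowski_sum (walk_range X n w) A))%E
    @[n --> \oo] --> ((pi ^+ 2 / 8 : R)%:E).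
Proof.
pose EC := expected_capacity P X A.
set c : R := pi ^+ 2 / 8.
have c0 : 0 < c by rewrite divr_gt0 ?exprn_gt0 ?pi_gt0.
have close r : 0 < r -> \forall n \near \oo,
    ((c - r)%:E <= (ln n%:R / n%:R)%:E * EC n <= (c + r)%:E)%E.
  move=> r0.
  (* For [e <= 1 / 8] the factor [(1 + e)^2 / (1 - e)^3] is at most [1 + 10 e], so the upper error
     is at most [10 c e + e <= r]; the lower error is at most [2 c e]. *)
  pose e := Num.min (1 / 8) (r / (10 * c + 1)).
  have D0 : 0 < 10 * c + 1 by lra.
  have e0 : 0 < e by rewrite lt_min !divr_gt0.
  have e8 : e <= 1 / 8 by rewrite ge_min lexx.
  have ec : e * (10 * c + 1) <= r by rewrite -ler_pdivlMr // ge_min lexx orbT.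
  have e1 : e < 1 by lra.
  have [B1 H1] := expected_capacity_lower hX finA A0 e0 e1.
  have [B2 H2] := expected_capacity_upper hX finA A0 e0 e8.
  near=> n.
  have n0 : (0 < n)%N by near: n; exists 1%N.
  have nB : expR (Num.max B1 B2) <= n%:R by near: n; exact: nbhs_infty_ger.
  have nR : (0 : R) < n%:R by rewrite ltr0n.
  move: nB; rewrite -[leRHS](lnK nR) ler_expR ge_max => /andP[n1 n2].
  apply/andP; split.
    apply: le_trans (H1 n n0 n1); rewrite lee_fin -/c.
    have : c * (1 - 2 * e) <= c * (1 - e) ^+ 2 by rewrite ler_wpM2l ?(ltW c0) //; nra.
    have := mulr_ge0 (ltW c0) (ltW e0); lra.
  apply: le_trans (H2 n n0 n2) _; rewrite lee_fin -/c.
  have : (1 + e) ^+ 2 / (1 - e) ^+ 3 <= 1 + 10 * e.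
    rewrite ler_pdivrMr ?exprn_gt0 ?subr_gt0 //.
    have -> : (1 + 10 * e) * (1 - e) ^+ 3 =
      (1 + e) ^+ 2 + e * (5 - 28 * e + 29 * e ^+ 2 - 10 * e ^+ 3) by ring.
    rewrite lerDl mulr_ge0 ?(ltW e0) //.
    have : 0 <= e ^+ 2 * (29 - 10 * e) by rewrite mulr_ge0 ?sqr_ge0 //; lra.
    lra.
  move=> /(ler_wpM2l (ltW c0)); lra.
apply/fine_cvgP; split.
  near=> n.
  have /andP[l u] : ((c - 1)%:E <= (ln n%:R / n%:R)%:E * EC n <= (c + 1)%:E)%E.
    by near: n; exact: close.
  by rewrite fin_numE; apply/andP; split; apply/eqP => E; move: l u; rewrite /EC /expected_capacity E.
apply/cvgrPdist_le => r r0; near=> n.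
have : ((c - r)%:E <= (ln n%:R / n%:R)%:E * EC n <= (c + r)%:E)%E.
  by near: n; exact: close.
rewrite /comp -/(EC n); case: (_ * EC n)%E => [x| |].
- by rewrite !lee_fin /= => h; rewrite ler_distlC.
- by rewrite leye_eq andbF.
- by rewrite leeNy_eq.
Unshelve. all: by end_near. Qed.
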